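(* Let $n \geq 3$. A map $Z : \mathcal{T}_o^n \to \mathcal{K}_o^n$ is an $\mathrm{SL}(n)$ covariant Minkowski valuation if and only if there exist constants $a_1,a_2,b_1,b_2,c_1,c_2 \geq 0$ satisfying $a_1 \leq a_2$, $b_1 \leq b_2$, $a_2-a_1 \leq b_2$ and $b_2-b_1 \leq a_2$ such that $$ZT = c_1 M^+ T + c_2 M^- T + D_{a_1,a_2,b_1,b_2} T$$ for every $T \in \mathcal{T}_o^n$.
   Context: $\mathcal{K}_o^n$ denotes the set of convex bodies (compact convex sets) in $\mathbb{R}^n$ containing the origin $o$, and $\mathcal{T}_o^n$ the set of simplices (of any dimension $0\le d\le n$) in $\mathbb{R}^n$ having the origin as one of their vertices. $+$ denotes Minkowski addition. A map $Z:\mathcal{T}_o^n\to\mathcal{K}_o^n$ is a Minkowski valuation if $Z(K\cup L)+Z(K\cap L)=ZK+ZL$ whenever $K,L,K\cup L,K\cap L\in\mathcal{T}_o^n$; it is $\mathrm{SL}(n)$ covariant if $Z(\phi K)=\phi ZK$ for all $\phi\in\mathrm{SL}(n)$. The moment bodies are defined by $h_{M^+K}(x)=\int_K \max\{x\cdot y,0\}\,dy$, $h_{M^-K}(x)=\int_K \max\{-x\cdot y,0\}\,dy$ (Lebesgue measure on $\mathbb{R}^n$), $h$ denoting support functions. For $T=[o,v_1,\dots,v_d]$ with $o,v_1,\dots,v_d$ affinely independent and $2\le d\le n$, $D_{a_1,a_2,b_1,b_2}T = \mathrm{conv}\{a_2v_i-b_2v_j,\ a_2v_i-(a_2-a_1)v_j,\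 (b_2-b_1)v_i-b_2v_j : 1\le i,j\le d\}$; for $T=[o,v_1]$, $D_{a_1,a_2,b_1,b_2}T=[-b_1v_1,a_1v_1]$; and $D_{a_1,a_2,b_1,b_2}\{o\}=\{o\}$. Here $[\cdot]$ denotes convex hull. *)

(* Defs.v *)
From HB Require Import structures.
From mathcomp Require Import all_boot all_order all_algebra.
From mathcomp Require Import all_classical all_reals all_analysis.
Set Implicit Arguments. Unset Strict Implicit. Unset Printing Implicit Defensive.
Import Order.TTheory GRing.Theory Num.Theory.
Import numFieldNormedType.Exports.
Local Open Scope classical_set_scope.
Local Open Scope ring_scope.

Section Defs.
Variable R : realType.

Definition vdot n (x y : 'cV[R]_n) : R := \sum_(i < n) x i 0 * y i 0.

Definition mink_sum n (A B : set 'cV[R]_n) : set 'cV[R]_n :=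
  [set a + b | a in A & b in B].
Definition bscale n (c : R) (A : set 'cV[R]_n) : set 'cV[R]_n :=
  [set c *: a | a in A].
Definition limage n (phi : 'M[R]_n) (A : set 'cV[R]_n) : set 'cV[R]_n :=
  [set phi *m a | a in A].

Definition conv_seq n (s : seq 'cV[R]_n) : set 'cV[R]_n :=
  [set x | exists w : 'I_(size s) -> R,
     (forall i, 0 <= w i) /\ \sum_i w i = 1 /\ x = \sum_i w i *: s`_i].

Definition convex_set_ n (K : set 'cV[R]_n) : Prop :=
  forall x y t, K x -> K y -> 0 <= t -> t <= 1 -> K ((1 - t) *: x + t *: y).

Definition convex_body_o n (K : set 'cV[R]_n) : Prop :=
  compact K /\ convex_set_ K /\ K 0.

(* the simplex [o, v_1, ..., v_d] with o, v_1, ..., v_d affinely independent,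
   i.e. v_1, ..., v_d linearly independent *)
Definition osimplex n (vs : seq 'cV[R]_n) : set 'cV[R]_n := conv_seq (0 :: vs).

Definition is_osimplex n (T : set 'cV[R]_n) : Prop :=
  exists vs : seq 'cV[R]_n, free vs /\ T = osimplex vs.

Definition minkowski_valuation n (Z : set 'cV[R]_n -> set 'cV[R]_n) : Prop :=
  forall K L, is_osimplex K -> is_osimplex L -> is_osimplex (K `|` L) ->
    is_osimplex (K `&` L) ->
    mink_sum (Z (K `|` L)) (Z (K `&` L)) = mink_sum (Z K) (Z L).

Definition SLn_covariant n (Z : set 'cV[R]_n -> set 'cV[R]_n) : Prop :=
  forall (phi : 'M[R]_n) K, \det phi = 1 -> is_osimplex K ->
    Z (limage phi K) = limage phi (Z K).

(* Integration with respect to Lebesgue measure on R^n, realised as the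
   iterated integral of one-dimensional Lebesgue integrals (equal to the
   n-dimensional Lebesgue integral for nonnegative measurable integrands by
   Tonelli). *)
Fixpoint lebesgue_int (n : nat) : ('cV[R]_n -> \bar R) -> \bar R :=
  match n return ('cV[R]_n -> \bar R) -> \bar R with
  | 0 => fun f => f 0
  | m.+1 => fun f =>
      (\int[@lebesgue_measure R]_t
         lebesgue_int (fun s : 'cV[R]_m =>
                         f (col_mx (const_mx t : 'cV[R]_1) s)))%E
  end.

(* The convex body with support function h (h sublinear). *)
Definition body_of_support n (h : 'cV[R]_n -> \bar R) : set 'cV[R]_n :=
  [set z | forall x, ((vdot x z)%:E <= h x)%E].

Definition Mplus n (K : set 'cV[R]_n) : set 'cV[R]_n :=
  body_of_support (fun x => lebesgue_int
    (fun y => (\1_K y * Num.max (vdot x y) 0)%:E)).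
Definition Mminus n (K : set 'cV[R]_n) : set 'cV[R]_n :=
  body_of_support (fun x => lebesgue_int
    (fun y => (\1_K y * Num.max (- vdot x y) 0)%:E)).

Definition Dbody n (a1 a2 b1 b2 : R) (vs : seq 'cV[R]_n) : set 'cV[R]_n :=
  match vs with
  | [::] => [set 0]
  | [:: v] => conv_seq [:: - (b1 *: v); a1 *: v]
  | _ => conv_seq
      ([seq a2 *: vi - b2 *: vj | vi <- vs, vj <- vs] ++
       [seq a2 *: vi - (a2 - a1) *: vj | vi <- vs, vj <- vs] ++
       [seq (b2 - b1) *: vi - b2 *: vj | vi <- vs, vj <- vs])
  end.

End Defs.

(* Main.v *)
(* A body [Z T] is determined by its support function, which by covariance
   depends only on the values [x . v_i] at the nonzero vertices [v_i] of [T] and,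
   for [T] of full dimension, on [det (v_1, ..., v_n)].  Cutting [T] through a
   point [w] of an edge [v_1 v_2] gives a functional equation in these values.
   In dimensions 1 and 2 it is solved by the support function of [D]; in
   dimensions 3 <= d < n the difference to [D] vanishes whenever two values
   coincide, hence always, since one can cut at the middle one of three values.
   In dimension n the same cut shows, with Cauchy's functional equation for the
   determinant, that the difference is [det] times a function satisfying the
   recursion of a divided difference, so it is determined by its values at
   [e_1] and [- e_1], which are matched by the two moment bodies.  The sign of
   [a1 - a2] and [b1 - b2] is read off from sublinearity when [det -> 0].

   Conversely, the moment bodies are valuations by additivity of the integral,
   and the support function of [D] depends on the maximum and the minimum of
   [x] on the facet opposite to the origin; if neither of two simplices with
   convex union contains the other, these facets lie in a common hyperplane. *)
Require Import Defs.
From HB Require Import structures.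
From mathcomp Require Import all_boot all_order all_algebra.
From mathcomp Require Import all_classical all_reals all_analysis.
From mathcomp Require Import measurable_realfun perm zify ring lra.
Set Implicit Arguments. Unset Strict Implicit. Unset Printing Implicit Defensive.
Import Order.TTheory GRing.Theory Num.Theory.
Import numFieldNormedType.Exports.
Local Open Scope classical_set_scope.
Local Open Scope ring_scope.

(** * Inner products and weighted combinations *)

(** No continuity of [Z] is assumed. The only regularity available is that every body contains the
    origin, so its support function is nonnegative; this one-sided bound already excludes the wild
    solutions of Cauchy's equation. Having at least three dimensions matters in three places: a
    third vertex supplies the middle value for a cut, a 3-cycle permutes the vertices with
    determinant 1, and a third coordinate can keep the maximum additive where the minimum is not.
    Two definitions shape the preparations. A moment body is an intersection of half-spaces, so
    identifying its support function is a Hahn-Banach argument. The integral over the space is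
    iterated, so the behaviour under linear maps has to be derived by reducing a matrix to block
    triangular matrices and a swap of coordinates. The converse must handle any two simplices whose
    union and intersection are simplices, not only the two pieces of an edge cut. *)

Section InnerProduct.
Variables (R : realType) (n : nat).
Implicit Types (x y z u v w : 'cV[R]_n) (A : 'M[R]_n) (s t vs : seq 'cV[R]_n).

Lemma vdotE x y : vdot x y = (x^T *m y) 0 0.
Proof. by rewrite mxE; apply: eq_bigr => i _; rewrite mxE. Qed.

Lemma vdotC x y : vdot x y = vdot y x.
Proof. by apply: eq_bigr => i _; rewrite mulrC. Qed.

Lemma vdotDr x y z : vdot x (y + z) = vdot x y + vdot x z.
Proof. by rewrite !vdotE mulmxDr mxE. Qed.

Lemma vdotDl x y z : vdot (y + z) x = vdot y x + vdot z x.
Proof. by rewrite vdotC vdotDr !(vdotC x). Qed.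

Lemma vdotZr x k y : vdot x (k *: y) = k * vdot x y.
Proof. by rewrite !vdotE -scalemxAr mxE. Qed.

Lemma vdotZl x k y : vdot (k *: y) x = k * vdot y x.
Proof. by rewrite vdotC vdotZr vdotC. Qed.

Lemma vdotNr x y : vdot x (- y) = - vdot x y.
Proof. by rewrite -scaleN1r vdotZr mulN1r. Qed.

Lemma vdotNl x y : vdot (- y) x = - vdot y x.
Proof. by rewrite vdotC vdotNr vdotC. Qed.

Lemma vdotBr x y z : vdot x (y - z) = vdot x y - vdot x z.
Proof. by rewrite vdotDr vdotNr. Qed.

Lemma vdotBl x y z : vdot (y - z) x = vdot y x - vdot z x.
Proof. by rewrite vdotDl vdotNl. Qed.

Lemma vdot0r x : vdot x 0 = 0.
Proof. by rewrite -(scale0r x) vdotZr mul0r. Qed.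

Lemma vdot0l x : vdot 0 x = 0.
Proof. by rewrite vdotC vdot0r. Qed.

Definition vdot_simp := (vdotDr, vdotDl, vdotNr, vdotNl, vdotZr, vdotZl,
  vdot0r, vdot0l).

Lemma vdot_mulmxr x A y : vdot x (A *m y) = vdot (A^T *m x) y.
Proof. by rewrite !vdotE trmx_mul trmxK mulmxA. Qed.

Lemma vdot_deltal i y : vdot (delta_mx i 0) y = y i 0.
Proof.
rewrite /vdot (bigD1 i)//= mxE !eqxx mul1r big1 ?addr0// => j ji.
by rewrite mxE (negPf ji) mul0r.
Qed.

Lemma vdot_deltar i y : vdot y (delta_mx i 0) = y i 0.
Proof. by rewrite vdotC vdot_deltal. Qed.

Lemma vdot_ge0 x : 0 <= vdot x x.
Proof. by apply: sumr_ge0 => i _; rewrite -expr2 sqr_ge0. Qed.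

Lemma vdot_eq0 x : (vdot x x == 0) = (x == 0).
Proof.
apply/eqP/eqP => [/psumr_eq0P x0|->]; last by rewrite vdot0r.
apply/colP => i; rewrite mxE; apply/eqP.
by rewrite -sqrf_eq0 expr2 x0// => j _; rewrite -expr2 sqr_ge0.
Qed.

Lemma vdot_gt0 x : x != 0 -> 0 < vdot x x.
Proof. by move=> x0; rewrite lt0r vdot_eq0 x0 vdot_ge0. Qed.

Lemma colE_sum y : y = \sum_i y i 0 *: delta_mx i 0.
Proof.
apply/colP => j; rewrite summxE (bigD1 j)//= !mxE !eqxx mulr1 big1 ?addr0// => i ij.
by rewrite !mxE eq_sym (negPf ij) mulr0.
Qed.

Fixpoint weighted s (a : R) x : Prop :=
  match s with
  | [::] => a = 0 /\ x = 0
  | v :: s' => exists2 t, 0 <= t & weighted s' (a - t) (x - t *: v)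
  end.

Lemma weightedP s a x : weighted s a x <->
  exists c : 'I_(size s) -> R,
    (forall i, 0 <= c i) /\ \sum_i c i = a /\ x = \sum_i c i *: s`_i.
Proof.
elim: s a x => [|v s IH] a x /=.
  split=> [[-> ->]|[c [_ [<- ->]]]]; last by rewrite !big_ord0.
  by exists (fun=> 0); rewrite !big_ord0.
split=> [[t t0 /IH[c [c0 [ca cx]]]]|[c [c0 [<- ->]]]].
  exists (fun i => if unlift ord0 i is Some j then c j else t); split.
    by move=> i; case: unlift.
  rewrite !big_ord_recl /= !unlift_none.
  under eq_bigr => i _ do rewrite liftK.
  under [in X in _ /\ X]eq_bigr => i _ do rewrite liftK /=.
  by rewrite ca -cx !(addrC t, addrC (t *: v)) !subrK.
exists (c ord0) => //; apply/IH; exists (fun i => c (lift ord0 i)); split=> //.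
by rewrite !big_ord_recl /= !(addrC (c ord0), addrC (c ord0 *: v)) !addrK.
Qed.

Lemma conv_seqP s x : conv_seq s x <-> weighted s 1 x.
Proof. by rewrite weightedP. Qed.

Lemma weighted_ge0 s a x : weighted s a x -> 0 <= a.
Proof.
elim: s a x => [|v s IH] a x /=; first by case=> ->.
by case=> t t0 /IH; rewrite subr_ge0; exact: le_trans.
Qed.

Lemma weightedZ s k a x : 0 <= k -> weighted s a x -> weighted s (k * a) (k *: x).
Proof.
move=> k0; elim: s a x => [|v s IH] a x /=; first by case=> -> ->; rewrite mulr0 scaler0.
case=> t t0 /IH; rewrite mulrBr scalerBr scalerA.
by exists (k * t) => //; exact: mulr_ge0.
Qed.

Lemma weightedD s a b x y : weighted s a x -> weighted s b y ->
  weighted s (a + b) (x + y).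
Proof.
elim: s a b x y => [|v s IH] a b x y /=.
  by case=> -> -> [-> ->]; rewrite !addr0.
case=> t t0 /IH h [u u0 /h]; exists (t + u); first exact: addr_ge0.
by rewrite scalerDl !opprD addrACA [x + _ + _]addrACA.
Qed.

Lemma weighted0 s : weighted s 0 0.
Proof.
by elim: s => //= v s IH; exists 0 => //; rewrite scale0r !subr0.
Qed.

Lemma weighted_cons v s a x : weighted s a x -> weighted (v :: s) a x.
Proof. by move=> h; exists 0 => //; rewrite scale0r !subr0. Qed.

Lemma weighted_mem s v : v \in s -> weighted s 1 v.
Proof.
elim: s => //= w s IH; rewrite inE => /orP[/eqP ->|/IH h].
  by exists 1 => //; rewrite scale1r !subrr; exact: weighted0.
exact: weighted_cons.
Qed.

Lemma weighted_sub s t a x : (forall v, v \in s -> weighted t 1 v) ->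
  weighted s a x -> weighted t a x.
Proof.
elim: s a x => [|v s IH] a x st /=; first by case=> -> ->; exact: weighted0.
case=> k k0 /IH h.
rewrite -[a](subrK k) -[x](subrK (k *: v)); apply: weightedD.
  by apply: h => w ws; apply: st; rewrite inE ws orbT.
by rewrite -[k in weighted _ k _]mulr1; apply: weightedZ => //; apply: st; exact: mem_head.
Qed.

Lemma weighted_linear s a x u k : (forall v, v \in s -> vdot u v = k) ->
  weighted s a x -> vdot u x = k * a.
Proof.
elim: s a x => [|v s IH] a x uk /=; first by case=> -> ->; rewrite vdot0r mulr0.
case=> t t0 /IH h.
have {}h : vdot u (x - t *: v) = k * (a - t).
  by apply: h => w ws; apply: uk; rewrite inE ws orbT.
by move: h; rewrite mulrBr vdotBr vdotZr (uk v) ?mem_head// (mulrC t) => /addIr.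
Qed.

Lemma weighted_le s a x u k : (forall v, v \in s -> vdot u v <= k) ->
  weighted s a x -> vdot u x <= k * a.
Proof.
elim: s a x => [|v s IH] a x uk /=; first by case=> -> ->; rewrite vdot0r mulr0.
case=> t t0 /IH h.
have {}h : vdot u (x - t *: v) <= k * (a - t).
  by apply: h => w ws; apply: uk; rewrite inE ws orbT.
have := ler_wpM2l t0 (uk v (mem_head _ _)).
by move: h; rewrite mulrBr vdotBr vdotZr (mulrC k t); lra.
Qed.

Lemma weighted_map A s a y :
  weighted [seq A *m v | v <- s] a y <-> exists2 x, weighted s a x & y = A *m x.
Proof.
elim: s a y => [|v s IH] a y /=.
  split=> [[-> ->]|[x [-> ->] ->]]; last by rewrite mulmx0.
  by exists 0; rewrite ?mulmx0.
split=> [[t t0 /IH[x sx yx]]|[x [t t0 sx] ->]].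
  exists (x + t *: v); last by rewrite mulmxDr -scalemxAr -yx subrK.
  by exists t => //; rewrite addrK.
exists t => //; apply/IH; exists (x - t *: v) => //.
by rewrite mulmxBr -scalemxAr.
Qed.

Lemma osimplexP vs x : osimplex vs x <-> exists2 b, b <= 1 & weighted vs b x.
Proof.
rewrite /osimplex conv_seqP /=; split=> [[t t0]|[b b1 bx]].
  by rewrite scaler0 subr0 => h; exists (1 - t) => //; rewrite gerBl.
by exists (1 - b); rewrite ?subr_ge0// scaler0 subr0 opprB addrCA subrr addr0.
Qed.

Lemma osimplex0 vs : osimplex vs 0.
Proof. by apply/osimplexP; exists 0 => //; exact: weighted0. Qed.

Lemma osimplex_mem vs v : v \in vs -> osimplex vs v.
Proof. by move=> vvs; apply/osimplexP; exists 1 => //; exact: weighted_mem. Qed.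

Lemma osimplex_sub vs ws : (forall v, v \in vs -> osimplex ws v) ->
  osimplex vs `<=` osimplex ws.
Proof.
move=> vw x /conv_seqP /weighted_sub h; apply/conv_seqP/h => v.
rewrite inE => /orP[/eqP ->|/vw/conv_seqP//]; apply/conv_seqP/osimplex0.
Qed.

Lemma eq_mem_osimplex vs ws : vs =i ws -> osimplex vs = osimplex ws.
Proof.
by move=> vw; apply/seteqP; split; apply: osimplex_sub => v; rewrite ?vw => h;
  apply: osimplex_mem; rewrite ?vw.
Qed.

Lemma limage_osimplex A vs :
  limage A (osimplex vs) = osimplex [seq A *m v | v <- vs].
Proof.
apply/seteqP; split=> [_ [x /osimplexP[b b1 bx] <-]|y /osimplexP[b b1 /weighted_map[x bx ->]]].
  by apply/osimplexP; exists b => //; apply/weighted_map; exists x.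
by exists x => //; apply/osimplexP; exists b.
Qed.

(** The columns of [V] are [vs] followed by a basis of a complement of its span, so every simplex is
    a linear image of a coordinate simplex. *)
Lemma free_complete vs : free vs ->
  exists2 V : 'M[R]_n, V \in unitmx &
    (size vs <= n)%N /\ forall j : 'I_n, (j < size vs)%N -> vs`_j = V *m delta_mx j 0.
Proof.
move=> fvs; pose ws := vs ++ vbasis <<vs>>^C.
have bws : basis_of fullv ws.
  rewrite -(addv_complf <<vs>>); apply: cat_basis.
  - by apply/directv_addP; rewrite capv_compl.
  - by rewrite /basis_of eqxx fvs.
  - exact: vbasisP.
have sws : size ws = n.
  by have := basis_free bws; rewrite /free (span_basis bws) dimvf => /eqP <-;
    rewrite /dim /= muln1.
pose V : 'M[R]_n := \matrix_(i, j) ws`_j i 0.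
have VE (c : 'cV[R]_n) : V *m c = \sum_(j < n) c j 0 *: ws`_j.
  apply/colP => i; rewrite mxE summxE; apply: eq_bigr => j _.
  by rewrite !mxE mulrC.
(* The coordinates of the standard vectors in the completed basis form the inverse of [V]. *)
pose W : 'M[R]_n := \matrix_(i, j)
  coord (in_tuple ws) (cast_ord (esym sws) i) (delta_mx j 0 : 'cV[R]_n).
exists V.
  suff /mulmx1_unit[] : V *m W = 1%:M by [].
  apply/matrixP => i j; rewrite !mxE.
  have : delta_mx j 0 \in <<in_tuple ws>>%VS by rewrite (span_basis bws) memvf.
  move=> /coord_span/(congr1 (fun z : 'cV[R]_n => z i 0)).
  rewrite summxE mxE andbT => ->.
  rewrite (reindex (cast_ord (esym sws))) /=; last first.
    by exists (cast_ord sws) => k _; rewrite ?cast_ordK ?cast_ordKV.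
  by apply: eq_bigr => k _; rewrite !mxE mulrC.
split; first by apply: (@leq_trans (size ws)); rewrite ?size_cat ?leq_addr// -size_cat sws.
move=> j jvs; rewrite VE (bigD1 j)//= mxE !eqxx scale1r big1 => [|i ij].
  by rewrite addr0 nth_cat jvs.
by rewrite mxE (negPf ij) scale0r.
Qed.

(** With its converse [dual_free], this is the working form of linear independence: values on the
    vectors can be prescribed freely. *)
Lemma free_dual vs (c : nat -> R) : free vs ->
  exists u, forall i, (i < size vs)%N -> vdot u vs`_i = c i.
Proof.
move=> /free_complete[V Vu [vsn VE]].
exists ((invmx V)^T *m \col_i c i) => i ivs.
have i_n : (i < n)%N by exact: leq_trans vsn.
rewrite (VE (Ordinal i_n))// vdot_mulmxr mulmxA -trmx_mul mulVmx// trmx1 mul1mx.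
by rewrite vdot_deltar mxE.
Qed.

(** The first row of the inverse of [V] beyond those dual to [vs] is orthogonal to all of [vs]. *)
Lemma free_perp vs : free vs -> (size vs < n)%N ->
  exists2 u, u != 0 & forall v, v \in vs -> vdot u v = 0.
Proof.
move=> /free_complete[V Vu [vsn VE]] svs.
exists ((invmx V)^T *m delta_mx (Ordinal svs) 0).
  apply/eqP => /(congr1 (mulmx V^T)); rewrite mulmxA -trmx_mul mulVmx// trmx1 mul1mx mulmx0.
  by move=> /colP/(_ (Ordinal svs))/eqP; rewrite !mxE !eqxx oner_eq0.
move=> v /(nthP 0)[i ivs <-].
have i_n : (i < n)%N by exact: leq_trans vsn.
rewrite (VE (Ordinal i_n))// vdot_mulmxr mulmxA -trmx_mul mulVmx// trmx1 mul1mx.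
by rewrite vdot_deltar mxE -val_eqE /= (ltn_eqF ivs).
Qed.

End InnerProduct.

(** * Support functions of convex bodies *)

Lemma continuous_sum_ord (R : realType) (V : normedModType R)
    (T : topologicalType) (m : nat) (f : 'I_m -> T -> V) :
  (forall i, continuous (f i)) -> continuous (fun x => \sum_i f i x).
Proof.
move=> fc; apply: continuous_big => [|i _]; last exact: fc.
exact: (@pseudometric_normed_Zmodule.add_continuous _ V).
Qed.

Lemma continuous_coordZ (R : realType) (V : normedModType R) p q (i : 'I_p)
    (j : 'I_q) (v : V) : continuous (fun y : 'M[R]_(p, q) => y i j *: v).
Proof.
move=> y.
exact: (continuous_comp (@coord_continuous _ _ _ i j y) (@scalel_continuous _ _ v _)).
Qed.

Section SupportFunction.
Variables (R : realType) (n : nat).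
Implicit Types (x y z u v : 'cV[R]_n) (A : 'M[R]_n) (s vs : seq 'cV[R]_n)
  (K L : set 'cV[R]_n) (g : 'cV[R]_n -> R).

Definition support K x : R := sup [set vdot x y | y in K].

Definition cbody K := [/\ compact K, convex_set_ K & K !=set0].

Lemma vdot_continuous x : continuous (fun y => vdot x y).
Proof.
apply: (@continuous_sum_ord R R^o) => i y; apply: continuousM; first exact: cst_continuous.
exact: coord_continuous.
Qed.

Lemma supportE K x c : K c -> (forall y, K y -> vdot x y <= vdot x c) ->
  support K x = vdot x c.
Proof.
move=> Kc maxc; apply/eqP; rewrite eq_le; apply/andP; split.
  by apply: ge_sup; [exists (vdot x c); exists c|move=> _ [y Ky <-]; exact: maxc].
apply: ub_le_sup; last by exists c.
by exists (vdot x c) => _ [y Ky <-]; exact: maxc.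
Qed.

Lemma support_argmax K x : compact K -> K !=set0 ->
  exists2 c, K c & forall y, K y -> vdot x y <= vdot x c.
Proof.
move=> cK K0; have [|c cK' cmax] := @compact_EVT_max _ R (vdot x) K K0 cK.
  by apply: continuous_subspaceT; exact: vdot_continuous.
exists c; first by rewrite inE in cK'.
by move=> y Ky; apply: cmax; rewrite inE.
Qed.

Lemma support_attained K x : compact K -> K !=set0 ->
  exists2 c, K c & support K x = vdot x c.
Proof.
move=> cK K0; have [c Kc cmax] := support_argmax x cK K0.
by exists c => //; exact: supportE.
Qed.

Lemma support_ub K x y : compact K -> K y -> vdot x y <= support K x.
Proof.
move=> cK Ky; have [c Kc cmax] := support_argmax x cK (ex_intro _ y Ky).
by rewrite (supportE Kc cmax) cmax.
Qed.

Definition sublinear g :=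
  (forall x y, g (x + y) <= g x + g y) /\
  (forall k x, 0 <= k -> g (k *: x) = k * g x).

Lemma support_sublinear K : compact K -> K !=set0 -> sublinear (support K).
Proof.
move=> cK K0; split=> [x y|k x k0].
  have [c Kc ->] := support_attained (x + y) cK K0.
  by rewrite vdotDl lerD// support_ub.
have [c Kc cmax] := support_argmax x cK K0.
rewrite (supportE Kc cmax) -vdotZl; apply: supportE => // y Ky.
by rewrite !vdotZl ler_wpM2l ?cmax.
Qed.

Lemma vdot_sqrD x y : vdot (x + y) (x + y) = vdot x x + 2 * vdot x y + vdot y y.
Proof. by rewrite !(vdotDl, vdotDr) (vdotC y x); ring. Qed.

(** The normal is [b - c], where [c] is the point of [K] nearest to [b]. Minimality along the
    segment from [c] to [a] gives the quadratic inequality [key]. *)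
Lemma separation K b : cbody K -> ~ K b ->
  exists x, forall a, K a -> vdot x a < vdot x b.
Proof.
move=> [cK vK K0] Kb; pose f a := vdot (a - b) (a - b).
have [|c cK' cmin] := @compact_EVT_min _ R f K K0 cK.
  apply: continuous_subspaceT; apply: (@continuous_sum_ord R R^o) => i y.
  suff h : {for y, continuous (fun a : 'cV[R]_n => (a - b) i 0)} by exact: continuousM.
  rewrite (_ : (fun a : 'cV[R]_n => _) = (fun a => a i 0 - b i 0));
    last by apply/funext => a; rewrite !mxE.
  by apply: continuousB; [exact: coord_continuous|exact: cst_continuous].
have Kc : K c by rewrite inE in cK'.
exists (b - c) => a Ka.
have bc : b - c != 0 by rewrite subr_eq0; apply/eqP => bc; rewrite bc in Kb.
have key t : 0 <= t -> t <= 1 -> 0 <= 2 * t * vdot (c - b) (a - c) + t ^+ 2 * vdot (a - c) (a - c).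
  move=> t0 t1; have := cmin ((1 - t) *: c + t *: a).
  rewrite inE => /(_ (vK _ _ _ Kc Ka t0 t1)); rewrite /f.
  have -> : (1 - t) *: c + t *: a - b = (c - b) + t *: (a - c).
    by apply/colP => i; rewrite !mxE; ring.
  rewrite vdot_sqrD !vdotZr !vdotZl -addrA lerDl => h.
  by apply: le_trans h _; rewrite le_eqVlt; apply/orP; left; apply/eqP; ring.
have ge0 : 0 <= vdot (c - b) (a - c).
  rewrite leNgt; apply/negP => lt0.
  set p := vdot (c - b) (a - c) in key lt0.
  set q := vdot (a - c) (a - c) in key.
  have q0 : 0 <= q by exact: vdot_ge0.
  have d0 : 0 < q - p by lra.
  (* For this [t] one has [t * q = - p + t * p], so [2 * p + t * q = p + t * p] is negative, against
     [key]. *)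
  pose t := - p / (q - p).
  have tE : t * (q - p) = - p by rewrite /t divfK// gt_eqF.
  have t0 : 0 < t by rewrite /t divr_gt0//; lra.
  have t1 : t <= 1 by rewrite /t ler_pdivrMr//; lra.
  have := key t (ltW t0) t1.
  have -> : 2 * t * p + t ^+ 2 * q = t * (2 * p + t * q) by ring.
  rewrite pmulr_rge0// => h.
  have : t * q = - p + t * p by rewrite -tE; ring.
  by have : t * p < 0 by [rewrite pmulr_rlt0]; lra.
have h := vdot_gt0 bc; rewrite -subr_gt0.
have -> : vdot (b - c) b - vdot (b - c) a =
    vdot (b - c) (b - c) + vdot (c - b) (a - c) by rewrite !vdot_simp; ring.
exact: ltr_wpDr.
Qed.

Lemma support_inj K L : cbody K -> cbody L -> support K =1 support L -> K = L.
Proof.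
move=> bK bL; wlog: K L bK bL / forall b, L b -> K b.
  have sub K' L' : cbody K' -> cbody L' -> support K' =1 support L' -> L' `<=` K'.
    move=> bK' bL' KL b Lb; apply: contrapT => Kb.
    have [x xab] := separation bK' Kb.
    have [[cK vK K0] [cL vL L0]] := (bK', bL').
    have [c Kc hc] := support_attained x cK K0.
    have := support_ub x cL Lb; rewrite -KL hc leNgt xab//.
  move=> _ KL; apply/seteqP; split; last exact: sub.
  by apply: sub => // x; rewrite KL.
move=> LK KL; apply/seteqP; split => // b Kb; apply: contrapT => Lb.
have [x xab] := separation bL Lb.
have [[cK vK K0] [cL vL L0]] := (bK, bL).
have [c Kc hc] := support_attained x cL L0.
by have := support_ub x cK Kb; rewrite KL hc leNgt xab.
Qed.

Lemma cbody_mink_sum K L : cbody K -> cbody L -> cbody (mink_sum K L).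
Proof.
move=> [cK vK [a Ka]] [cL vL [b Lb]]; split.
- have -> : mink_sum K L = (fun p => p.1 + p.2) @` (K `*` L).
    apply/seteqP; split=> [_ [x Kx [y Ly <-]]|_ [[x y] [/= Kx Ly] <-]].
      by exists (x, y).
    by exists x => //; exists y.
  apply: continuous_compact; last exact: compact_setX.
  by apply: continuous_subspaceT; exact: (@pseudometric_normed_Zmodule.add_continuous _ 'cV[R]_n).
- move=> _ _ t [x Kx [y Ly <-]] [x' Kx' [y' Ly' <-]] t0 t1.
  exists ((1 - t) *: x + t *: x'); first exact: vK.
  exists ((1 - t) *: y + t *: y'); first exact: vL.
  by rewrite !scalerDr addrACA.
- by exists (a + b); exists a => //; exists b.
Qed.

Lemma support_mink_sum K L x : cbody K -> cbody L ->
  support (mink_sum K L) x = support K x + support L x.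
Proof.
move=> [cK vK K0] [cL vL L0].
have [c Kc cmax] := support_argmax x cK K0.
have [d Ld dmax] := support_argmax x cL L0.
rewrite (supportE Kc cmax) (supportE Ld dmax) -vdotDr; apply: supportE.
  by exists c => //; exists d.
by move=> _ [a Ka [b Lb <-]]; rewrite !vdotDr lerD ?cmax ?dmax.
Qed.

Lemma cbody_bscale c K : cbody K -> cbody (bscale c K).
Proof.
move=> [cK vK [a Ka]]; split.
- apply: continuous_compact => //.
  by apply: continuous_subspaceT; exact: scaler_continuous.
- move=> _ _ t [x Kx <-] [y Ky <-] t0 t1.
  exists ((1 - t) *: x + t *: y); first exact: vK.
  by rewrite scalerDr !scalerA !(mulrC c).
- by exists (c *: a); exists a.
Qed.

Lemma support_bscale c K x : 0 <= c -> cbody K ->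
  support (bscale c K) x = c * support K x.
Proof.
move=> c0 [cK vK K0]; have [d Kd dmax] := support_argmax x cK K0.
rewrite (supportE Kd dmax) -vdotZr; apply: supportE; first by exists d.
by move=> _ [y Ky <-]; rewrite !vdotZr ler_wpM2l ?dmax.
Qed.

Lemma mulmx_continuous (m p : nat) (B : 'M[R]_(m, p)) : continuous (fun y : 'cV[R]_p => B *m y).
Proof.
have -> : (fun y : 'cV[R]_p => B *m y) = (fun y : 'cV[R]_p => \sum_j y j 0 *: col j B).
  apply/funext => y; apply/colP => i; rewrite mxE summxE.
  by apply: eq_bigr => j _; rewrite !mxE mulrC.
by apply: continuous_sum_ord => i; exact: continuous_coordZ.
Qed.

Lemma cbody_limage A K : cbody K -> cbody (limage A K).
Proof.
move=> [cK vK [a Ka]]; split.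
- apply: continuous_compact => //.
  by apply: continuous_subspaceT; exact: mulmx_continuous.
- move=> _ _ t [x Kx <-] [y Ky <-] t0 t1.
  exists ((1 - t) *: x + t *: y); first exact: vK.
  by rewrite mulmxDr -!scalemxAr.
- by exists (A *m a); exists a.
Qed.

Lemma support_limage A K x : cbody K ->
  support (limage A K) x = support K (A^T *m x).
Proof.
move=> [cK vK K0]; have [c Kc cmax] := support_argmax (A^T *m x) cK K0.
rewrite (supportE Kc cmax) -vdot_mulmxr; apply: supportE; first by exists c.
by move=> _ [y Ky <-]; rewrite !vdot_mulmxr cmax.
Qed.

Lemma weighted_eq0 s x : weighted s 0 x -> x = 0.
Proof.
elim: s x => [|v s IH] x /=; first by case.
case=> t t0 h; have := weighted_ge0 h; rewrite sub0r oppr_ge0 => t1.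
have tE : t = 0 by apply/eqP; rewrite eq_le t0 t1.
by move: h; rewrite tE scale0r !subr0 => /IH.
Qed.

Lemma cbody_conv_seq s : s != [::] -> cbody (conv_seq s).
Proof.
move=> s0; split.
- case: s s0 => // v s _.
  elim: s v => [|w s IH] v.
    rewrite (_ : conv_seq _ = [set v]); first exact: compact_set1.
    apply/seteqP; split=> x; last by move=> ->; apply/conv_seqP/weighted_mem/mem_head.
    move=> /conv_seqP[t t0 [/eqP]]; rewrite subr_eq0 => /eqP <-.
    by rewrite scale1r => /eqP; rewrite subr_eq0 => /eqP.
  (* Compactness by induction: the hull is a continuous image of the product of [0, 1] with the hull
     of the remaining points. *)
  have -> : conv_seq [:: v, w & s] = (fun p : R * 'cV[R]_n => p.1 *: v + (1 - p.1) *: p.2) @`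
      (`[0, 1]%classic `*` conv_seq (w :: s)).
    apply/seteqP; split=> [x /conv_seqP[t t0 tx]|_ [[t y] /= [t01 /conv_seqP wy] <-]].
      have {}tx : weighted (w :: s) (1 - t) (x - t *: v) by [].
      have t1 : t <= 1 by rewrite -subr_ge0; exact: weighted_ge0 tx.
      (* At [t = 1] no weight remains to be normalised, and any second point, here [w], will do. *)
      have [tE|tE] := eqVneq t 1.
        move: tx; rewrite tE subrr => /weighted_eq0/eqP;
          rewrite subr_eq0 scale1r => /eqP ->.
        exists (1, w) => /=; last by rewrite subrr scale0r scale1r addr0.
        split; first by rewrite /= in_itv /= ler01 lexx.
        exact/conv_seqP/weighted_mem/mem_head.
      have t1' : 0 < 1 - t by rewrite subr_gt0 lt_neqAle tE.
      exists (t, (1 - t)^-1 *: (x - t *: v)) => /=.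
        split; first by rewrite /= in_itv /= t0 t1.
        have t1V : 0 <= (1 - t)^-1 by rewrite invr_ge0 ltW.
        by have := weightedZ t1V tx; rewrite mulVf ?lt0r_neq0// => ?; exact/conv_seqP.
      by rewrite scalerA mulfV ?lt0r_neq0// scale1r addrC subrK.
    move: t01; rewrite /= in_itv /= => /andP[t0 t1].
    apply/conv_seqP; exists t => //; rewrite addrAC subrr add0r.
    have t1' : 0 <= 1 - t by rewrite subr_ge0.
    by have := weightedZ t1' wy; rewrite mulr1.
  apply: continuous_compact; last by apply: compact_setX;
    [exact: segment_compact|exact: IH].
  apply: continuous_subspaceT => p; apply: cvgD; apply: cvgZ.
  - exact: cvg_fst.
  - exact: cvg_cst.
  - by apply: cvgB; [exact: cvg_cst|exact: cvg_fst].
  - exact: cvg_snd.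
- move=> x y t /conv_seqP sx /conv_seqP sy t0 t1; apply/conv_seqP.
  have t1' : 0 <= 1 - t by rewrite subr_ge0.
  by have := weightedD (weightedZ t1' sx) (weightedZ t0 sy); rewrite !mulr1 subrK.
- by case: s s0 => // v s _; exists v; apply/conv_seqP/weighted_mem/mem_head.
Qed.

Lemma support_conv_seq s x v : v \in s ->
  (forall w, w \in s -> vdot x w <= vdot x v) ->
  support (conv_seq s) x = vdot x v.
Proof.
move=> vs vmax; apply: supportE; first exact/conv_seqP/weighted_mem.
by move=> y /conv_seqP/(weighted_le vmax); rewrite mulr1.
Qed.

End SupportFunction.

(** * Convex bodies cut out by sublinear functions *)

Section BodyOfSupport.
Variables (R : realType) (n : nat).
Implicit Types (x y z : 'cV[R]_n) (g : 'cV[R]_n -> R).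

Lemma sublinear0 g : sublinear g -> g 0 = 0.
Proof. by move=> [_ gZ]; rewrite -(scale0r 0) gZ// mul0r. Qed.

Lemma sublinearN_ge0 g x : sublinear g -> 0 <= g x + g (- x).
Proof. by move=> gs; rewrite -(sublinear0 gs) -(subrr x); exact: gs.1. Qed.

(** The function [g' x = inf_t (g (x + t y) - t g y)] is the directional derivative of [g] at [y] in
    direction [x], with step length [1 / t]. It is finite because subadditivity bounds it below by
    [- g (- x)]. *)
Lemma sublinear_step g y : sublinear g -> exists g', 
  [/\ sublinear g', forall x, g' x <= g x & g' (- y) <= - g y].
Proof.
move=> gs; have [gD gZ] := gs.
pose S x := [set g (x + t *: y) - t * g y | t in [set t | 0 <= t]].
have lbS x : lbound (S x) (- g (- x)).
  move=> _ [t t0 <-]; have := gD (x + t *: y) (- x).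
  by rewrite addrAC subrr add0r gZ//; lra.
have S0 x : S x !=set0 by exists (g (x + 0 *: y) - 0 * g y); exists 0 => //=.
have infS x : has_inf (S x) by split => //; exists (- g (- x)).
pose g' x := inf (S x).
have g'le x t : 0 <= t -> g' x <= g (x + t *: y) - t * g y.
  by move=> t0; apply: ge_inf; [exact: (infS x).2|exists t].
have le_g' x b : (forall t, 0 <= t -> b <= g (x + t *: y) - t * g y) -> b <= g' x.
  by move=> h; apply: lb_le_inf => // _ [t t0 <-]; exact: h.
have g'Zle k x : 0 < k -> g' (k *: x) <= k * g' x.
  move=> k0; rewrite mulrC -ler_pdivrMr//; apply: (le_g' _ _) => t t0.
  rewrite ler_pdivrMr//; apply: le_trans (g'le _ (k * t) _) _;
    first by rewrite mulr_ge0// ltW.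
  by rewrite -scalerA -scalerDr gZ ?(ltW k0)//; lra.
exists g'; split=> [|x|].
- split=> [x1 x2|k x].
    rewrite -lerBlDr; apply: (le_g' _ _) => t1 t10;
      rewrite lerBlDr [X in _ <= X]addrC -lerBlDr.
    apply: (le_g' _ _) => t2 t20; rewrite lerBlDr.
    apply: le_trans (g'le _ (t1 + t2) _) _; first exact: addr_ge0.
    have -> : x1 + x2 + (t1 + t2) *: y = (x1 + t1 *: y) + (x2 + t2 *: y).
      by rewrite scalerDl addrACA.
    by have := gD (x1 + t1 *: y) (x2 + t2 *: y); lra.
  rewrite le_eqVlt => /orP[/eqP <-|k0].
    rewrite scale0r mul0r; apply/eqP; rewrite eq_le; apply/andP; split.
      by have := g'le 0 0 (lexx _); rewrite scale0r addr0 (sublinear0 gs) mul0r subr0.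
    by apply: (le_g' _ _) => t t0; rewrite add0r gZ// subrr.
  apply/eqP; rewrite eq_le g'Zle//= -ler_pdivlMl// mulrC.
  have k0' : 0 < k^-1 by rewrite invr_gt0.
  have := g'Zle k^-1 (k *: x) k0'; rewrite scalerA mulVf ?gt_eqF// scale1r.
  by rewrite mulrC.
- by have := g'le x 0 (lexx _); rewrite scale0r addr0 mul0r subr0.
- by have := g'le (- y) 1 ler01; rewrite scale1r addNr (sublinear0 gs) mul1r sub0r.
Qed.

(** Linearity gained along one vector survives later steps: the functions only decrease, while
    [g x + g (- x)] stays nonnegative. *)
Lemma sublinear_linearize g (l : seq 'cV[R]_n) : sublinear g -> exists g',
  [/\ sublinear g', forall x, g' x <= g x & forall y, y \in l -> g' (- y) = - g' y].
Proof.
elim: l g => [|y l IH] g gs; first by exists g.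
have [g1 [g1s g1g g1y]] := sublinear_step y gs.
have [g2 [g2s g2g g2l]] := IH _ g1s.
exists g2; split=> // [x|z]; first exact: le_trans (g1g x).
rewrite inE => /orP[/eqP ->|]; last exact: g2l.
have := sublinearN_ge0 y g2s; have := g2g y; have := g2g (- y); have := g1g y.
by move=> *; apply/eqP; rewrite eq_le; apply/andP; split; lra.
Qed.

(** Hahn-Banach in finite dimension. Differentiating at [x0] first pins the value there; linearising
    along the coordinate axes afterwards turns the function into an inner product with [z]. *)
Lemma sublinear_subgradient g x0 : sublinear g -> exists2 z,
  vdot x0 z = g x0 & forall x, vdot x z <= g x.
Proof.
move=> gs; have [g1 [g1s g1g g1x]] := sublinear_step x0 gs.
have [g2 [g2s g2g g2l]] := sublinear_linearize [seq delta_mx i 0 | i : 'I_n] g1s.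
have {}g2l i : g2 (- delta_mx i 0) = - g2 (delta_mx i 0).
  by apply: g2l; apply/mapP; exists i; rewrite ?mem_enum.
have [g2D g2Z] := g2s.
have lin x i k : g2 (x + k *: delta_mx i 0) = g2 x + k * g2 (delta_mx i 0).
  have g2k : g2 (k *: delta_mx i 0) = k * g2 (delta_mx i 0).
    have [k0|k0] := leP 0 k; first exact: g2Z.
    rewrite -[k in LHS]opprK scaleNr -scalerN g2Z ?g2l ?mulrNN//.
    by rewrite oppr_ge0 ltW.
  have g2kN : g2 (- (k *: delta_mx i 0)) = - (k * g2 (delta_mx i 0)).
    rewrite -scaleNr; have [k0|k0] := leP k 0; first by rewrite g2Z ?oppr_ge0// mulNr.
    by rewrite scaleNr -scalerN g2Z ?g2l ?mulrN// ltW.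
  apply/eqP; rewrite eq_le; apply/andP; split; first by rewrite -g2k; exact: g2D.
  have := g2D (x + k *: delta_mx i 0) (- (k *: delta_mx i 0)).
  by rewrite addrK g2kN; lra.
pose z : 'cV[R]_n := \col_i g2 (delta_mx i 0).
have zE x : vdot x z = g2 x.
  rewrite [in RHS](colE_sum x) /vdot.
  under eq_bigr do rewrite mxE.
  elim/big_rec2: _ => [|i a b _ ->]; first by rewrite (sublinear0 g2s).
  by rewrite addrC [in RHS]addrC lin.
exists z => [|x]; last by rewrite zE (le_trans (g2g _)).
rewrite zE; apply/eqP; rewrite eq_le (le_trans (g2g _))//=.
by have := sublinearN_ge0 x0 g2s; have := g2g (- x0); lra.
Qed.

Lemma cbody_body_of_support g : sublinear g ->
  cbody (body_of_support (fun x => (g x)%:E)).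
Proof.
move=> gs; split.
- pose B := \sum_(i < n) (`|g (delta_mx i 0)| + `|g (- delta_mx i 0)|).
  have closedB : closed (body_of_support (fun x => (g x)%:E)).
    have -> : body_of_support (fun x => (g x)%:E) =
        \bigcap_(x in setT) [set z | vdot x z <= g x].
      by apply/seteqP; split=> z h x; [move=> _|]; [|rewrite lee_fin]; have := h x;
        rewrite ?lee_fin //; apply.
    apply: closed_bigI => x _.
    apply: (@preimage_closed _ _ (vdot x) [set r | r <= g x]).
      by move=> y _; exact: vdot_continuous.
    exact: closed_le.
  (* The box is the transpose of a product of intervals of row vectors, which is compact by
     Tychonoff's theorem. *)
  have cbox : compact [set z : 'cV[R]_n | forall i, z i 0 \in `[- B, B]].
    have -> : [set z : 'cV[R]_n | forall i, z i 0 \in `[- B, B]] =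
      (fun r : 'rV[R]_n => r^T) @` [set r : 'rV[R]_n | forall i, `[- B, B]%classic (r ord0 i)].
      apply/seteqP; split=> [z h|_ [r h <-] i]; last by rewrite mxE; exact: h.
      exists z^T; last by rewrite trmxK.
      by move=> i; rewrite mxE; exact: h.
    apply: continuous_compact; last first.
      by apply: (@rV_compact _ _ (fun=> `[- B, B]%classic)) => i; exact: segment_compact.
    apply: continuous_subspaceT.
    have -> : (fun r : 'rV[R]_n => r^T) = (fun r : 'rV[R]_n => \sum_j r 0 j *: delta_mx j 0).
      by apply/funext => r; rewrite [LHS]colE_sum; apply: eq_bigr => j _; rewrite mxE.
    by apply: continuous_sum_ord => i; exact: continuous_coordZ.
  apply: subclosed_compact closedB cbox _ => z zg i.
  have gB j : `|g (delta_mx j 0)| + `|g (- delta_mx j 0)| <= B.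
    by rewrite /B (bigD1 j)//= lerDl; apply: sumr_ge0 => k _; rewrite addr_ge0.
  rewrite in_itv /=; apply/andP; split.
    have := zg (- delta_mx i 0); rewrite lee_fin vdotNl vdot_deltal.
    have := gB i; have := ler_norm (g (- delta_mx i 0));
      have := normr_ge0 (g (delta_mx i 0)); lra.
  have := zg (delta_mx i 0); rewrite lee_fin vdot_deltal.
  have := gB i; have := ler_norm (g (delta_mx i 0));
    have := normr_ge0 (g (- delta_mx i 0)); lra.
- move=> y z t yg zg t0 t1 x; rewrite lee_fin vdotDr !vdotZr.
  have := yg x; have := zg x; rewrite !lee_fin => h1 h2.
  have t1' : 0 <= 1 - t by rewrite subr_ge0.
  by have := ler_wpM2l t0 h1; have := ler_wpM2l t1' h2; lra.
- by have [z _ zg] := sublinear_subgradient 0 gs; exists z => x; rewrite lee_fin.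
Qed.

Lemma support_body_of_support g x : sublinear g ->
  support (body_of_support (fun x => (g x)%:E)) x = g x.
Proof.
move=> gs; have [z zx zg] := sublinear_subgradient x gs.
rewrite -zx; apply: supportE; first by move=> y; rewrite lee_fin.
by move=> y yg; rewrite zx -lee_fin; exact: yg.
Qed.

End BodyOfSupport.

(** * Iterated Lebesgue integrals and linear changes of variables *)

(** Scaling by [|a|] the push-forward of Lebesgue measure under the affine map gives the right
    length to half-open intervals, hence is Lebesgue measure by uniqueness. *)
Lemma ge0_integral_affine (R : realType) (a b : R) (f : R -> \bar R) :
  a != 0 -> measurable_fun setT f -> (forall t, (0 <= f t)%E) ->
  (`|a|%:E * \int[@lebesgue_measure R]_t f (a * (t:R) + b)%R
   = \int[@lebesgue_measure R]_t f t)%E.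
Proof.
move=> a0 mf f0.
pose phi (t : measurableTypeR R) : measurableTypeR R := a * t + b.
have mphi : measurable_fun setT phi.
  by apply: measurable_funD => //; apply: measurable_funM.
have a_ge0 : 0 <= `|a| by [].
pose k : {nonneg R} := NngNum a_ge0.
pose nu : {measure set (measurableTypeR R) -> \bar R} := ltac:(
  unshelve refine (pushforward (@lebesgue_measure R) phi
    : {measure set (measurableTypeR R) -> \bar R}); exact: mphi).
have mue : forall A, measurable A -> lebesgue_measure A = mscale k nu A.
  apply: (@lebesgue_measure_unique R (mscale k nu)) => _ [[x y] _ <-] /=.
  rewrite [LHS]lebesgue_measure_itv /=.
  change (mscale k nu `]x, y]%classic)
    with (`|a|%:E * lebesgue_measure (phi @^-1` `]x, y]%classic))%E.
  have [a_gt0|a_lt0|aE] := ltgtP 0 a; last by rewrite -aE eqxx in a0.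
  - rewrite (_ : phi @^-1` _ = `](x - b) / a, (y - b) / a]%classic); last first.
      by apply/seteqP; split => t /=; rewrite !in_itv/= /phi ltr_pdivrMr// ler_pdivlMr// ltrBlDr lerBrDr mulrC.
    rewrite lebesgue_measure_itv/= !lte_fin ltr_pM2r ?invr_gt0// ltrD2r.
    case: ifP => // _; last by rewrite mule0.
    by rewrite -!EFinB -EFinM gtr0_norm//; congr (_%:E); field.
  - rewrite (_ : phi @^-1` _ = `[(y - b) / a, (x - b) / a[%classic); last first.
      by apply/seteqP; split => t /=; rewrite !in_itv/= /phi ltr_ndivlMr// ler_ndivrMr// ltrBlDr lerBrDr mulrC andbC.
    rewrite lebesgue_measure_itv/= !lte_fin ltr_nM2r ?invr_lt0// ltrD2r.
    case: ifP => // _; last by rewrite mule0.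
    by rewrite -!EFinB -EFinM ltr0_norm//; congr (_%:E); field.
rewrite [RHS](@eq_measure_integral _ _ _ setT (mscale k nu)); last by move=> A mA _;
  exact: mue.
rewrite ge0_integral_mscale//=; congr (_ * _)%E.
by rewrite ge0_integral_pushforward.
Qed.

Section IteratedIntegral.
Variable R : realType.
Implicit Types n : nat.

Definition coord_measurable d (P : measurableType d) n (f : P -> 'cV[R]_n) :=
  forall i, measurable_fun setT (fun p => f p i 0).

(** Joint measurability in a parameter and a vector; the parameter space absorbs the outer variables
    of the iterated integral. *)
Definition borel_family d0 (Q : measurableType d0) n
    (F : Q -> 'cV[R]_n -> \bar R) :=
  forall d (P : measurableType d) (q : P -> Q) (f : P -> 'cV[R]_n),
    measurable_fun setT q -> coord_measurable f ->
    measurable_fun setT (fun p => F (q p) (f p)).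

(** Measurability tested on every map into column vectors with measurable coordinates. It passes to
    slices and affine substitutions by mere composition. *)
Definition borel_fun n (F : 'cV[R]_n -> \bar R) :=
  forall d (P : measurableType d) (f : P -> 'cV[R]_n),
    coord_measurable f -> measurable_fun setT (fun p => F (f p)).

Definition slice n (F : 'cV[R]_n.+1 -> \bar R) (t : R) (s : 'cV[R]_n) :=
  F (col_mx (const_mx t : 'cV[R]_1) s).

Lemma lebesgue_intS n (F : 'cV[R]_n.+1 -> \bar R) :
  lebesgue_int F = (\int[@lebesgue_measure R]_t lebesgue_int (slice F t))%E.
Proof. by []. Qed.

Lemma coord_measurable_col d (P : measurableType d) n (t : P -> R)
    (f : P -> 'cV[R]_n) :
  measurable_fun setT t -> coord_measurable f ->
  coord_measurable (fun p => col_mx (const_mx (t p) : 'cV[R]_1) (f p)).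
Proof.
move=> mt mf i; case: (splitP i) => j ij.
  have -> : i = lshift n j by apply: val_inj.
  by under eq_fun do rewrite col_mxEu mxE.
have -> : i = rshift 1 j by apply: val_inj.
by under eq_fun do rewrite col_mxEd; exact: mf.
Qed.

Lemma borel_family_section d0 (Q : measurableType d0) n
    (F : Q -> 'cV[R]_n -> \bar R) q : borel_family F -> borel_fun (F q).
Proof. by move=> bF d P f mf; apply: (bF d P (cst q)). Qed.

Lemma borel_slice n (F : 'cV[R]_n.+1 -> \bar R) :
  borel_fun F -> @borel_family _ (measurableTypeR R) n (slice F).
Proof. by move=> bF d P q f mq mf; apply: bF; exact: coord_measurable_col. Qed.

Lemma borel_slice1 n (F : 'cV[R]_n.+1 -> \bar R) t :
  borel_fun F -> borel_fun (slice F t).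
Proof. by move=> /borel_slice bF; exact: (borel_family_section t bF). Qed.

Lemma lebesgue_int_ge0 n (F : 'cV[R]_n -> \bar R) :
  (forall y, 0 <= F y)%E -> (0 <= lebesgue_int F)%E.
Proof.
elim: n F => [|n IH] F F0 //=.
by apply: integral_ge0 => t _; apply: IH => s; exact: F0.
Qed.

(** By induction with the parameter space replaced by its product with the line; Tonelli's theorem
    then integrates out the new variable. *)
Lemma measurable_lebesgue_int d0 (Q : measurableType d0) n
    (F : Q -> 'cV[R]_n -> \bar R) :
  borel_family F -> (forall q y, 0 <= F q y)%E ->
  measurable_fun setT (fun q => lebesgue_int (F q)).
Proof.
elim: n d0 Q F => [|n IH] d0 Q F bF F0 /=.
  by apply: (bF d0 Q id (cst 0)) => // i; exact: measurable_cst.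
pose F' (z : Q * measurableTypeR R) := slice (F z.1) z.2.
have bF' : borel_family F'.
  move=> d P z f mz mf; apply: (bF d P (fst \o z)
    (fun p => col_mx (const_mx (z p).2 : 'cV[R]_1) (f p))).
    exact: measurableT_comp.
  by apply: coord_measurable_col => //; exact: measurableT_comp.
have := IH _ _ F' bF' (fun z s => F0 _ _).
move=> /(measurable_fun_fubini_tonelli_F (m2 := @lebesgue_measure R)).
by apply => z; apply: lebesgue_int_ge0 => y; exact: F0.
Qed.

Lemma measurable_int_slice n (F : 'cV[R]_n.+1 -> \bar R) :
  borel_fun F -> (forall y, 0 <= F y)%E ->
  measurable_fun setT (fun t : measurableTypeR R => lebesgue_int (slice F t)).
Proof.
by move=> bF F0; apply: measurable_lebesgue_int => [|q y]; [exact: borel_slice|exact: F0].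
Qed.

Lemma eq_lebesgue_int n (F G : 'cV[R]_n -> \bar R) :
  F =1 G -> lebesgue_int F = lebesgue_int G.
Proof. by move=> /funext ->. Qed.

Lemma borel_funD n (F G : 'cV[R]_n -> \bar R) :
  borel_fun F -> borel_fun G -> borel_fun (fun y => F y + G y)%E.
Proof. by move=> bF bG d P f mf; apply: emeasurable_funD; [exact: bF|exact: bG]. Qed.

Lemma ge0_lebesgue_intD n (F G : 'cV[R]_n -> \bar R) :
  borel_fun F -> (forall y, 0 <= F y)%E ->
  borel_fun G -> (forall y, 0 <= G y)%E ->
  lebesgue_int (fun y => F y + G y)%E = (lebesgue_int F + lebesgue_int G)%E.
Proof.
elim: n F G => [|n IH] F G bF F0 bG G0 //.
rewrite !lebesgue_intS -ge0_integralD//=.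
- by apply: eq_integral => t _; apply: IH; rewrite /slice //; exact: borel_slice1.
- by move=> t _; apply: lebesgue_int_ge0 => y; exact: F0.
- exact: measurable_int_slice.
- by move=> t _; apply: lebesgue_int_ge0 => y; exact: G0.
- exact: measurable_int_slice.
Qed.

Lemma ge0_lebesgue_intZ n (F : 'cV[R]_n -> \bar R) (c : R) :
  borel_fun F -> (forall y, 0 <= F y)%E -> 0 <= c ->
  lebesgue_int (fun y => c%:E * F y)%E = (c%:E * lebesgue_int F)%E.
Proof.
elim: n F => [|n IH] F bF F0 c0 //.
rewrite !lebesgue_intS -ge0_integralZl//=.
- by apply: eq_integral => t _; apply: IH; rewrite /slice //; exact: borel_slice1.
- exact: measurable_int_slice.
- by move=> t _; apply: lebesgue_int_ge0 => y; exact: F0.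
Qed.

Lemma ge0_le_lebesgue_int n (F G : 'cV[R]_n -> \bar R) :
  borel_fun F -> (forall y, 0 <= F y)%E -> borel_fun G ->
  (forall y, F y <= G y)%E ->
  (lebesgue_int F <= lebesgue_int G)%E.
Proof.
elim: n F G => [|n IH] F G bF F0 bG FG; first exact: FG.
have G0 y : (0 <= G y)%E by exact: le_trans (F0 y) (FG y).
rewrite !lebesgue_intS; apply: ge0_le_integral => //=.
- by move=> t _; apply: lebesgue_int_ge0 => y; exact: F0.
- exact: measurable_int_slice.
- exact: measurable_int_slice.
- by move=> t _; apply: IH; rewrite /slice //; exact: borel_slice1.
Qed.

Lemma borel_affine m n (A : 'M[R]_(m, n)) (b : 'cV[R]_m)
    (F : 'cV[R]_m -> \bar R) :
  borel_fun F -> borel_fun (fun y => F (A *m y + b)).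
Proof.
move=> bF d P f mf; apply: bF => i.
under eq_fun do rewrite !mxE.
apply: measurable_funD => //.
by apply: measurable_sum => j; apply: measurable_funM.
Qed.

(** The translation [b] is included because, for a block triangular matrix, the first coordinate
    translates the remaining ones. *)
Definition change_of_variables n (A : 'M[R]_n) :=
  forall (F : 'cV[R]_n -> \bar R) (b : 'cV[R]_n),
    borel_fun F -> (forall y, 0 <= F y)%E ->
    (`|\det A|%:E * lebesgue_int (fun y => F (A *m y + b)%R) = lebesgue_int F)%E.

Lemma change_of_variables_block n (a : R) (c : 'cV[R]_n) (B : 'M[R]_n) :
  a != 0 -> change_of_variables B ->
  change_of_variables (block_mx (a%:M : 'M[R]_1) 0 c B : 'M[R]_(1 + n)).
Proof.
move=> a0 covB F b bF F0.
pose b0 : R := b 0 0; pose b1 : 'cV[R]_n := dsubmx (b : 'cV[R]_(1 + n)).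
have sliceE t s : slice (fun y => F (block_mx (a%:M : 'M[R]_1) 0 c B *m y + b)) t s
    = slice F (a * t + b0) (B *m s + (t *: c + b1)).
  rewrite /slice mul_block_col mul0mx addr0 -[b in LHS](vsubmxK (b : 'cV[R]_(1 + n))) add_col_mx.
  congr (F (col_mx _ _)).
    by apply/colP => i; rewrite !mxE !ord1 big_ord1 !mxE eqxx mulr1n; congr (_ + _);
      congr (b _ _); apply: val_inj.
  rewrite addrA [B *m s + _]addrC; congr (_ + _ + _).
  apply/colP => i; rewrite !mxE big_ord1 !mxE. by rewrite mulrC.
rewrite !lebesgue_intS det_lblock det_scalar1 normrM EFinM -muleA.
have nn0 : 0 <= `|\det B| by [].
rewrite -ge0_integralZl//=; last first.
- by move=> t _; apply: lebesgue_int_ge0 => s; exact: F0.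
- by apply: measurable_int_slice => //; exact: borel_affine.
under eq_integral => t _.
  rewrite (eq_lebesgue_int (sliceE t)) covB; last first.
  - by move=> s; exact: F0.
  - exact: borel_slice1.
  over.
rewrite (@ge0_integral_affine _ _ _ (fun t => lebesgue_int (slice F t)))//.
- exact: measurable_int_slice.
- by move=> t; apply: lebesgue_int_ge0 => s; exact: F0.
Qed.

Lemma change_of_variables1 n : change_of_variables (1%:M : 'M[R]_n).
Proof.
elim: n => [|n IH].
  by move=> F b bF F0; rewrite det1 normr1 mul1e /=; congr F; apply/colP => -[].
have := @change_of_variables_block n 1 0 1%:M (oner_neq0 _) IH.
by rewrite -scalar_mx_block.
Qed.

Lemma lebesgue_int_swap n (F : 'cV[R]_n.+2 -> \bar R) :
  borel_fun F -> (forall y, 0 <= F y)%E ->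
  lebesgue_int (fun y => F (perm_mx (tperm 0 1) *m y)) = lebesgue_int F.
Proof.
move=> bF F0.
have swapE t u s :
    slice (slice (fun y => F (perm_mx (tperm 0 1) *m y)) t) u s = slice (slice F u) t s.
  pose col2 (x y : R) : 'cV[R]_n.+2 :=
    col_mx (const_mx x : 'cV[R]_1) (col_mx (const_mx y : 'cV[R]_1) s : 'cV[R]_n.+1).
  have col20 x y : col2 x y 0 0 = x.
    have -> : (0 : 'I_n.+2) = @lshift 1 n.+1 0 by exact: val_inj.
    by apply: etrans (@col_mxEu _ 1 n.+1 1 _ _ 0 0) _; rewrite mxE.
  have col21 x y : col2 x y 1 0 = y.
    have -> : (1 : 'I_n.+2) = @rshift 1 n.+1 0 by exact: val_inj.
    have -> : (0 : 'I_n.+1) = @lshift 1 n 0 by exact: val_inj.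
    apply: etrans (@col_mxEd _ 1 n.+1 1 _ _ _ 0) _.
    by apply: etrans (@col_mxEu _ 1 n 1 _ _ 0 0) _; rewrite mxE.
  have col2S x y k : col2 x y (rshift 1 (rshift 1 k)) 0 = s k 0.
    apply: etrans (@col_mxEd _ 1 n.+1 1 _ _ _ 0) _.
    exact: (@col_mxEd _ 1 n 1 _ _ _ 0).
  rewrite /slice -row_permE; congr F; apply/colP => i; rewrite mxE -!/(col2 _ _).
  have [->|->|] := tpermP; rewrite ?col20 ?col21//.
  case: (splitP (i : 'I_(1 + n.+1))) => j ij; first by case; apply: val_inj;
    rewrite /= ij ord1.
  case: (splitP (j : 'I_(1 + n))) => k jk; first by move=> _ []; apply: val_inj;
    rewrite /= ij jk ord1.
  by rewrite (_ : i = rshift 1 (rshift 1 k)) ?col2S//; apply: val_inj; rewrite /= ij jk.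
rewrite !lebesgue_intS.
under eq_integral => t _ do rewrite lebesgue_intS.
under [RHS]eq_integral => t _ do rewrite lebesgue_intS.
rewrite [RHS](@fubini_tonelli _ _ (measurableTypeR R) (measurableTypeR R) R
  lebesgue_measure lebesgue_measure
  (fun z => lebesgue_int (slice (slice F z.1) z.2))); last 2 first.
- apply: (measurable_lebesgue_int 
    (F := fun z : measurableTypeR R * measurableTypeR R => slice (slice F z.1) z.2)) => [|z y]; last exact: F0.
  move=> d P q f mq mf; apply: bF.
  by do 2! [apply: coord_measurable_col; first exact: measurableT_comp].
- by move=> z; apply: lebesgue_int_ge0 => y; exact: F0.
by do 2! apply: eq_integral => ? _; apply: eq_lebesgue_int => s; rewrite swapE.
Qed.

(** This allows column operations [X] to be applied to [A] and then removed. *)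
Lemma change_of_variables_cancel n (A X : 'M[R]_n) : X \in unitmx ->
  change_of_variables (A *m X) -> change_of_variables X ->
  change_of_variables A.
Proof.
move=> Xu covAX covX F b bF F0.
rewrite -(covAX F b)// det_mulmx normrM EFinM -muleA; congr (_ * _)%E.
rewrite -(covX (fun y => F (A *m y + b)) 0)//; last exact: borel_affine.
by congr (_ * _)%E; apply: eq_lebesgue_int => y; rewrite addr0 mulmxA.
Qed.

Lemma change_of_variables_swap n :
  change_of_variables (perm_mx (tperm 0 1) : 'M[R]_n.+2).
Proof.
move=> F b bF F0; rewrite det_perm normrX normrN1 expr1n mul1e.
pose G y := F (y + b).
have bG : borel_fun G.
  have := borel_affine 1%:M b bF.
  by rewrite (_ : (fun y => _) = G)//; apply/funext => y; rewrite mul1mx.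
transitivity (lebesgue_int G); first exact: (lebesgue_int_swap bG (fun y => F0 _)).
rewrite -(change_of_variables1 b bF F0) det1 normr1 mul1e.
by apply: eq_lebesgue_int => y; rewrite mul1mx.
Qed.

Lemma block_mx_reduce m (A : 'M[R]_(1 + m)) (V : 'M[R]_m) (c : 'cV[R]_m) :
  let A' := A *m block_mx 1%:M 0 0 V *m block_mx 1%:M 0 c 1%:M in
  ulsubmx A' = ulsubmx A + ursubmx A *m V *m c /\
  ursubmx A' = ursubmx A *m V.
Proof.
move=> A'.
have -> : A' = block_mx (ulsubmx A + ursubmx A *m V *m c) (ursubmx A *m V)
    (dlsubmx A + drsubmx A *m V *m c) (drsubmx A *m V).
  by rewrite /A' -{1}(submxK A) !mulmx_block !mulmx0 !mulmx1 !add0r !addr0.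
by rewrite block_mxKul block_mxKur.
Qed.

(** Induction on the dimension. A first row that vanishes off the corner is the block case;
    otherwise column operations bring the first row to the form (0, l, 0, ..., 0), and swapping two
    columns moves [l] into the corner. *)
Lemma change_of_variables_unit n (A : 'M[R]_n) :
  A \in unitmx -> change_of_variables A.
Proof.
elim: n A => [|n IH] A Au.
  by rewrite [A](_ : _ = 1%:M); [exact: change_of_variables1|apply/matrixP => -[]].
have blockc (B : 'M[R]_(1 + n)) : B \in unitmx -> ursubmx B = 0 -> change_of_variables B.
  move=> Bu B0; move: (Bu); rewrite -(submxK B) B0 (mx11_scalar (ulsubmx B)).
  rewrite unitmxE det_lblock det_scalar1 unitfE mulf_eq0 negb_or => /andP[a0 d0].
  by apply: change_of_variables_block => //; apply: IH; rewrite unitmxE unitfE.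
have [|r0] := eqVneq (ursubmx (A : 'M[R]_(1 + n))) 0; first exact: blockc.
case: n => [|k] in IH A Au blockc r0 *.
  by move: r0; rewrite (_ : ursubmx _ = 0) ?eqxx//; apply/matrixP => i [].
pose r := ursubmx (A : 'M[R]_(1 + k.+1)); rewrite -/r in r0.
pose a := ulsubmx (A : 'M[R]_(1 + k.+1)) 0 0.
pose U := row_ebase r; pose l := col_ebase r 0 0.
(* Gaussian elimination of a nonzero row leaves only its first entry [l]. *)
have rU : r *m invmx U = l *: pid_mx 1.
  have := mulmx_ebase r; rewrite rank_rV r0 => rE.
  rewrite -[X in X *m _]rE mulmxK ?row_ebase_unit//.
  by rewrite [col_ebase r]mx11_scalar mul_scalar_mx.
have l0 : l != 0.
  by have := col_ebase_unit r; rewrite [col_ebase r]mx11_scalar unitmxE det_scalar1 unitfE.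
pose X1 : 'M[R]_(1 + k.+1) := block_mx 1%:M 0 0 (invmx U).
(* Adding [- (a / l)] times the column that carries [l] clears the corner entry [a]. *)
pose c : 'cV[R]_k.+1 := - (a / l) *: delta_mx 0 0.
pose X2 : 'M[R]_(1 + k.+1) := block_mx 1%:M 0 c 1%:M.
pose S : 'M[R]_k.+2 := perm_mx (tperm 0 1).
have X1u : X1 \in unitmx.
  by rewrite unitmxE det_lblock det1 mul1r -unitmxE unitmx_inv row_ebase_unit.
have X2u : X2 \in unitmx.
  by rewrite unitmxE det_lblock !det1 mul1r unitr1.
have Su : S \in unitmx by exact: unitmx_perm.
have cov_X1 : change_of_variables X1.
  apply: (@change_of_variables_block _ 1 0); first exact: oner_neq0.
  by apply: IH; rewrite unitmx_inv row_ebase_unit.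
have cov_X2 : change_of_variables X2.
  apply: (@change_of_variables_block _ 1 c); first exact: oner_neq0.
  by apply: IH; rewrite unitmx1.
have cov_S : change_of_variables S by exact: change_of_variables_swap.
apply: (change_of_variables_cancel X1u _ cov_X1).
apply: (change_of_variables_cancel X2u _ cov_X2).
apply: (change_of_variables_cancel Su _ cov_S).
apply: blockc; first by rewrite !unitmx_mul Au X1u X2u Su.
have [] := block_mx_reduce A (invmx U) c; rewrite -/r -/X1 -/X2 rU.
set Y : 'M[R]_(1 + k.+1) := A *m X1 *m X2 => Yul Yur; clearbody Y.
have Y0 : Y (lshift k.+1 0) (lshift k.+1 0) = 0.
  have := congr1 (fun M : 'M[R]_1 => M 0 0) Yul; rewrite !mxE => ->.
  rewrite (bigD1 0)//= big1 => [|m m0]; last by rewrite !mxE (negPf m0) !mulr0.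
  by rewrite !mxE !eqxx /a !mxE /= !mulr1 addr0 mulrN mulrCA divff// mulr1 subrr.
have YS j : j != 0 -> Y (lshift k.+1 0) (rshift 1 j) = 0.
  move=> j0; have := congr1 (fun M : 'M[R]_(1, k.+1) => M 0 j) Yur; rewrite !mxE => ->.
  by case: j j0 => [[|j] jl] //= _; rewrite mulr0.
apply/matrixP => i j; rewrite ord1 -[S]/(perm_mx _) -tpermV -col_permE !mxE.
case: tpermP => [/(congr1 val)//|_|_ j1].
  by rewrite -[RHS]Y0; congr (fun_of_matrix Y _ _); exact: val_inj.
by apply: YS; apply/eqP => j0; apply: j1; rewrite j0; exact: val_inj.
Qed.

End IteratedIntegral.

(** * Moments of simplices *)

Section MomentFunctional.
Variables (R : realType) (n : nat).
Implicit Types (x y z : 'cV[R]_n) (K L : set 'cV[R]_n) (vs : seq 'cV[R]_n).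

Definition borel_set K := forall d (P : measurableType d) (f : P -> 'cV[R]_n),
  coord_measurable f -> measurable (f @^-1` K).

(** Boxes and simplices are written below as the zero set of a sum of nonnegative penalties, one for
    each defining inequality or equation. *)
Lemma borel_zero_set (g : 'cV[R]_n -> R) :
  (forall d (P : measurableType d) (f : P -> 'cV[R]_n),
    coord_measurable f -> measurable_fun setT (fun p => g (f p))) ->
  borel_set [set y | g y = 0].
Proof.
move=> mg d P f mf; rewrite -[X in measurable X]setTI.
by apply: (mg _ _ _ mf measurableT [set 0]); exact: measurable_set1.
Qed.

Lemma borel_setU K L : borel_set K -> borel_set L -> borel_set (K `|` L).
Proof. by move=> bK bL d P f mf; apply: measurableU; [exact: bK|exact: bL]. Qed.

Lemma borel_setI K L : borel_set K -> borel_set L -> borel_set (K `&` L).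
Proof. by move=> bK bL d P f mf; apply: measurableI; [exact: bK|exact: bL]. Qed.

Lemma borel_indic K : borel_set K -> borel_fun (fun y => (\1_K y)%:E).
Proof.
move=> bK d P f mf; apply/measurable_EFinP.
have -> : (fun p => \1_K (f p)) = \1_(f @^-1` K) :> (_ -> R).
  by apply/funext => p; rewrite !indicE.
exact: measurable_indic (bK _ _ _ mf).
Qed.

Definition moment_density K x y : \bar R := (\1_K y * Num.max (vdot x y) 0)%:E.

Definition moment_support K x : \bar R := lebesgue_int (moment_density K x).

Lemma MplusE K : Mplus K = body_of_support (moment_support K).
Proof. by []. Qed.

Lemma MminusE K : Mminus K = body_of_support (fun x => moment_support K (- x)).
Proof.
congr body_of_support; apply/funext => x; congr lebesgue_int; apply/funext => y.
by rewrite /moment_density vdotNl.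
Qed.

Lemma moment_density_ge0 K x y : (0 <= moment_density K x y)%E.
Proof. by rewrite lee_fin mulr_ge0// ?le_max ?lexx ?orbT// indicE. Qed.

Lemma borel_moment_density K x : borel_set K -> borel_fun (moment_density K x).
Proof.
move=> bK d P f mf; apply/measurable_EFinP/measurable_funM.
  exact/measurable_EFinP/borel_indic.
apply: measurable_maxr => //.
by apply: measurable_sum => i; apply: measurable_funM.
Qed.

Lemma moment_support_ge0 K x : (0 <= moment_support K x)%E.
Proof. by apply: lebesgue_int_ge0 => y; exact: moment_density_ge0. Qed.

Lemma moment_supportD K x y : borel_set K ->
  (moment_support K (x + y) <= moment_support K x + moment_support K y)%E.
Proof.
move=> bK; rewrite -ge0_lebesgue_intD; last 4 first.
- exact: borel_moment_density.
- by move=> z; exact: moment_density_ge0.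
- exact: borel_moment_density.
- by move=> z; exact: moment_density_ge0.
apply: ge0_le_lebesgue_int; last 2 first.
- by apply: borel_funD; exact: borel_moment_density.
- move=> z; rewrite -EFinD lee_fin -mulrDr ler_wpM2l ?indicE// vdotDl.
  rewrite ge_max; apply/andP; split; last by rewrite addr_ge0// le_max lexx orbT.
  by rewrite lerD// le_max lexx.
- exact: borel_moment_density.
- by move=> z; exact: moment_density_ge0.
Qed.

Lemma moment_supportZ K k x : borel_set K -> 0 <= k ->
  moment_support K (k *: x) = (k%:E * moment_support K x)%E.
Proof.
move=> bK k0; rewrite -ge0_lebesgue_intZ//; last 2 first.
- exact: borel_moment_density.
- by move=> z; exact: moment_density_ge0.
apply: eq_lebesgue_int => y; rewrite /moment_density -EFinM; congr (_%:E).
by rewrite vdotZl mulrCA -[X in Num.max _ X](mulr0 k) -maxr_pMr.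
Qed.

Lemma moment_support_valuation K L x : borel_set K -> borel_set L ->
  (moment_support (K `|` L) x + moment_support (K `&` L) x =
   moment_support K x + moment_support L x)%E.
Proof.
move=> bK bL; have bU := borel_setU bK bL; have bI := borel_setI bK bL.
rewrite -!ge0_lebesgue_intD; do ?by [exact: borel_moment_density|
  move=> z; exact: moment_density_ge0].
apply: eq_lebesgue_int => y; rewrite /moment_density -!EFinD -!mulrDl.
congr ((_ * _)%:E); rewrite !indicE !in_setU !in_setI.
by case: (y \in K); case: (y \in L); rewrite /= ?addr0 ?add0r.
Qed.

Lemma moment_support_image (A : 'M[R]_n) K x : A \in unitmx -> borel_set K ->
  borel_set (limage A K) ->
  moment_support (limage A K) x = (`|\det A|%:E * moment_support K (A^T *m x))%E.
Proof.
move=> Au bK bAK.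
rewrite [LHS]/moment_support -(change_of_variables_unit Au 0 (borel_moment_density x bAK));
  last first.
  by move=> z; exact: moment_density_ge0.
congr (_ * _)%E; apply: eq_lebesgue_int => y; rewrite addr0 /moment_density.
rewrite vdot_mulmxr; congr ((_ * _)%:E); rewrite !indicE; congr (_%:R); congr nat_of_bool.
apply/idP/idP; rewrite !inE; last by exists y.
by move=> [z Kz /(can_inj (mulKmx Au)) <-].
Qed.

End MomentFunctional.

(** * Integrals over boxes and bounds for moments *)

Section BoxIntegral.
Variable R : realType.

Definition box n (a b : R) : set 'cV[R]_n := [set y | forall i, a <= y i 0 <= b].
Arguments box : clear implicits.

Lemma col_const0 n t (s : 'cV[R]_n) :
  (col_mx (const_mx t : 'cV[R]_1) s : 'cV[R]_n.+1) ord0 0 = t.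
Proof.
have -> : ord0 = @lshift 1 n 0 by exact: val_inj.
by apply: etrans (@col_mxEu _ 1 n 1 _ _ 0 0) _; rewrite mxE.
Qed.

Lemma col_constS n t (s : 'cV[R]_n) j :
  (col_mx (const_mx t : 'cV[R]_1) s : 'cV[R]_n.+1) (lift ord0 j) 0 = s j 0.
Proof.
have -> : lift ord0 j = @rshift 1 n j by exact: val_inj.
exact: (@col_mxEd _ 1 n 1 _ _ j 0).
Qed.

Lemma borel_box n a b : borel_set (box n a b).
Proof.
pose g (y : 'cV[R]_n) := \sum_i (Num.max (a - y i 0) 0 + Num.max (y i 0 - b) 0).
have -> : box n a b = [set y | g y = 0].
  have g0 y i : 0 <= Num.max (a - y i 0) 0 + Num.max (y i 0 - b) 0.
    by rewrite addr_ge0// le_max lexx orbT.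
  apply/seteqP; split=> y /= yab.
    rewrite /g big1// => i _; have /andP[ay yb] := yab i.
    by rewrite !max_r ?addr0// subr_le0.
  move=> i; have /eqP := yab; rewrite /g psumr_eq0// => /allP/(_ i).
  rewrite mem_index_enum /= => /(_ isT).
  rewrite paddr_eq0 ?le_max ?lexx ?orbT// => /andP[/eqP h1 /eqP h2].
  apply/andP; split; rewrite -subr_le0; first by rewrite -h1 le_max lexx.
  by rewrite -h2 le_max lexx.
apply: borel_zero_set => d P f mf.
apply: measurable_sum => i; apply: measurable_funD; apply: measurable_maxr => //;
 by apply: measurable_funB.
Qed.

Lemma borel_box_indic n a b c :
  borel_fun (fun y : 'cV[R]_n => (c * \1_(box n a b) y)%:E).
Proof.
move=> d P f mf; apply/measurable_EFinP/measurable_funM => //.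
by apply/measurable_EFinP/borel_indic => //; exact: borel_box.
Qed.

Lemma lebesgue_int_box n (a b c : R) : a <= b -> 0 <= c ->
  lebesgue_int (fun y : 'cV[R]_n => (c * \1_(box n a b) y)%:E) =
  (c * (b - a) ^+ n)%:E.
Proof.
move=> ab c0; elim: n => [|n IH] /=.
  by rewrite expr0 indicE mem_set// => -[].
under eq_integral => t _.
  rewrite (_ : lebesgue_int _ = (c * (b - a) ^+ n)%:E * (\1_`[a, b] t)%:E)%E; last first.
    rewrite -IH muleC -ge0_lebesgue_intZ; last 3 first.
    - exact: borel_box_indic.
    - by move=> y; rewrite lee_fin mulr_ge0// indicE.
    - by rewrite indicE.
    apply: eq_lebesgue_int => s; rewrite -EFinM; congr (_%:E); rewrite mulrCA;
      congr (_ * _).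
    rewrite !indicE -natrM mulnb; congr (_%:R); congr nat_of_bool.
    apply/idP/andP; rewrite !inE /= in_itv /=.
      move=> h; split; first by have := h ord0; rewrite col_const0.
      by move=> i; have := h (lift ord0 i); rewrite col_constS.
    move=> [tab sab] i; case: (unliftP ord0 i) => [j|] ->.
      by rewrite col_constS.
    by rewrite col_const0.
  over.
rewrite ge0_integralZl//=; first last.
- by rewrite lee_fin mulr_ge0// exprn_ge0// subr_ge0.
- by apply/measurable_EFinP/measurable_indic; exact: measurable_itv.
rewrite integral_indic// setIT /= lebesgue_measure_itv/= lte_fin.
rewrite exprSr mulrA [RHS]EFinM; congr (_ * _)%E.
case: ltP => //; rewrite le_eqVlt ltNge ab orbF => /eqP ->.
by rewrite subrr.
Qed.

Lemma moment_support_lt_pinfty n (K : set 'cV[R]_n) (B : R) x :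
  borel_set K -> 0 <= B -> (forall y, K y -> forall i, `|y i 0| <= B) ->
  (moment_support K x < +oo)%E.
Proof.
move=> bK B0 KB; pose C := \sum_i `|x i 0| * B.
have C0 : 0 <= C by apply: sumr_ge0 => i _; exact: mulr_ge0.
apply: (@le_lt_trans _ _ (lebesgue_int (fun y : 'cV[R]_n => (C * \1_(box n (- B) B) y)%:E))).
  apply: ge0_le_lebesgue_int; first exact: borel_moment_density.
  - by move=> y; exact: moment_density_ge0.
  - exact: borel_box_indic.
  move=> y; rewrite /moment_density lee_fin !indicE.
  have [yK|yK] := boolP (y \in K); last by rewrite mul0r mulr_ge0.
  rewrite mem_set ?mulr1 ?mul1r; last first.
    by move=> i; rewrite -ler_norml; apply: KB; rewrite inE in yK.
  rewrite ge_max C0 andbT; apply: le_trans (ler_norm _) _.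
  apply: le_trans (ler_norm_sum _ _ _) _; apply: ler_sum => i _.
  by rewrite normrM ler_wpM2l// KB//; rewrite inE in yK.
by rewrite lebesgue_int_box ?ltry//; lra.
Qed.

Lemma moment_support_gt0 n (K : set 'cV[R]_n) (a b c : R) x :
  borel_set K -> a < b -> 0 < c -> box n a b `<=` K ->
  (forall y, box n a b y -> c <= vdot x y) ->
  (0 < moment_support K x)%E.
Proof.
move=> bK ab c0 boxK xc.
have := lebesgue_int_box n (ltW ab) (ltW c0) => boxE.
apply: (@lt_le_trans _ _ (lebesgue_int (fun y : 'cV[R]_n => (c * \1_(box n a b) y)%:E))).
  by rewrite boxE lte_fin mulr_gt0// exprn_gt0// subr_gt0.
apply: ge0_le_lebesgue_int; last 2 first.
- exact: borel_moment_density.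
- move=> y; rewrite /moment_density lee_fin !indicE.
  have [yB|_] := boolP (y \in box n a b); last first.
    by rewrite mulr0 mulr_ge0// le_max lexx orbT.
  rewrite mulr1 (mem_set (boxK _ _)) ?mul1r; last by rewrite inE in yB.
  by rewrite le_max xc//; rewrite inE in yB.
- exact: borel_box_indic.
- by move=> y; rewrite lee_fin mulr_ge0 ?indicE// ltW.
Qed.

End BoxIntegral.

(** * Simplices are bounded Borel sets with finite moments *)

Section MomentSimplex.
Variables (R : realType) (n : nat).
Implicit Types (x y z : 'cV[R]_n) (vs : seq 'cV[R]_n).

(** In the coordinates of a completed basis the simplex is given by linear inequalities and
    equations, the form needed for measurability. *)
Lemma osimplex_coord vs : free vs -> exists2 W : 'M[R]_n, W \in unitmx &
  forall y, osimplex vs y <->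
    [/\ forall i, 0 <= (W *m y) i 0,
        forall i : 'I_n, (size vs <= i)%N -> (W *m y) i 0 = 0 &
        \sum_i (W *m y) i 0 <= 1].
Proof.
move=> /free_complete[V Vu [vsn VE]]; exists (invmx V); first by rewrite unitmx_inv.
have WE (c : nat -> R) : invmx V *m (\sum_(i < size vs) c i *: vs`_i) =
    \col_(i < n) (if (i < size vs)%N then c i else 0).
  rewrite mulmx_sumr; apply/colP => j; rewrite summxE mxE.
  have h (i : 'I_(size vs)) : (invmx V *m (c i *: vs`_i)) j 0 = c i * (j == i :> nat)%:R.
    have i_n : (i < n)%N by exact: leq_trans vsn.
    by rewrite (VE (Ordinal i_n))//= -scalemxAr mulKmx// !mxE -val_eqE /= andbT.
  under eq_bigr do rewrite h.
  case: ifPn => [jvs|]; last first.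
    rewrite -leqNgt => jvs; rewrite big1// => i _.
    by rewrite gtn_eqF ?mulr0//; exact: leq_trans jvs.
  rewrite (bigD1 (Ordinal jvs))//= eqxx mulr1 big1 ?addr0// => i.
  by rewrite -val_eqE /= eq_sym => /negPf ->; rewrite mulr0.
have sumE (c : nat -> R) :
    \sum_(i < n) (if (i < size vs)%N then c i else 0) = \sum_(i < size vs) c i.
  by rewrite -big_mkcond /= (big_ord_widen n c vsn).
move=> y; split.
  move=> /osimplexP[b b1 /weightedP[c0 [c0_ge0 [cb ->]]]].
  pose c i := if insub i is Some j then c0 j else 0.
  have c0E : c0 = (fun i : 'I_(size vs) => c i).
    by apply/funext => i; rewrite /c insubT//= => ii; congr c0; exact: val_inj.
  have c_ge0 i : 0 <= c i by rewrite /c; case: insubP.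
  rewrite c0E in cb *; rewrite WE; split=> [i|i ivs|].
  - by rewrite mxE; case: ifP.
  - by rewrite mxE ltnNge ivs.
  - by under eq_bigr do rewrite mxE; rewrite sumE cb.
move=> [W0 WS W1]; pose c (i : nat) := if insub i is Some j then (invmx V *m y) j 0 else 0.
have cE (i : 'I_n) : c i = (invmx V *m y) i 0.
  by rewrite /c insubT//= => ii; congr ((invmx V *m y) _ _); exact: val_inj.
apply/osimplexP; exists (\sum_(i < size vs) c i).
  rewrite -sumE; apply: le_trans W1; apply: ler_sum => i _.
  by case: ifPn => [_|]; rewrite ?cE// -leqNgt => /WS ->.
apply/weightedP; exists (fun i => c i); split.
  by move=> i; rewrite /c; case: insubP.
split=> //; rewrite -[LHS](mulKVmx Vu) -[RHS](mulKVmx Vu) WE; congr (_ *m _).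
apply/colP => i; rewrite [RHS]mxE cE; case: ifPn => //.
by rewrite -leqNgt => /WS.
Qed.

Lemma borel_osimplex vs : free vs -> borel_set (osimplex vs).
Proof.
move=> /osimplex_coord[W Wu WP].
pose g y := \sum_i (Num.max (- (W *m y) i 0) 0
  + (size vs <= i)%N%:R * `|(W *m y) i 0|) + Num.max (\sum_i (W *m y) i 0 - 1) 0.
have -> : osimplex vs = [set y | g y = 0].
  have g1 y i : 0 <= Num.max (- (W *m y) i 0) 0 + (size vs <= i)%N%:R * `|(W *m y) i 0|.
    by rewrite addr_ge0 ?mulr_ge0// le_max lexx orbT.
  apply/seteqP; split=> y.
    move=> /WP[W0 WS W1]; rewrite /= /g max_r ?subr_le0// addr0 big1// => i _.
    by rewrite max_r ?oppr_le0// add0r; case: leqP => [/WS ->|];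
      rewrite ?normr0 ?mulr0 ?mul0r.
  move=> /= /eqP; rewrite /g paddr_eq0; last 2 first.
  - by apply: sumr_ge0.
  - by rewrite le_max lexx orbT.
  rewrite psumr_eq0// => /andP[/allP h /eqP h1].
  have {}h i : (0 <= (W *m y) i 0) /\ ((size vs <= i)%N -> (W *m y) i 0 = 0).
    have := h i; rewrite mem_index_enum /= => /(_ isT).
    rewrite paddr_eq0 ?mulr_ge0// ?le_max ?lexx ?orbT// => /andP[/eqP h2 /eqP h3].
    split; first by rewrite -oppr_le0 -[X in _ <= X]h2 le_max lexx.
    by move=> ivs; move: h3; rewrite ivs mul1r => /normr0_eq0.
  apply/WP; split=> [i|i|]; [exact: (h i).1|exact: (h i).2|].
  by rewrite -subr_le0 -[X in _ <= X]h1 le_max lexx.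
apply: borel_zero_set => d P f mf.
have mW i : measurable_fun setT (fun p => (W *m f p) i 0).
  under eq_fun do rewrite mxE.
  by apply: measurable_sum => j; apply: measurable_funM.
apply: measurable_funD.
  apply: measurable_sum => i; apply: measurable_funD;
    first by apply: measurable_maxr => //; exact: measurableT_comp.
  by apply: measurable_funM => //; exact: measurableT_comp.
by apply: measurable_maxr => //; apply: measurable_funB => //; exact: measurable_sum.
Qed.

Lemma osimplex_bounded vs : exists2 B : R, 0 <= B &
  forall y, osimplex vs y -> forall i, `|y i 0| <= B.
Proof.
exists (\sum_(v <- vs) \sum_i `|v i 0|).
  by apply: sumr_ge0 => v _; apply: sumr_ge0.
move=> y /osimplexP[b b1 yb] i.
have B0 : 0 <= \sum_(v <- vs) \sum_i `|v i 0|.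
  by apply: sumr_ge0 => v _; apply: sumr_ge0.
have vB v : v \in vs -> `|v i 0| <= \sum_(v <- vs) \sum_i `|v i 0|.
  move=> vvs; rewrite (big_rem v)//= (bigD1 i)//= -addrA lerDl addr_ge0//.
    by apply: sumr_ge0.
  by apply: sumr_ge0 => w _; apply: sumr_ge0.
have b0 := weighted_ge0 yb.
have bB : (\sum_(v <- vs) \sum_i `|v i 0|) * b <= \sum_(v <- vs) \sum_i `|v i 0|.
  by rewrite ler_piMr.
rewrite ler_norml; apply/andP; split.
  rewrite lerNl -(vdot_deltal i y) -vdotNl; apply: le_trans bB.
  apply: weighted_le yb => v vvs; rewrite vdotNl vdot_deltal.
  by apply: le_trans (vB v vvs); rewrite -normrN ler_norm.
rewrite -(vdot_deltal i y); apply: le_trans bB.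
apply: weighted_le yb => v vvs; rewrite vdot_deltal.
by apply: le_trans (vB v vvs); rewrite ler_norm.
Qed.

Lemma moment_simplex_fin vs x : free vs -> moment_support (osimplex vs) x \is a fin_num.
Proof.
move=> fvs; have [B B0 KB] := osimplex_bounded vs.
rewrite ge0_fin_numE ?moment_support_ge0//.
exact: (moment_support_lt_pinfty _ (borel_osimplex fvs) B0).
Qed.

End MomentSimplex.

(** * Cutting simplices; the support function of D *)

Section ValueLists.
Variable R : realType.
Implicit Types (a b w t : R) (l : seq R).

(** The singleton case keeps 0 from competing with negative entries; the value 0 of the empty list
    makes [Dval] vanish on the simplex consisting of the origin. *)
Fixpoint maxl l : R :=
  match l with
  | [::] => 0
  | [:: a] => a
  | a :: l' => Num.max a (maxl l')
  end.

Definition minl l : R := - maxl [seq - t | t <- l].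

Lemma maxl_cons a b l : maxl [:: a, b & l] = Num.max a (maxl (b :: l)).
Proof. by []. Qed.

Lemma maxl_ge l a : a \in l -> a <= maxl l.
Proof.
elim: l => // b [|c l] IH; first by rewrite inE => /eqP ->.
rewrite inE => /orP[/eqP ->|/IH h]; first by rewrite maxl_cons le_max lexx.
by rewrite maxl_cons le_max h orbT.
Qed.

Lemma maxl_mem a l : maxl (a :: l) \in a :: l.
Proof.
elim: l a => [|b l IH] a; first by rewrite inE.
rewrite maxl_cons; have [_|_] := leP a (maxl (b :: l)); last exact: mem_head.
by rewrite inE IH orbT.
Qed.

Lemma maxlE l a : a \in l -> (forall b, b \in l -> b <= a) -> maxl l = a.
Proof.
move=> al h; apply/eqP; rewrite eq_le maxl_ge// andbT; apply: h.
by case: l al => // b l _; exact: maxl_mem.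
Qed.

Lemma minl_le l a : a \in l -> minl l <= a.
Proof. by move=> al; rewrite lerNl; apply: maxl_ge; exact: map_f. Qed.

Lemma minl_mem a l : minl (a :: l) \in a :: l.
Proof.
have := maxl_mem (- a) [seq - t | t <- l].
by rewrite -map_cons => /mapP[b bl h]; rewrite /minl h opprK.
Qed.

Lemma maxl_perm l l' : l =i l' -> maxl l = maxl l'.
Proof.
case: l => [|a l] h.
  by case: l' h => // b l' /(_ b); rewrite mem_head in_nil.
by apply/esym/maxlE => [|b]; rewrite -h; [exact: maxl_mem|exact: maxl_ge].
Qed.

Lemma minl_perm l l' : l =i l' -> minl l = minl l'.
Proof.
by move=> h; congr (- _); apply: maxl_perm; exact: eq_mem_map.
Qed.

(* On the values [x . v_i] at the nonzero vertices, the support function of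
   [Dbody] is [Dpos (max_i x . v_i) - Dneg (min_i x . v_i)]. *)
Definition Dpos a2 b1 b2 t := a2 * Num.max t 0 - (b2 - b1) * Num.max (- t) 0.
Definition Dneg a1 a2 b2 t := (a2 - a1) * Num.max t 0 - b2 * Num.max (- t) 0.
Definition Dval a1 a2 b1 b2 l :=
  Dpos a2 b1 b2 (maxl l) - Dneg a1 a2 b2 (minl l).

(** The piece containing [b] has the maximum of the whole, the piece containing [a] that of the
    common facet, so any function [P] of the maximum is additive under the cut. *)
Lemma maxl_cut (P : R -> R) a b w l : a <= w -> w <= b ->
  P (maxl [:: a, b & l]) + P (maxl (w :: l)) =
  P (maxl [:: a, w & l]) + P (maxl [:: w, b & l]).
Proof.
move=> aw wb; have ab := le_trans aw wb.
case: l => [|c l].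
  by rewrite /= (max_r ab) (max_r aw) (max_r wb) addrC.
rewrite !maxl_cons; set m := maxl _.
rewrite !maxA (max_r ab) (max_r aw) (max_r wb) addrC//.
Qed.

Lemma maxl_swap a b l : maxl [:: a, b & l] = maxl [:: b, a & l].
Proof. by apply: maxl_perm => t; rewrite !inE orbCA. Qed.

Lemma maxl_cut2 (P : R -> R) a b w l : a <= w <= b \/ b <= w <= a ->
  P (maxl [:: a, b & l]) + P (maxl (w :: l)) =
  P (maxl [:: a, w & l]) + P (maxl [:: w, b & l]).
Proof.
case=> /andP[h1 h2]; first exact: maxl_cut.
by rewrite maxl_swap (maxl_swap a w) (maxl_swap w b) [RHS]addrC; exact: maxl_cut.
Qed.

Lemma Dval_cut a1 a2 b1 b2 a b w l : a <= w <= b \/ b <= w <= a ->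
  Dval a1 a2 b1 b2 [:: a, b & l] + Dval a1 a2 b1 b2 (w :: l) =
  Dval a1 a2 b1 b2 [:: a, w & l] + Dval a1 a2 b1 b2 [:: w, b & l].
Proof.
move=> awb; have h1 := maxl_cut2 (Dpos a2 b1 b2) l awb.
have awb' : - a <= - w <= - b \/ - b <= - w <= - a.
  by case: awb => /andP[? ?]; [right|left]; rewrite !lerN2; apply/andP.
have h2 := maxl_cut2 (fun t => Dneg a1 a2 b2 (- t)) [seq - t | t <- l] awb'.
rewrite /Dval /minl /= in h1 h2 *; lra.
Qed.

Lemma Dval_perm a1 a2 b1 b2 l l' : l =i l' ->
  Dval a1 a2 b1 b2 l = Dval a1 a2 b1 b2 l'.
Proof. by move=> h; rewrite /Dval (maxl_perm h) (minl_perm h). Qed.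

End ValueLists.

(** * Linearly independent families and the two pieces of a cut simplex *)

Section FreeFamilies.
Variables (R : realType) (n : nat).
Implicit Types (x y u v w : 'cV[R]_n) (r vs ws : seq 'cV[R]_n) (A : 'M[R]_n).

Definition vals x vs : seq R := [seq vdot x v | v <- vs].

Lemma maxl_vals x vs : vs != [::] ->
  exists2 v, v \in vs & maxl (vals x vs) = vdot x v.
Proof.
case: vs => // v vs _; apply/(@mapP _ _ (vdot x)).
exact: (maxl_mem _ (vals x vs)).
Qed.

Lemma minl_vals x vs : vs != [::] ->
  exists2 v, v \in vs & minl (vals x vs) = vdot x v.
Proof.
case: vs => // v vs _; apply/(@mapP _ _ (vdot x)).
exact: (minl_mem _ (vals x vs)).
Qed.

Lemma vals_map A x vs : vals x [seq A *m v | v <- vs] = vals (A^T *m x) vs.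
Proof. by rewrite /vals -map_comp; apply: eq_map => v /=; rewrite vdot_mulmxr. Qed.

Lemma dual_free vs :
  (forall c : nat -> R, exists u, forall i, (i < size vs)%N -> vdot u vs`_i = c i) ->
  free vs.
Proof.
move=> h; change (free (in_tuple vs)); apply/freeP => k k0 i.
have [u uE] := h (fun j => (j == i)%:R).
have /= := congr1 (vdot u) k0; rewrite vdot0r => <-.
rewrite (big_morph (vdot u) (vdotDr u) (vdot0r u)) (bigD1 i)//= big1 => [|j ji].
  by rewrite vdotZr uE// eqxx mulr1 addr0.
by rewrite vdotZr uE// val_eqE (negPf ji) mulr0.
Qed.

Lemma free_dual_mem vs : free vs -> exists u, forall v, v \in vs -> vdot u v = 1.
Proof.
move=> /(free_dual (fun=> 1))[u uE]; exists u => v /(nthP 0)[i ivs <-]; exact: uE.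
Qed.

Lemma free_map_unit A vs : A \in unitmx -> free vs -> free [seq A *m v | v <- vs].
Proof.
move=> Au fvs; apply: dual_free => c; have [u uE] := free_dual c fvs.
exists ((invmx A)^T *m u) => i; rewrite size_map => ivs.
rewrite (nth_map 0)// vdot_mulmxr mulmxA -trmx_mul mulVmx// trmx1 mul1mx.
exact: uE.
Qed.

Lemma free_neq0 vs v : free vs -> v \in vs -> v != 0.
Proof.
move=> /free_dual_mem[u uE] /uE; apply: contra_eqN => /eqP ->.
by rewrite vdot0r eq_sym oner_eq0.
Qed.

Lemma free_dual2 v1 v2 r (a b : R) : free [:: v1, v2 & r] ->
  exists u, [/\ vdot u v1 = a, vdot u v2 = b & forall v, v \in r -> vdot u v = 0].
Proof.
move=> /(free_dual (fun i => if i is j.+1 then if j is _.+1 then 0 else b else a)).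
move=> [u uE]; exists u; split; [exact: (uE 0%N)|exact: (uE 1%N)|].
by move=> v /(nthP 0)[i ir <-]; exact: (uE i.+2).
Qed.

Section Cut.
Variables (v1 v2 : 'cV[R]_n) (r : seq 'cV[R]_n) (lam : R).
Hypotheses (lam0 : 0 < lam) (lam1 : lam < 1) (fv : free [:: v1, v2 & r]).
Let w := (1 - lam) *: v1 + lam *: v2.

Lemma free_cut1 : free [:: v1, w & r].
Proof.
apply: dual_free => c.
have [u uE] := free_dual (fun i => if i == 1%N then (c 1%N - (1 - lam) * c 0%N) / lam else c i) fv.
have u1 := uE 0%N isT; have u2 := uE 1%N isT; rewrite /= in u1 u2.
exists u => -[|[|i]] ir; rewrite /=; last exact: (uE i.+2).
  by rewrite u1.
by rewrite /w vdotDr !vdotZr u1 u2; field; rewrite gt_eqF.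
Qed.

Lemma free_cut2 : free [:: w, v2 & r].
Proof.
apply: dual_free => c.
have [u uE] := free_dual (fun i => if i == 0%N then (c 0%N - lam * c 1%N) / (1 - lam) else c i) fv.
have u1 := uE 0%N isT; have u2 := uE 1%N isT; rewrite /= in u1 u2.
exists u => -[|[|i]] ir; rewrite /=; last exact: (uE i.+2).
  by rewrite /w vdotDr !vdotZr u1 u2; field; rewrite subr_eq0 gt_eqF.
by rewrite u2.
Qed.

Lemma free_cut : free (w :: r).
Proof.
apply: dual_free => c.
have [u uE] := free_dual (fun i => if i is j.+1 then if j == 0%N then c 0%N else c j else c 0%N) fv.
have u1 := uE 0%N isT; have u2 := uE 1%N isT; rewrite /= in u1 u2.
exists u => -[|i] ir; rewrite /=; last exact: (uE i.+2).
by rewrite /w vdotDr !vdotZr u1 u2; ring.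
Qed.

Lemma cut_mem : weighted [:: v1, v2 & r] 1 w.
Proof.
have h : 0 <= 1 - lam by rewrite subr_ge0 ltW.
have := weightedD (weightedZ h (@weighted_mem _ _ [:: v1, v2 & r] v1 _))
  (weightedZ (ltW lam0) (@weighted_mem _ _ [:: v1, v2 & r] v2 _)).
by rewrite !mulr1 subrK; apply; rewrite !inE eqxx ?orbT.
Qed.

Lemma cut_union :
  osimplex [:: v1, w & r] `|` osimplex [:: w, v2 & r] = osimplex [:: v1, v2 & r].
Proof.
have h : 0 < 1 - lam by rewrite subr_gt0.
have wT : osimplex [:: v1, v2 & r] w by apply/osimplexP; exists 1 => //; exact: cut_mem.
apply/seteqP; split=> y.
  have sub ws : {subset ws <= [:: v1, v2, w & r]} -> osimplex ws `<=` osimplex [:: v1, v2 & r].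
    move=> sws; apply: osimplex_sub => v /sws;
      rewrite !inE => /or4P[/eqP ->|/eqP ->|/eqP ->//|vr];
      by apply: osimplex_mem; rewrite !inE ?eqxx ?vr ?orbT.
  by case; apply: sub => v; rewrite !inE => /or3P[->|->|->]; rewrite ?orbT.
move=> /osimplexP[b b1 [t1 t10 [t2 t20 yr]]].
(* The cutting hyperplane is [(1 - lam) * t2 = lam * t1]. On the side of [v1] the whole weight of
   [v2] can be traded for weight on [w], and conversely. *)
have [t12|t21] := leP ((1 - lam) * t2) (lam * t1).
  left; apply/osimplexP; exists b => //.
  exists (t1 - (1 - lam) * (t2 / lam)).
    by rewrite subr_ge0 mulrA ler_pdivrMr// [t1 * _]mulrC.
  exists (t2 / lam); first by rewrite divr_ge0// ltW.
  rewrite (_ : _ - _ - _ = b - t1 - t2); last by field; rewrite gt_eqF.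
  rewrite (_ : _ - _ *: _ = y - t1 *: v1 - t2 *: v2)//.
  apply/colP => i; rewrite !mxE; field; rewrite gt_eqF//.
right; apply/osimplexP; exists b => //.
exists (t1 / (1 - lam)); first by rewrite divr_ge0// ltW.
exists (t2 - lam * (t1 / (1 - lam))).
  by rewrite subr_ge0 mulrA ler_pdivrMr// [t2 * _]mulrC ltW.
rewrite (_ : _ - _ - _ = b - t1 - t2); last by field; rewrite gt_eqF.
rewrite (_ : _ - _ *: _ = y - t1 *: v1 - t2 *: v2)//.
by apply/colP => i; rewrite !mxE; field; rewrite gt_eqF.
Qed.

Lemma cut_inter :
  osimplex [:: v1, w & r] `&` osimplex [:: w, v2 & r] = osimplex (w :: r).
Proof.
have h : 0 < 1 - lam by rewrite subr_gt0.
apply/seteqP; split=> y; last first.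
  move=> yT; split; apply: osimplex_sub yT => v vr; apply: osimplex_mem;
  by move: vr; rewrite !inE => /orP[->|->]; rewrite ?orbT.
have [u1 [u11 u12 u1r]] := free_dual2 1 0 fv.
have [u2 [u21 u22 u2r]] := free_dual2 0 1 fv.
move=> [/osimplexP[b b1 [t1 t10 [t t0 yr]]] /osimplexP[b' b1' [s s0 [s2 s20 yr']]]].
have rE u z c : (forall v, v \in r -> vdot u v = 0) -> weighted r c z -> vdot u z = 0.
  by move=> ur /(weighted_linear ur); rewrite mul0r.
have := rE _ _ _ u1r yr; have := rE _ _ _ u2r yr.
have := rE _ _ _ u1r yr'; have := rE _ _ _ u2r yr'.
rewrite /w !vdot_simp u11 u12 u21 u22.
move=> e1 e2 e3 e4.
(* Comparing the coefficients of [v1] and [v2] in the two representations of [y]: nonnegativity of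
   [t1] and [s2] forces [s = t], so no weight is left on [v1]. *)
have e5 : t1 = (s - t) * (1 - lam) by lra.
have e6 : (t - s) * lam = s2 by lra.
have ts : s <= t by rewrite -subr_ge0 -(pmulr_lge0 _ lam0) e6.
have st : t <= s by rewrite -subr_ge0 -(pmulr_lge0 _ h) -e5.
have tE : s = t by apply/eqP; rewrite eq_le ts st.
have t1E : t1 = 0 by rewrite e5 tE subrr mul0r.
apply/osimplexP; exists b => //; exists t => //.
by move: yr; rewrite t1E scale0r !subr0.
Qed.

End Cut.

End FreeFamilies.

(** * The support function of D *)

Section DbodySupport.
Variables (R : realType) (n : nat) (a1 a2 b1 b2 : R).
Hypotheses (a10 : 0 <= a1) (b10 : 0 <= b1) (a12 : a1 <= a2) (b12 : b1 <= b2)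
  (a21b : a2 - a1 <= b2) (b21a : b2 - b1 <= a2).
Implicit Types (x y u v w : 'cV[R]_n) (vs : seq 'cV[R]_n).

Let P := Dpos a2 b1 b2.
Let Q := Dneg a1 a2 b2.

(** By [b2 - b1 <= a2], [Dpos] is the larger of two linear functions; likewise [a2 - a1 <= b2] makes
    [Dneg] the smaller of two. Here the two mixed inequalities between the constants enter. *)
Lemma Dpos_ge t : a2 * t <= P t /\ (b2 - b1) * t <= P t.
Proof.
rewrite /P /Dpos; have [t0|t0] := leP 0 t.
  by rewrite max_r ?oppr_le0// mulr0 subr0; split=> //; apply: ler_wpM2r.
rewrite max_l ?oppr_ge0 ?(ltW t0)// mulr0 sub0r mulrN opprK.
by split=> //; apply: ler_wnM2r => //; exact: ltW.
Qed.

Lemma Dneg_le t : Q t <= b2 * t /\ Q t <= (a2 - a1) * t.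
Proof.
rewrite /Q /Dneg; have [t0|t0] := leP 0 t.
  by rewrite max_r ?oppr_le0// mulr0 subr0; split=> //; apply: ler_wpM2r.
rewrite max_l ?oppr_ge0 ?(ltW t0)// mulr0 sub0r mulrN opprK.
by split=> //; apply: ler_wnM2r => //; exact: ltW.
Qed.

Lemma cbody_set0 : cbody [set 0 : 'cV[R]_n].
Proof.
split; first exact: compact_set1; last by exists 0.
by move=> x y t -> -> _ _; rewrite !scaler0 addr0.
Qed.

Lemma cbody_Dbody vs : cbody (Dbody a1 a2 b1 b2 vs).
Proof.
by case: vs => [|v [|w vs]]; [exact: cbody_set0|exact: cbody_conv_seq|exact: cbody_conv_seq].
Qed.

Lemma support_Dbody vs x :
  support (Dbody a1 a2 b1 b2 vs) x = Dval a1 a2 b1 b2 (vals x vs).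
Proof.
case: vs => [|v [|w vs]].
- rewrite (@supportE _ _ _ _ 0)//= ?vdot0r; last by move=> y ->; rewrite vdot0r.
  by rewrite /Dval /minl /= /Dpos /Dneg /= !oppr0 maxxx !mulr0 subrr.
- rewrite /= /Dval /minl /= opprK /Dpos /Dneg; set t := vdot x v.
  have [t0|t0] := leP 0 t.
    rewrite max_r ?oppr_le0//.
    rewrite (@support_conv_seq _ _ _ _ (a1 *: v)) ?inE ?eqxx ?orbT// ?vdotZr -/t;
      first by ring.
    move=> y; rewrite !inE => /orP[]/eqP ->; rewrite ?vdotNr !vdotZr -/t//.
    have : 0 <= a1 * t by exact: mulr_ge0. have : 0 <= b1 * t by exact: mulr_ge0. lra.
  rewrite max_l ?oppr_ge0 ?(ltW t0)//.
  rewrite (@support_conv_seq _ _ _ _ (- (b1 *: v))) ?inE ?eqxx ?orbT// ?vdotNr ?vdotZr -/t;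
    first by ring.
  move=> y; rewrite !inE => /orP[]/eqP ->; rewrite ?vdotNr !vdotZr -/t//.
  have : a1 * t <= 0 by rewrite mulr_ge0_le0// ltW. have : b1 * t <= 0 by rewrite mulr_ge0_le0// ltW. lra.
have [vs' vs'E] : {vs' | vs' = [:: v, w & vs]} by exists [:: v, w & vs].
rewrite /Dbody -vs'E; set s := (X in support (conv_seq X) _).
have sP y : y \in s <-> exists vi vj, [/\ vi \in vs', vj \in vs' &
    [\/ y = a2 *: vi - b2 *: vj, y = a2 *: vi - (a2 - a1) *: vj | y = (b2 - b1) *: vi - b2 *: vj]].
  rewrite /s !mem_cat; split.
    by move=> /or3P[] /allpairsP[[vi vj] [/= h1 h2 ->]]; exists vi, vj; split=> //;
      [exact: Or31|exact: Or32|exact: Or33].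
  move=> [vi [vj [h1 h2 []->]]]; apply/or3P; [apply: Or31|apply: Or32|apply: Or33].
  - exact: (allpairs_f (fun u v => a2 *: u - b2 *: v)).
  - exact: (allpairs_f (fun u v => a2 *: u - (a2 - a1) *: v)).
  - exact: (allpairs_f (fun u v => (b2 - b1) *: u - b2 *: v)).
have [vM vMin MM] : exists2 vM, vM \in vs' & maxl (vals x vs') = vdot x vM.
  by apply: maxl_vals; rewrite vs'E.
have [vm vmin mm] : exists2 vm, vm \in vs' & minl (vals x vs') = vdot x vm.
  by apply: minl_vals; rewrite vs'E.
have vMge u : u \in vs' -> vdot x u <= vdot x vM.
  by move=> us; rewrite -MM; apply: maxl_ge; exact: map_f.
have vmle u : u \in vs' -> vdot x vm <= vdot x u.
  by move=> us; rewrite -mm; apply: minl_le; exact: map_f.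
have le_s y : y \in s -> vdot x y <= P (vdot x vM) - Q (vdot x vm).
  move=> /sP[vi [vj [/vMge hi /vmle hj]]].
  have [p1 p2] := Dpos_ge (vdot x vM); have [q1 q2] := Dneg_le (vdot x vm).
  have a20 : 0 <= a2 by exact: le_trans a12.
  have b20 : 0 <= b2 by exact: le_trans b12.
  have c1 := ler_wpM2l a20 hi; have c2 := ler_wpM2l b20 hj.
  have d1 : (b2 - b1) * vdot x vi <= (b2 - b1) * vdot x vM by rewrite ler_wpM2l// subr_ge0.
  have d2 : (a2 - a1) * vdot x vm <= (a2 - a1) * vdot x vj by rewrite ler_wpM2l// subr_ge0.
  by move=> []->; rewrite vdotBr !vdotZr; lra.
(* Each of the three families of points is maximal for one sign pattern of the minimum and the
   maximum. The fourth pattern, a negative maximum with a nonnegative minimum, cannot occur, which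
   explains why there is no fourth family. *)
have [z zs zE] : exists2 z, z \in s & vdot x z = P (vdot x vM) - Q (vdot x vm).
  have Mm := vmle _ vMin; rewrite /P /Q /Dpos /Dneg.
  have [m0|m0] := leP 0 (vdot x vm).
    exists (a2 *: vM - (a2 - a1) *: vm).
      by apply/sP; exists vM, vm; split=> //; exact: Or32.
    have M0 := le_trans m0 Mm.
    by rewrite vdotBr !vdotZr (max_l M0) !max_r ?oppr_le0//; ring.
  have [M0|M0] := leP 0 (vdot x vM).
    exists (a2 *: vM - b2 *: vm).
      by apply/sP; exists vM, vm; split=> //; exact: Or31.
    by rewrite vdotBr !vdotZr (max_r (x := - vdot x vM)) ?oppr_le0// max_l ?oppr_ge0 ?(ltW m0)//; ring.
  exists ((b2 - b1) *: vM - b2 *: vm).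
    by apply/sP; exists vM, vm; split=> //; exact: Or33.
  by rewrite vdotBr !vdotZr !max_l ?oppr_ge0 ?(ltW m0) ?(ltW M0)//; ring.
rewrite /Dval MM mm (support_conv_seq zs) ?zE// => y; rewrite zE; exact: le_s.
Qed.

End DbodySupport.

(** * The support function of D is a valuation *)

Section DbodyValuation.
Variables (R : realType) (n : nat).
Implicit Types (x y u v w l : 'cV[R]_n) (vs ks ls ws us : seq 'cV[R]_n)
  (T C : set 'cV[R]_n).

(* The facet of a simplex opposite to the origin, described without reference
   to its vertices. *)
Definition outer T : set 'cV[R]_n := [set y | T y /\ forall s, 1 < s -> ~ T (s *: y)].

Lemma osimplex_functional vs l y : (forall v, v \in vs -> vdot l v = 1) ->
  osimplex vs y -> [/\ 0 <= vdot l y, vdot l y <= 1 & weighted vs (vdot l y) y].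
Proof.
move=> lvs /osimplexP[b b1 yb].
have lyb : vdot l y = b by rewrite (weighted_linear lvs yb) mul1r.
by rewrite lyb; split=> //; exact: weighted_ge0 yb.
Qed.

Lemma outer_osimplex vs l y : (forall v, v \in vs -> vdot l v = 1) ->
  outer (osimplex vs) y <-> osimplex vs y /\ vdot l y = 1.
Proof.
move=> lvs; split=> -[Ty h]; split=> //; last first.
  move=> s s1 /(osimplex_functional lvs)[_ + _].
  by rewrite vdotZr h mulr1 leNgt s1.
have [ly0 ly1 yw] := osimplex_functional lvs Ty.
apply/eqP; rewrite eq_le ly1 /= leNgt; apply/negP => lt1.
have [l0|l0] := eqVneq (vdot l y) 0.
  have y0 : y = 0 by move: yw; rewrite l0; exact: weighted_eq0.
  by apply: (h 2); [lra|rewrite y0 scaler0; exact: osimplex0].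
have lgt0 : 0 < vdot l y by rewrite lt0r l0.
apply: (h (vdot l y)^-1); first by rewrite invf_gt1.
apply/osimplexP; exists 1 => //.
by rewrite -(mulVf l0); apply: weightedZ => //; rewrite invr_ge0.
Qed.

Lemma outer_weighted vs l y : (forall v, v \in vs -> vdot l v = 1) ->
  outer (osimplex vs) y <-> weighted vs 1 y.
Proof.
move=> lvs; rewrite (outer_osimplex _ lvs); split.
  by move=> [/(osimplex_functional lvs)[_ _ h] <-].
move=> yw; split; first by apply/osimplexP; exists 1.
by rewrite (weighted_linear lvs yw) mul1r.
Qed.

Definition is_max x C (m : R) :=
  (exists2 y, C y & vdot x y = m) /\ forall y, C y -> vdot x y <= m.

Lemma is_max_inj x C m m' : is_max x C m -> is_max x C m' -> m = m'.
Proof.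
move=> [[y Cy <-] ym] [[y' Cy' <-] ym'].
by apply/eqP; rewrite eq_le ym// ym'.
Qed.

Lemma is_max_outer x vs : free vs -> vs != [::] ->
  is_max x (outer (osimplex vs)) (maxl (vals x vs)).
Proof.
move=> /free_dual_mem[l lvs] vs0; split.
  have [u us uE] := maxl_vals x vs0.
  by exists u => //; apply/(outer_weighted _ lvs); exact: weighted_mem.
move=> y /(outer_weighted _ lvs) yw.
rewrite -[leRHS]mulr1; apply: weighted_le yw => v vvs.
by apply: maxl_ge; exact: map_f.
Qed.

Lemma minl_valsN x vs : minl (vals x vs) = - maxl (vals (- x) vs).
Proof.
congr (- maxl _); rewrite /vals -map_comp; apply: eq_map => v /=.
by rewrite vdotNl.
Qed.

Lemma outer_nonempty vs : free vs -> (vs != [::]) <-> outer (osimplex vs) !=set0.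
Proof.
move=> /free_dual_mem[l lvs]; split=> [|[y /(outer_weighted _ lvs)]].
  by case: vs lvs => // v vs lvs _; exists v;
    apply/(outer_weighted _ lvs)/weighted_mem/mem_head.
by case: vs {lvs} => // -[/eqP]; rewrite oner_eq0.
Qed.

(** The outer facet is determined by the set alone, so vertex lists of the same simplex need not be
    compared. *)
Lemma maxl_osimplex x vs ws : free vs -> free ws -> osimplex vs = osimplex ws ->
  maxl (vals x vs) = maxl (vals x ws).
Proof.
move=> fvs fws E; have [vs0|vs0] := eqVneq vs [::].
  rewrite vs0; have [->//|/(outer_nonempty fws)] := eqVneq ws [::].
  by rewrite -E => /(outer_nonempty fvs); rewrite vs0.
have ws0 : ws != [::] by apply/(outer_nonempty fws); rewrite -E; apply/outer_nonempty.
apply: is_max_inj (is_max_outer x fvs vs0) _; rewrite E; exact: is_max_outer.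
Qed.

Lemma cbody_osimplex vs : cbody (osimplex vs).
Proof. exact: cbody_conv_seq. Qed.

(* If a neighbourhood of the vertex [w] of [osimplex ws] lies in
   [osimplex ks], then the outer facets span the same hyperplane. *)
Lemma outer_functional ks ls ws l w : free ks -> 
  (forall v, v \in ws -> vdot l v = 1) -> w \in ws ->
  osimplex ws = osimplex ks `|` osimplex ls -> ~ osimplex ls w ->
  forall k, k \in ks -> vdot l k = 1.
Proof.
move=> fks lws wws E Lw.
have [m mks] := free_dual_mem fks.
have KS : osimplex ks `<=` osimplex ws by rewrite E; exact: subsetUl.
have Kw : osimplex ks w.
  by have := osimplex_mem wws; rewrite E => -[].
(* The point [w] cannot be pushed outwards inside the union, hence not inside [osimplex ks], so it
   lies on the outer facet of the latter. *)
have mw : vdot m w = 1.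
  apply: ((outer_osimplex _ mks).1 _).2; split=> // s s1 /KS.
  by apply: ((outer_osimplex _ lws).2 (conj (osimplex_mem wws) (lws _ wws))).2.
(* A short step from [w] towards [w'] avoids [osimplex ls], from which [w] is strictly separated. It
   therefore stays in [osimplex ks], where [vdot m] is at most 1. *)
have mws w' : w' \in ws -> vdot m w' <= 1.
  move=> w'ws.
  have [cL vL L0] := cbody_osimplex ls.
  have [x xL] := separation (cbody_osimplex ls) Lw.
  have [c Lc cE] := support_attained x cL L0.
  pose g := vdot x w - vdot x c; have g0 : 0 < g by rewrite subr_gt0 xL.
  pose d := vdot x w - vdot x w'.
  (* With this step length the loss [e * d] of the separating functional stays below the gap [g]. *)
  pose e := g / (g + `|d|).
  have gd : 0 < g + `|d| by rewrite ltr_wpDr.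
  have e0 : 0 < e by rewrite divr_gt0.
  have e1 : e <= 1 by rewrite ler_pdivrMr// mul1r lerDl.
  have ed : e * d < g.
    apply: (@le_lt_trans _ _ (e * `|d|)); first by rewrite ler_pM2l// ler_norm.
    by rewrite /e mulrAC ltr_pdivrMr// mulrDr ltrDr mulr_gt0.
  pose p := (1 - e) *: w + e *: w'.
  have Sp : osimplex ws p.
    by have [_ vS _] := cbody_osimplex ws; apply: vS; rewrite ?(ltW e0)//;
      exact: osimplex_mem.
  have Lp : ~ osimplex ls p.
    move=> Lp; have := support_ub x cL Lp; rewrite cE leNgt => /negP; apply.
    rewrite /p vdotDr !vdotZr -subr_gt0.
    have -> : (1 - e) * vdot x w + e * vdot x w' - vdot x c = g - e * d by rewrite /g /d;
      ring.
    by rewrite subr_gt0.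
  have Kp : osimplex ks p by move: Sp; rewrite E => -[].
  have [_ + _] := osimplex_functional mks Kp.
  rewrite /p vdotDr !vdotZr mw mulr1 -subr_ge0.
  have -> : 1 - (1 - e + e * vdot m w') = e * (1 - vdot m w') by ring.
  by rewrite pmulr_rge0// subr_ge0.
(* A vertex [k] of weight [b] in [ws] has [1 = vdot m k <= b], so [b = 1] and [k] lies on the
   hyperplane [vdot l = 1]. *)
move=> k kks; have := KS _ (osimplex_mem kks) => /osimplexP[b b1 kb].
have := weighted_le mws kb; rewrite (mks _ kks) mul1r => b1'.
have bE : b = 1 by apply/eqP; rewrite eq_le b1 b1'.
by rewrite (weighted_linear lws kb) bE mulr1.
Qed.

(** Otherwise the two closed simplices would disconnect the segment. *)
Lemma segment_cross ks ls y1 y2 :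
  osimplex ks y1 -> osimplex ls y2 ->
  (forall t, 0 <= t <= 1 -> (osimplex ks `|` osimplex ls) (y1 + t *: (y2 - y1))) ->
  exists2 t, 0 <= t <= 1 & (osimplex ks `&` osimplex ls) (y1 + t *: (y2 - y1)).
Proof.
move=> K1 L2 KL; apply: contrapT => noI.
pose f (t : R) := y1 + t *: (y2 - y1).
have cf : continuous f.
  by move=> t; apply: cvgD; [exact: cvg_cst|exact: scalel_continuous].
have clos vs : closed (f @^-1` osimplex vs).
  apply: preimage_closed => [t _|]; first exact: cf.
  apply: compact_closed; first exact: norm_hausdorff.
  by have [] := cbody_osimplex vs.
pose B := `[0, 1]%classic `&` f @^-1` osimplex ks.
have BE : B = `[0, 1]%classic `&` ~` (f @^-1` osimplex ls).
  apply/seteqP; split=> t [t01 /= ft]; split => //.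
    by move=> Lt; apply: noI; exists t.
  by have [] := KL t t01.
have B01 : B = `[0, 1]%classic.
  apply: segment_connected.
  - by exists 0; split; rewrite /= ?in_itv/= ?lexx ?ler01// /f scale0r addr0.
  - by exists (~` (f @^-1` osimplex ls)); [exact: closed_openC|].
  - by exists (f @^-1` osimplex ks).
have : B 1 by rewrite B01 /= in_itv /= ler01 lexx.
by rewrite BE => -[_ nL]; apply: nL; rewrite /= /f scale1r addrC subrK.
Qed.

Lemma maxl_valuation (P : R -> R) x ks ls ws us :
  free ks -> free ls -> free ws -> free us ->
  osimplex ws = osimplex ks `|` osimplex ls ->
  osimplex us = osimplex ks `&` osimplex ls ->
  P (maxl (vals x ws)) + P (maxl (vals x us)) =
  P (maxl (vals x ks)) + P (maxl (vals x ls)).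
Proof.
move=> fks fls fws fus EU EI.
have nested ws' us' : free ws' -> free us' -> osimplex ws' = osimplex ws ->
    osimplex us' = osimplex us -> P (maxl (vals x ws)) + P (maxl (vals x us)) =
    P (maxl (vals x ws')) + P (maxl (vals x us')).
  move=> fw' fu' Ew Eu.
  by rewrite (maxl_osimplex x fw' fws Ew) (maxl_osimplex x fu' fus Eu).
(* If one simplex contains the other, union and intersection are the two given simplices and the
   identity is trivial. *)
have [SL|] := pselect (forall w, w \in ws -> osimplex ls w).
  have WL : osimplex ws `<=` osimplex ls by exact: osimplex_sub.
  rewrite (nested ls ks)// 1?addrC//; apply/seteqP; rewrite ?EI ?EU; split.
  - exact: subsetUr.
  - by rewrite -EU.
  - by move=> y Ky; split=> //; apply: WL; rewrite EU; left.
  - exact: subIsetl.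
move=> /existsNP[w /not_implyP[wws Lw]].
have [SK|] := pselect (forall w, w \in ws -> osimplex ks w).
  have WK : osimplex ws `<=` osimplex ks by exact: osimplex_sub.
  rewrite (nested ks ls)//; apply/seteqP; rewrite ?EI ?EU; split.
  - exact: subsetUl.
  - by rewrite -EU.
  - by move=> y Ly; split=> //; apply: WK; rewrite EU; right.
  - exact: subIsetr.
move=> /existsNP[w' /not_implyP[w'ws Kw']].
(* Neither simplex contains the other now, so all the outer facets involved lie in the hyperplane
   [vdot l = 1]. *)
have [l lws] := free_dual_mem fws.
have lks : forall k, k \in ks -> vdot l k = 1 by exact: (outer_functional fks lws wws EU Lw).
have EU' : osimplex ws = osimplex ls `|` osimplex ks by rewrite setUC.
have lls : forall k, k \in ls -> vdot l k = 1 by exact: (outer_functional fls lws w'ws EU' Kw').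
have oU y : outer (osimplex ws) y <-> outer (osimplex ks) y \/ outer (osimplex ls) y.
  rewrite (outer_osimplex _ lws) (outer_osimplex _ lks) (outer_osimplex _ lls) EU.
  by split=> [[[]]|[[]|[]]] => h1 h2; [left|right|split => //; left|split => //; right].
have oI y : outer (osimplex us) y <-> outer (osimplex ks) y /\ outer (osimplex ls) y.
  rewrite (outer_osimplex _ lks) (outer_osimplex _ lls) EI; split; last first.
    move=> [[Ky ly] [Ly _]]; split=> // s s1 [/(osimplex_functional lks)[_ + _] _].
    by rewrite vdotZr ly mulr1 leNgt s1.
  move=> [[Ky Ly] h].
  have [ly0 ly1 kw] := osimplex_functional lks Ky.
  have [_ _ lw] := osimplex_functional lls Ly.
  suff lyE : vdot l y = 1 by [].
  apply/eqP; rewrite eq_le ly1 /= leNgt; apply/negP => lt1.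
  have [l0|l0] := eqVneq (vdot l y) 0.
    have y0 : y = 0 by move: kw; rewrite l0; exact: weighted_eq0.
    by apply: (h 2); [lra|rewrite y0 scaler0; split; exact: osimplex0].
  have lgt0 : 0 < vdot l y by rewrite lt0r l0.
  have lV : 0 <= (vdot l y)^-1 by rewrite invr_ge0.
  apply: (h (vdot l y)^-1); first by rewrite invf_gt1.
  split; apply/osimplexP; exists 1 => //.
    by have := weightedZ lV kw; rewrite mulVf.
  by have := weightedZ lV lw; rewrite mulVf.
have cross y1 y2 : outer (osimplex ks) y1 -> outer (osimplex ls) y2 ->
    exists2 t, 0 <= t <= 1 & outer (osimplex us) (y1 + t *: (y2 - y1)).
  move=> /(outer_osimplex _ lks)[K1 l1] /(outer_osimplex _ lls)[L2 l2].
  have [|t t01 [Kt Lt]] := segment_cross K1 L2.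
    move=> t /andP[t0 t1]; rewrite -EU.
    have -> : y1 + t *: (y2 - y1) = (1 - t) *: y1 + t *: y2.
      by apply/colP => i; rewrite !mxE; ring.
    have [_ vS _] := cbody_osimplex ws.
    by apply: vS => //; rewrite EU; [left|right].
  exists t => //; apply/oI; split; [apply/(outer_osimplex _ lks)|apply/(outer_osimplex _ lls)];
    by split=> //; rewrite vdotDr vdotZr vdotBr l1 l2 subrr mulr0 addr0.
have ks0 : ks != [::].
  by apply/(outer_nonempty fks); exists w; apply/(outer_osimplex _ lks); split;
    [have := osimplex_mem wws; rewrite EU => -[]|exact: lws].
have ls0 : ls != [::].
  by apply/(outer_nonempty fls); exists w'; apply/(outer_osimplex _ lls); split;
    [have := osimplex_mem w'ws; rewrite EU => -[]|exact: lws].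
have ws0 : ws != [::] by case: (ws) wws.
have [[y1 o1 m1] M1] := is_max_outer x fks ks0.
have [[y2 o2 m2] M2] := is_max_outer x fls ls0.
have [t /andP[t0 t1] oT] := cross _ _ o1 o2.
have us0 : us != [::] by apply/(outer_nonempty fus); exists (y1 + t *: (y2 - y1)).
have MW := is_max_outer x fws ws0; have MU := is_max_outer x fus us0.
move: m1 m2 M1 M2; set mk := maxl (vals x ks); set ml := maxl (vals x ls) => m1 m2 M1 M2.
have -> : maxl (vals x ws) = Num.max mk ml.
  apply: is_max_inj MW _; split.
    have [_|_] := leP mk ml; [exists y2|exists y1] => //; apply/oU; by [left|right].
  by move=> y /oU[/M1|/M2] h; rewrite le_max h ?orbT.
(* A segment joining maximisers on the two facets meets the common facet, where the value of [x]
   lies between the two maxima. Hence union and intersection carry the larger and the smaller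
   maximum. *)
have -> : maxl (vals x us) = Num.min mk ml.
  apply/eqP; rewrite eq_le; apply/andP; split.
    have [[y /oI[/M1 h1 /M2 h2] <-] _] := MU; by rewrite le_min h1 h2.
  apply: le_trans (MU.2 _ oT); rewrite vdotDr vdotZr vdotBr m1 m2.
  have [h|h] := leP mk ml; first by rewrite lerDl mulr_ge0// subr_ge0.
  have : 0 <= (1 - t) * (mk - ml) by rewrite mulr_ge0// subr_ge0// ltW.
  by lra.
by have [_|_] := leP mk ml; rewrite 1?addrC.
Qed.

Lemma Dval_valuation a1 a2 b1 b2 x ks ls ws us :
  free ks -> free ls -> free ws -> free us ->
  osimplex ws = osimplex ks `|` osimplex ls ->
  osimplex us = osimplex ks `&` osimplex ls ->
  Dval a1 a2 b1 b2 (vals x ws) + Dval a1 a2 b1 b2 (vals x us) =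
  Dval a1 a2 b1 b2 (vals x ks) + Dval a1 a2 b1 b2 (vals x ls).
Proof.
move=> fks fls fws fus EU EI; rewrite /Dval !minl_valsN.
have h1 := maxl_valuation (Dpos a2 b1 b2) x fks fls fws fus EU EI.
have h2 := maxl_valuation (fun t => Dneg a1 a2 b2 (- t)) (- x) fks fls fws fus EU EI.
by rewrite /= in h2; lra.
Qed.

End DbodyValuation.

(** * Moment bodies and the converse direction *)

Section RankOne.
Variables (R : realType) (n : nat).
Implicit Types (x y u v w : 'cV[R]_n) (vs r : seq 'cV[R]_n).

(** These maps fix the hyperplane orthogonal to [v] and move points along [u]: transvections when
    [vdot v u = 0], stretches otherwise. They supply the special matrices used below. *)
Definition rank1 u v : 'M[R]_n := 1%:M + u *m v^T.

Lemma rank1E u v y : rank1 u v *m y = y + vdot v y *: u.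
Proof.
rewrite mulmxDl mul1mx -mulmxA [v^T *m y]mx11_scalar -vdotE.
by rewrite mul_mx_scalar.
Qed.

Lemma rank1_tr u v : (rank1 u v)^T = rank1 v u.
Proof. by rewrite linearD /= trmx1 trmx_mul trmxK. Qed.

(** Matrix determinant lemma: one block matrix is factored into triangular ones through either of
    its two Schur complements. *)
Lemma det_rank1 u v : \det (rank1 u v) = 1 + vdot v u.
Proof.
have e1 : block_mx (1%:M : 'M[R]_1) 0 u 1%:M *m block_mx 1%:M (- v^T) 0 (rank1 u v) =
    block_mx 1%:M (- v^T) u 1%:M.
  rewrite mulmx_block ?(mul1mx, mul0mx, mulmx1, mulmx0, addr0, mulmxN).
  by rewrite /rank1 addrC -addrA subrr addr0.
have e2 : block_mx (1%:M : 'M[R]_1) (- v^T) 0 1%:M *m block_mx (1%:M + v^T *m u) 0 u 1%:M =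
    block_mx 1%:M (- v^T) u 1%:M.
  rewrite mulmx_block ?(mul1mx, mul0mx, mulmx1, mulmx0, add0r, mulNmx).
  by rewrite addrK.
have := congr1 determinant (etrans e1 (esym e2)).
rewrite !det_mulmx !det_lblock !det_ublock !det1 !mul1r => ->.
by rewrite mulr1 det_mx11 !mxE eqxx; congr (_ + _); apply: eq_bigr => i _; rewrite !mxE.
Qed.

Lemma rank1_fix u v vs : (forall w, w \in vs -> vdot v w = 0) ->
  [seq rank1 u v *m w | w <- vs] = vs.
Proof.
move=> vvs; rewrite -[RHS]map_id; apply/eq_in_map => w /vvs h.
by rewrite rank1E h scale0r addr0.
Qed.

End RankOne.

(** * Moment functionals of simplices and the combined body *)

Section Moment.
Variables (R : realType) (n : nat).
Implicit Types (x y u v w : 'cV[R]_n) (vs r ks ls ws us : seq 'cV[R]_n).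

Definition moment vs x : R := fine (moment_support (osimplex vs) x).

Lemma momentE vs x : free vs -> (moment vs x)%:E = moment_support (osimplex vs) x.
Proof. by move=> fvs; rewrite fineK// moment_simplex_fin. Qed.

Lemma moment_sublinear vs : free vs -> sublinear (moment vs).
Proof.
move=> fvs; have bT := borel_osimplex fvs; split=> [x y|k x k0].
  by rewrite -lee_fin EFinD !momentE// moment_supportD.
by apply: EFin_inj; rewrite EFinM !momentE// moment_supportZ.
Qed.

Lemma moment_perm vs ws x : vs =i ws -> moment vs x = moment ws x.
Proof. by move=> /eq_mem_osimplex h; rewrite /moment h. Qed.

Lemma moment_valuation ks ls ws us x :
  free ks -> free ls -> free ws -> free us ->
  osimplex ws = osimplex ks `|` osimplex ls ->
  osimplex us = osimplex ks `&` osimplex ls ->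
  moment ws x + moment us x = moment ks x + moment ls x.
Proof.
move=> fks fls fws fus EU EI; apply: EFin_inj; rewrite !EFinD !momentE//.
by rewrite EU EI moment_support_valuation//; exact: borel_osimplex.
Qed.

Lemma moment_map (A : 'M[R]_n) vs x : A \in unitmx -> free vs ->
  moment [seq A *m v | v <- vs] x = `|\det A| * moment vs (A^T *m x).
Proof.
move=> Au fvs; have fAvs := free_map_unit Au fvs.
apply: EFin_inj; rewrite EFinM !momentE// -limage_osimplex moment_support_image//.
  exact: borel_osimplex.
by rewrite limage_osimplex; exact: borel_osimplex.
Qed.

(* Stretching the complement of the span of [vs] fixes the simplex but
   multiplies the Lebesgue measure by 2. *)
Lemma moment_lower vs x : free vs -> (size vs < n)%N -> moment vs x = 0.
Proof.
move=> fvs svs; have [u u0 uvs] := free_perp fvs svs.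
pose A := rank1 ((vdot u u)^-1 *: u) u.
have detA : \det A = 2.
  by rewrite det_rank1 vdotZr mulVf// vdot_eq0.
have Au : A \in unitmx by rewrite unitmxE detA unitfE pnatr_eq0.
have := moment_map x Au fvs; rewrite rank1_fix// detA.
have -> : moment vs (A^T *m x) = moment vs x.
  congr fine; apply: eq_lebesgue_int => y; rewrite /moment_density indicE.
  have [|_] := boolP (y \in osimplex vs); last by rewrite !mul0r.
  rewrite inE => /osimplexP[b _ yb]; congr (_ * Num.max _ _)%:E.
  rewrite rank1_tr rank1E vdotDl !vdotZl.
  by rewrite (weighted_linear uvs yb) mul0r !mulr0 addr0.
rewrite normr_nat => h; lra.
Qed.

Lemma Mplus_body vs : free vs ->
  Mplus (osimplex vs) = body_of_support (fun x => (moment vs x)%:E).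
Proof.
by move=> fvs; rewrite MplusE; congr body_of_support; apply/funext => x; rewrite momentE.
Qed.

Lemma Mminus_body vs : free vs ->
  Mminus (osimplex vs) = body_of_support (fun x => (moment vs (- x))%:E).
Proof.
by move=> fvs; rewrite MminusE; congr body_of_support; apply/funext => x; rewrite momentE.
Qed.

Lemma sublinearN (g : 'cV[R]_n -> R) : sublinear g -> sublinear (fun x => g (- x)).
Proof.
by move=> [gD gZ]; split=> [x y|k x k0]; [rewrite opprD|rewrite -scalerN gZ].
Qed.

Section Combination.
Variables a1 a2 b1 b2 c1 c2 : R.
Hypotheses (a10 : 0 <= a1) (b10 : 0 <= b1) (a12 : a1 <= a2) (b12 : b1 <= b2)
  (a21b : a2 - a1 <= b2) (b21a : b2 - b1 <= a2) (c10 : 0 <= c1) (c20 : 0 <= c2).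

Definition combination vs :=
  mink_sum (mink_sum (bscale c1 (Mplus (osimplex vs)))
    (bscale c2 (Mminus (osimplex vs)))) (Dbody a1 a2 b1 b2 vs).

Lemma cbody_combination vs : free vs -> cbody (combination vs).
Proof.
move=> fvs; have ms := moment_sublinear fvs.
rewrite /combination Mplus_body// Mminus_body//.
apply: cbody_mink_sum; last exact: cbody_Dbody.
apply: cbody_mink_sum; apply: cbody_bscale; apply: cbody_body_of_support => //.
exact: sublinearN.
Qed.

Lemma support_combination vs x : free vs -> support (combination vs) x =
  c1 * moment vs x + c2 * moment vs (- x) + Dval a1 a2 b1 b2 (vals x vs).
Proof.
move=> fvs; have ms := moment_sublinear fvs; have mns := sublinearN ms.
have cb1 := cbody_body_of_support ms; have cb2 := cbody_body_of_support mns.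
rewrite /combination Mplus_body// Mminus_body//.
rewrite support_mink_sum; [|by apply: cbody_mink_sum;
  exact: cbody_bscale|exact: cbody_Dbody].
rewrite support_Dbody//; congr (_ + _).
rewrite support_mink_sum; [|exact: cbody_bscale..].
rewrite !support_bscale// support_body_of_support// (support_body_of_support _ mns).
by [].
Qed.

Variable Z : set 'cV[R]_n -> set 'cV[R]_n.
Hypothesis ZE : forall vs, free vs -> Z (osimplex vs) = combination vs.

Lemma combination_valuation : minkowski_valuation Z.
Proof.
move=> K L [ks [fks ->]] [ls [fls ->]] [ws [fws EU]] [us [fus EI]].
have cb vs : free vs -> cbody (Z (osimplex vs)).
  by move=> fvs; rewrite ZE//; exact: cbody_combination.
rewrite EU EI; apply: support_inj.
- by apply: cbody_mink_sum; exact: cb.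
- by apply: cbody_mink_sum; exact: cb.
move=> x; rewrite !support_mink_sum; [|exact: cb..].
rewrite !ZE// !support_combination//.
have m1 := moment_valuation x fks fls fws fus (esym EU) (esym EI).
have m2 := moment_valuation (- x) fks fls fws fus (esym EU) (esym EI).
have d := Dval_valuation a1 a2 b1 b2 x fks fls fws fus (esym EU) (esym EI).
transitivity (c1 * (moment ws x + moment us x) + c2 * (moment ws (- x) + moment us (- x))
  + (Dval a1 a2 b1 b2 (vals x ws) + Dval a1 a2 b1 b2 (vals x us))); first by ring.
by rewrite m1 m2 d; ring.
Qed.

Lemma combination_covariant : SLn_covariant Z.
Proof.
move=> phi K detp [vs [fvs ->]].
have phiu : phi \in unitmx by rewrite unitmxE detp unitr1.
have fpvs := free_map_unit phiu fvs.
rewrite limage_osimplex !ZE//; apply: support_inj.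
- exact: cbody_combination.
- by apply: cbody_limage; exact: cbody_combination.
move=> x; rewrite support_limage ?support_combination//; last exact: cbody_combination.
by rewrite !moment_map// detp normr1 !mul1r vals_map mulmxN.
Qed.

End Combination.

End Moment.

(** * Functionals additive under cuts *)

(** A negative value of [k] would have multiples violating the lower bound, so [k] is nonnegative.
    Being additive it is then monotone, and squeezing between rational multiples gives linearity. *)
Lemma additive_linear (R : realType) (k : R -> R) (B : R) :
  (forall s t, 0 < s -> 0 < t -> k (s + t) = k s + k t) ->
  (forall t, 0 < t -> - B <= k t) -> forall t, 0 < t -> k t = t * k 1.
Proof.
move=> kD kB.
have kM m t : 0 < t -> k (m.+1%:R * t) = m.+1%:R * k t.
  move=> t0; elim: m => [|m IH]; first by rewrite !mul1r.
  by rewrite -natr1 !mulrDl !mul1r kD ?IH// mulr_gt0.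
have k0 t : 0 < t -> 0 <= k t.
  move=> t0; rewrite leNgt; apply/negP => kt.
  have := archi_boundP (ltW (_ : 0 < (`|B| + 1) / - k t)).
  rewrite divr_gt0 ?oppr_gt0 ?ltr_wpDl// => /(_ isT).
  set m := Num.bound _; rewrite ltr_pdivrMr ?oppr_gt0// => h.
  have := kB (m.+1%:R * t) (mulr_gt0 (ltr0Sn _ _) t0); rewrite kM//.
  have := ler_norm B; rewrite -natr1 mulrDl mul1r.
  by move: h; rewrite mulrN; lra.
have mono s t : 0 < s -> s <= t -> k s <= k t.
  move=> s0; rewrite le_eqVlt => /orP[/eqP ->//|st].
  by rewrite -(subrK s t) kD ?subr_gt0// lerDr k0 ?subr_gt0.
move=> t t0; apply/eqP; rewrite -subr_eq0 -normr_eq0; apply/eqP.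
have c0 : 0 <= k 1 by exact: k0.
(* With [p] the integer part of [m.+1%:R * t], both multiples lie between [p%:R * k 1] and
   [p.+1%:R * k 1]. *)
have key m : m.+1%:R * `|k t - t * k 1| <= k 1.
  have mt0 : 0 < m.+1%:R * t by rewrite mulr_gt0.
  have /andP[p1 p2] := truncn_itv (ltW mt0).
  set p := Num.truncn _ in p1 p2.
  have h1 : p%:R * k 1 <= m.+1%:R * k t.
    rewrite -kM//; case: p p1 p2 => [|p] p1 _; first by rewrite mul0r k0.
    by rewrite -kM// mulr1 mono.
  have h2 : m.+1%:R * k t <= p.+1%:R * k 1.
    by rewrite -!kM// mulr1; apply: mono => //; exact: ltW.
  have h3 : p%:R * k 1 <= m.+1%:R * t * k 1 by rewrite ler_wpM2r.
  have h4 : m.+1%:R * t * k 1 <= p.+1%:R * k 1 by rewrite ler_wpM2r// ltW.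
  rewrite -[X in X * _]gtr0_norm// -normrM mulrBr mulrA ler_norml.
  move: h2 h4; rewrite -[p.+1%:R]natr1 mulrDl mul1r => h2 h4.
  by apply/andP; split; lra.
apply/eqP; rewrite eq_le normr_ge0 andbT leNgt; apply/negP => d0.
have := archi_boundP (ltW (_ : 0 < (k 1 + 1) / `|k t - t * k 1|)).
rewrite divr_gt0 ?ltr_wpDl// => /(_ isT).
set m := Num.bound _; rewrite ltr_pdivrMr// => h.
have := key m; rewrite -natr1 mulrDl mul1r; lra.
Qed.

(** * Points on an edge and linear maps along it *)

Section Mix.
Variables (R : realType) (n : nat).
Implicit Types (x y u v w : 'cV[R]_n) (vs r : seq 'cV[R]_n) (s t : R).

Definition mix t v1 v2 : 'cV[R]_n := (1 - t) *: v1 + t *: v2.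

Lemma mixC t v1 v2 : mix t v1 v2 = mix (1 - t) v2 v1.
Proof. by rewrite /mix subKr addrC. Qed.

Lemma vdot_mix x t v1 v2 :
  vdot x (mix t v1 v2) = (1 - t) * vdot x v1 + t * vdot x v2.
Proof. by rewrite vdotDr !vdotZr. Qed.

Lemma mulmx_mix (A : 'M[R]_n) t v1 v2 :
  A *m mix t v1 v2 = mix t (A *m v1) (A *m v2).
Proof. by rewrite mulmxDr -!scalemxAr. Qed.

Lemma mix_mix s t v1 v2 : mix s v1 (mix t v1 v2) = mix (s * t) v1 v2.
Proof. by apply/colP => i; rewrite !mxE; ring. Qed.

(** The map shrinks the edge towards [v1]. Points move only along [v2 - v1], so a direction [x] with
    equal values at both ends does not notice it. *)
Lemma shear v1 v2 r t : free [:: v1, v2 & r] -> exists A : 'M[R]_n,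
  [/\ \det A = t, [seq A *m v | v <- [:: v1, v2 & r]] = [:: v1, mix t v1 v2 & r]
    & forall x, vdot x v1 = vdot x v2 -> A^T *m x = x].
Proof.
move=> /(free_dual2 0 1)[l [l1 l2 lr]].
exists (rank1 ((t - 1) *: (v2 - v1)) l); split.
- by rewrite det_rank1 vdotZr vdotBr l1 l2; ring.
- rewrite /= (rank1_fix _ lr) !rank1E l1 l2 scale0r addr0; congr [:: _, _ & _].
  by apply/colP => i; rewrite !mxE; ring.
- move=> x x12; rewrite rank1_tr rank1E vdotZl vdotBl !(vdotC _ x) x12 subrr.
  by rewrite mulr0 scale0r addr0.
Qed.

(** A transvection along [v2 - v1] whose functional [l] is 1 at both ends: the line through the edge
    is translated along itself. *)
Lemma shift v1 v2 r s : free [:: v1, v2 & r] -> exists A : 'M[R]_n,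
  [/\ \det A = 1,
     forall t, [seq A *m v | v <- [:: v1, mix t v1 v2 & r]] =
       [:: mix s v1 v2, mix (s + t) v1 v2 & r]
    & forall x, vdot x v1 = vdot x v2 -> A^T *m x = x].
Proof.
move=> /(free_dual2 1 1)[l [l1 l2 lr]].
exists (rank1 (s *: (v2 - v1)) l); split.
- by rewrite det_rank1 vdotZr vdotBr l1 l2; ring.
- move=> t; rewrite /= (rank1_fix _ lr) !rank1E vdot_mix l1 l2.
  by congr [:: _, _ & _]; apply/colP => i; rewrite !mxE; ring.
- move=> x x12; rewrite rank1_tr rank1E vdotZl vdotBl !(vdotC _ x) x12 subrr.
  by rewrite mulr0 scale0r addr0.
Qed.

Lemma perm_rot3 v1 v2 v3 r : perm_eq [:: v1, v2, v3 & r] [:: v2, v3, v1 & r].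
Proof. by apply/seq.permP => p /=; lia. Qed.

Lemma perm_swap12 v1 v2 r : perm_eq [:: v1, v2 & r] [:: v2, v1 & r].
Proof. by apply/seq.permP => p /=; lia. Qed.

Lemma perm_swap23 v1 v2 v3 r : perm_eq [:: v1, v2, v3 & r] [:: v1, v3, v2 & r].
Proof. by apply/seq.permP => p /=; lia. Qed.

Lemma middle_perm (f : 'cV[R]_n -> R) v1 v2 v3 r : exists u1 u2 u3,
  perm_eq [:: v1, v2, v3 & r] [:: u1, u2, u3 & r] /\ f u1 <= f u3 <= f u2.
Proof.
have perm (a b c : 'cV[R]_n) : (forall p : pred 'cV[R]_n, p v1 + p v2 + p v3 = p a + p b + p c)%N ->
    perm_eq [:: v1, v2, v3 & r] [:: a, b, c & r].
  by move=> h; apply/seq.permP => p /=; rewrite !addnA h.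
have [h12|h21] := leP (f v1) (f v2); have [h23|h32] := leP (f v2) (f v3);
  have [h13|h31] := leP (f v1) (f v3).
- by exists v1, v3, v2; split; [apply: perm => p; lia|rewrite h12 h23].
- by exists v1, v3, v2; split; [apply: perm => p; lia|rewrite h12 h23].
- by exists v1, v2, v3; split; [apply: perm => p; lia|rewrite h13 (ltW h32)].
- by exists v3, v2, v1; split; [apply: perm => p; lia|rewrite h12 (ltW h31)].
- by exists v2, v3, v1; split; [apply: perm => p; lia|rewrite h13 (ltW h21)].
- by exists v2, v1, v3; split; [apply: perm => p; lia|rewrite h23 (ltW h31)].
- by exists v3, v1, v2; split; [apply: perm => p; lia|rewrite (ltW h32) (ltW h21)].
- by exists v3, v1, v2; split; [apply: perm => p; lia|rewrite (ltW h32) (ltW h21)].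
Qed.

End Mix.

(** * Consequences of additivity under cuts *)

Section CutFunctional.
Variables (R : realType) (n d : nat).
Implicit Types (x y u v w : 'cV[R]_n) (vs ws r : seq 'cV[R]_n) (s t : R).
Implicit Types E F : seq 'cV[R]_n -> 'cV[R]_n -> R.

Definition perm_invariant E := forall vs ws x, free vs -> size vs = d ->
  perm_eq vs ws -> E vs x = E ws x.

(** The valuation property for an edge cut without the term of the common facet; it holds once a
    functional vanishing on that facet is considered. *)
Definition cut_additive E := forall v1 v2 r t x,
  free [:: v1, v2 & r] -> (size r).+2 = d -> 0 < t -> t < 1 ->
  E [:: v1, v2 & r] x = E [:: v1, mix t v1 v2 & r] x + E [:: mix t v1 v2, v2 & r] x.

(* Among three vertices, the one with the middle value of [vdot x] can be
   used to cut the edge joining the other two into pieces with a repeated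
   value. *)
Lemma cut_additive_eq0 E : (2 < d)%N -> perm_invariant E -> cut_additive E ->
  (forall v1 v2 r x, free [:: v1, v2 & r] -> (size r).+2 = d ->
    vdot x v1 = vdot x v2 -> E [:: v1, v2 & r] x = 0) ->
  forall vs x, free vs -> size vs = d -> E vs x = 0.
Proof.
move=> d2 EP EC E0 vs x fvs svs.
have [v1 [v2 [v3 [r vsE]]]] : exists v1 v2 v3 r, vs = [:: v1, v2, v3 & r].
  by case: vs svs {fvs} => [|v1 [|v2 [|v3 r]]] svs;
    [by rewrite -svs in d2..|exists v1, v2, v3, r].
have [u1 [u2 [u3 [pu /andP[h13 h32]]]]] := middle_perm (vdot x) v1 v2 v3 r.
rewrite vsE in fvs svs *; rewrite (EP _ _ _ fvs svs pu).
have fu : free [:: u1, u2, u3 & r] by rewrite -(perm_free pu).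
have su : size [:: u1, u2, u3 & r] = d by rewrite -(perm_size pu).
have p132 : perm_eq [:: u1, u2, u3 & r] [:: u1, u3, u2 & r] by exact: perm_swap23.
have p231 : perm_eq [:: u1, u2, u3 & r] [:: u2, u3, u1 & r] by exact: perm_rot3.
have [e13|n13] := eqVneq (vdot x u1) (vdot x u3).
  by rewrite (EP _ _ _ fu su p132) E0// -(perm_free p132).
have [e32|n32] := eqVneq (vdot x u3) (vdot x u2).
  by rewrite (EP _ _ _ fu su p231) E0// -(perm_free p231).
have {}h13 : vdot x u1 < vdot x u3 by rewrite lt_neqAle n13.
have {}h32 : vdot x u3 < vdot x u2 by rewrite lt_neqAle n32.
have h12 := lt_trans h13 h32.
(* The ratio at which the point on the edge takes the value of [u3]. *)
pose t := (vdot x u3 - vdot x u1) / (vdot x u2 - vdot x u1).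
have t0 : 0 < t by rewrite divr_gt0// subr_gt0.
have t1 : t < 1 by rewrite ltr_pdivrMr ?subr_gt0// mul1r ltrD2r.
rewrite (EC _ _ _ t)//; set w := mix t u1 u2.
have xw : vdot x w = vdot x u3.
  by rewrite vdot_mix /t; field; rewrite subr_eq0 gt_eqF.
have f1 : free [:: u1, w, u3 & r] by exact: free_cut1.
have f2 : free [:: w, u2, u3 & r] by exact: free_cut2.
have p1 : perm_eq [:: u1, w, u3 & r] [:: w, u3, u1 & r] by exact: perm_rot3.
have p2 : perm_eq [:: w, u2, u3 & r] [:: w, u3, u2 & r] by exact: perm_swap23.
rewrite (EP _ _ _ f1 su p1) (EP _ _ _ f2 su p2).
by rewrite !E0 ?addr0// -?(perm_free p1) -?(perm_free p2).
Qed.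

Definition sl_covariant E := forall (A : 'M[R]_n) vs x, \det A = 1 -> free vs ->
  size vs = d -> E [seq A *m v | v <- vs] x = E vs (A^T *m x).

Definition gl_homogeneous E := forall (A : 'M[R]_n) vs x, 0 < \det A ->
  free vs -> size vs = d ->
  E [seq A *m v | v <- vs] x = \det A * E vs (A^T *m x).

(** The defect of homogeneity is again additive under cuts, so it suffices to treat [x] with equal
    values at two vertices. The lower bound may depend on the values of [x] only, since these stay
    fixed while the edge shrinks. *)
Lemma sl_gl_homogeneous E (b : seq R -> R) : (2 < d)%N ->
  perm_invariant E -> cut_additive E -> sl_covariant E ->
  (forall vs x, free vs -> size vs = d -> - b (vals x vs) <= E vs x) ->
  gl_homogeneous E.
Proof.
move=> d2 EP EC ES Eb.
(* Cutting an edge of length [s + u] leaves one of length [s] and a shifted copy of one of length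
   [u], so [E] is additive in the length of the edge and hence linear. *)
have dil v1 v2 r t x : free [:: v1, v2 & r] -> (size r).+2 = d ->
    vdot x v1 = vdot x v2 -> 0 < t ->
    E [:: v1, mix t v1 v2 & r] x = t * E [:: v1, v2 & r] x.
  move=> fv sv x12 t0.
  have fmix s : 0 < s -> free [:: v1, mix s v1 v2 & r].
    move=> s0; have [A [dA <- _]] := shear s fv.
    by apply: free_map_unit => //; rewrite unitmxE dA unitfE gt_eqF.
  have xmix s : vdot x (mix s v1 v2) = vdot x v1 by rewrite vdot_mix -x12; ring.
  pose k s := E [:: v1, mix s v1 v2 & r] x.
  have := @additive_linear _ k (b [:: vdot x v1, vdot x v1 & vals x r]) _ _ t t0.
  rewrite /k (_ : mix 1 v1 v2 = v2); last by rewrite /mix subrr scale0r scale1r add0r.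
  apply => [s u s0 u0|s s0].
    have su0 : 0 < s + u by exact: addr_gt0.
    rewrite (EC _ _ _ (s / (s + u)))//; last 3 first.
    - exact: fmix.
    - by rewrite divr_gt0.
    - by rewrite ltr_pdivrMr// mul1r ltrDl.
    rewrite mix_mix divfK ?gt_eqF//; congr (_ + _).
    have [A [dA AE Ax]] := shift s fv.
    by rewrite -AE ES ?Ax//; exact: fmix.
  by have := Eb _ x (fmix s s0) sv; rewrite /vals /= xmix.
move=> A vs x dA0 fvs svs.
have Au : A \in unitmx by rewrite unitmxE unitfE gt_eqF.
(* Transforming the argument by the inverse transpose makes both terms see the same values at the
   vertices. *)
pose F vs y := E [seq A *m v | v <- vs] ((invmx A)^T *m y) - \det A * E vs y.
have trK y : A^T *m ((invmx A)^T *m y) = y.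
  by rewrite mulmxA -trmx_mul mulVmx// trmx1 mul1mx.
suff : F vs (A^T *m x) = 0.
  rewrite /F mulmxA -trmx_mul mulmxV// trmx1 mul1mx => /eqP.
  by rewrite subr_eq0 => /eqP.
apply: cut_additive_eq0 => //.
- move=> us ws y fus sus p; rewrite /F (EP us ws)//.
  by rewrite (EP _ [seq A *m v | v <- ws])// ?free_map_unit ?size_map ?perm_map.
- move=> v1 v2 r t y fv sv t0 t1; rewrite /F /= mulmx_mix (EC _ _ _ t _ fv)//.
  rewrite (EC _ _ _ t)// ?size_map//; last exact: (free_map_unit Au fv).
  by ring.
- move=> v1 v2 r y fv sv y12; rewrite /F.
  (* The shear [C] has the determinant of [A] and is invisible to [y]. It reduces [A] to
     [A *m invmx C], of determinant 1, and the factor comes from [dil]. *)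
  have [C [dC CE Cy]] := shear (\det A) fv.
  have Cu : C \in unitmx by rewrite unitmxE dC unitfE gt_eqF.
  have fC : free [:: v1, mix (\det A) v1 v2 & r] by rewrite -CE; exact: free_map_unit.
  have -> : [seq A *m v | v <- [:: v1, v2 & r]] =
      [seq (A *m invmx C) *m v | v <- [:: v1, mix (\det A) v1 v2 & r]].
    by rewrite -CE -map_comp; apply: eq_map => v /=; rewrite mulmxA mulmxKV.
  rewrite ES ?fC//; last first.
    by rewrite det_mulmx det_inv dC mulfV// gt_eqF.
  rewrite trmx_mul -mulmxA trK.
  have -> : (invmx C)^T *m y = y.
    by rewrite -[in LHS](Cy _ y12) mulmxA -trmx_mul mulmxV// trmx1 mul1mx.
  by rewrite dil// subrr.
Qed.

End CutFunctional.

(** * Uniqueness on the standard simplex *)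

Section StandardBasis.
Variables (R : realType) (n : nat).
Implicit Types (x y z u v w : 'cV[R]_n) (vs ws r : seq 'cV[R]_n) (i j k : 'I_n)
  (s : {perm 'I_n}).

Definition std : seq 'cV[R]_n := [seq delta_mx i 0 | i <- enum 'I_n].

Lemma size_std : size std = n.
Proof. by rewrite size_map size_enum_ord. Qed.

Lemma nth_std i : std`_i = delta_mx i 0.
Proof. by rewrite (nth_map i) ?size_enum_ord// nth_ord_enum. Qed.

Lemma free_std : free std.
Proof.
apply: dual_free => c; exists (\col_i c i) => i; rewrite size_std => i_n.
by rewrite (nth_std (Ordinal i_n)) vdot_deltar mxE.
Qed.

Lemma map_std vs : free vs -> size vs = n ->
  exists2 V : 'M[R]_n, V \in unitmx & vs = [seq V *m v | v <- std].
Proof.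
move=> /free_complete[V Vu [_ VE]] svs; exists V => //.
apply: (@eq_from_nth _ 0); first by rewrite size_map size_std.
move=> i; rewrite svs => i_n; rewrite (nth_map 0) ?size_std//.
by rewrite (nth_std (Ordinal i_n)) -VE// svs.
Qed.

Lemma std_pair i j : i != j -> exists r,
  perm_eq std [:: delta_mx i 0, delta_mx j 0 & r] /\
  forall v, v \in r -> vdot (delta_mx i 0) v = 0 /\ vdot (delta_mx j 0) v = 0.
Proof.
move=> ij; pose l := rem j (rem i (enum 'I_n)).
have uen := enum_uniq 'I_n.
exists [seq delta_mx k 0 | k <- l]; split.
  suff p : perm_eq (enum 'I_n) [:: i, j & l] by exact: (perm_map (fun k => delta_mx k 0) p).
  apply: perm_trans (perm_to_rem (mem_enum _ i)) _; rewrite perm_cons.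
  by apply: perm_to_rem; rewrite mem_rem_uniq// inE eq_sym ij mem_enum.
move=> _ /mapP[k + ->]; rewrite mem_rem_uniq ?rem_uniq// inE mem_rem_uniq// inE.
move=> /and3P[kj ki _]; rewrite !vdot_deltal !mxE.
by rewrite eq_sym (negPf ki) eq_sym (negPf kj).
Qed.

Lemma perm_mx_delta s j : perm_mx s *m delta_mx j 0 = delta_mx (s^-1 j)%g 0 :> 'cV[R]_n.
Proof.
rewrite -row_permE; apply/colP => i; rewrite !mxE; congr ((_ && _)%:R).
by rewrite -[in RHS](inj_eq (@perm_inj _ s)) permKV.
Qed.

Lemma perm_std s : perm_eq [seq perm_mx s *m v | v <- std] std.
Proof.
rewrite /std -map_comp (eq_map (g := (fun i => delta_mx i 0) \o (s^-1)%g)); last first.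
  by move=> i /=; rewrite perm_mx_delta.
rewrite map_comp; apply: perm_map; apply: uniq_perm.
- by rewrite map_inj_uniq ?enum_uniq//; exact: perm_inj.
- exact: enum_uniq.
move=> i; rewrite mem_enum; apply/mapP; exists (s i); first by rewrite mem_enum.
by rewrite permK.
Qed.

(** Just enough continuity to perturb [x] in a fixed direction, and stable under the sums, multiples
    and maxima occurring in [Dval]. *)
Definition dir_lipschitz (g : 'cV[R]_n -> R) := forall x y, exists C : R,
  forall e, 0 <= e -> e <= 1 -> `|g (x + e *: y) - g x| <= C * e.

Lemma sublinear_dir_lipschitz g : sublinear g -> dir_lipschitz g.
Proof.
move=> gs x y; have [gD gZ] := gs.
exists (`|g y| + `|g (- y)|) => e e0 e1.
have h1 := gD x (e *: y); have h2 := gD (x + e *: y) (e *: (- y)).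
have e2 : x + e *: y + e *: (- y) = x by rewrite scalerN addrK.
rewrite e2 gZ// in h2; rewrite gZ// in h1.
have k1 : e * g y <= e * `|g y| by rewrite ler_wpM2l// ler_norm.
have k2 : e * g (- y) <= e * `|g (- y)| by rewrite ler_wpM2l// ler_norm.
have k3 : 0 <= e * `|g y| by rewrite mulr_ge0.
have k4 : 0 <= e * `|g (- y)| by rewrite mulr_ge0.
by rewrite mulrC mulrDr ler_norml; apply/andP; split; lra.
Qed.

Lemma dir_lipschitzD f g : dir_lipschitz f -> dir_lipschitz g ->
  dir_lipschitz (fun x => f x + g x).
Proof.
move=> hf hg x y; have [C hC] := hf x y; have [D hD] := hg x y.
exists (C + D) => e e0 e1; rewrite opprD addrACA mulrDl.
by apply: le_trans (ler_normD _ _) _; rewrite lerD ?hC ?hD.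
Qed.

Lemma dir_lipschitzZ f c : dir_lipschitz f -> dir_lipschitz (fun x => c * f x).
Proof.
move=> hf x y; have [C hC] := hf x y; exists (`|c| * C) => e e0 e1.
by rewrite -mulrBr normrM -mulrA ler_wpM2l ?hC.
Qed.

Lemma dir_lipschitzN f : dir_lipschitz f -> dir_lipschitz (fun x => - f x).
Proof.
move=> hf x y; have [C hC] := hf x y; exists C => e e0 e1.
by rewrite -opprD normrN hC.
Qed.

Lemma dir_lipschitz_max f g : dir_lipschitz f -> dir_lipschitz g ->
  dir_lipschitz (fun x => Num.max (f x) (g x)).
Proof.
move=> hf hg x y; have [C hC] := hf x y; have [D hD] := hg x y.
exists (C + D) => e e0 e1; have {hC} := hC e e0 e1; have {hD} := hD e e0 e1.
set a := f (x + _); set b := g (x + _); move: (f x) (g x) => a' b'.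
rewrite mulrDl !ler_norml => /andP[h1 h2] /andP[h3 h4].
by case: (leP a b) => h5; case: (leP a' b') => h6; apply/andP; split; lra.
Qed.

Lemma dir_lipschitz_comp f (A : 'M[R]_n) : dir_lipschitz f ->
  dir_lipschitz (fun x => f (A *m x)).
Proof.
move=> hf x y; have [C hC] := hf (A *m x) (A *m y); exists C => e e0 e1.
by rewrite mulmxDr -scalemxAr hC.
Qed.

Lemma dir_lipschitz_vdot v : dir_lipschitz (fun x => vdot x v).
Proof.
by apply: sublinear_dir_lipschitz; split=> [x y|k x _]; rewrite ?vdotDl ?vdotZl.
Qed.

Lemma dir_lipschitz_maxl vs : dir_lipschitz (fun x => maxl (vals x vs)).
Proof.
elim: vs => [|v [|w vs] IH]; last exact: dir_lipschitz_max (dir_lipschitz_vdot v) IH.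
  by apply: sublinear_dir_lipschitz; split=> [x y|k x _]; rewrite ?addr0 ?mulr0.
exact: dir_lipschitz_vdot.
Qed.

Lemma dir_lipschitz_Dval a1 a2 b1 b2 vs :
  dir_lipschitz (fun x => Dval a1 a2 b1 b2 (vals x vs)).
Proof.
have hM := dir_lipschitz_maxl vs.
have hm : dir_lipschitz (fun x => minl (vals x vs)).
  have -> : (fun x => minl (vals x vs)) = (fun x => - maxl (vals (- x) vs)).
    by apply/funext => x; rewrite minl_valsN.
  apply: dir_lipschitzN; have := dir_lipschitz_comp (- 1%:M) hM.
  by congr dir_lipschitz; apply/funext => x; rewrite mulNmx mul1mx.
have h0 : dir_lipschitz (fun=> 0 : R).
  by move=> x y; exists 0 => e e0 e1; rewrite subrr normr0 mul0r.
have pos f c d : dir_lipschitz f ->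
    dir_lipschitz (fun x => c * Num.max (f x) 0 - d * Num.max (- f x) 0).
  move=> hf; apply: dir_lipschitzD; first exact/dir_lipschitzZ/dir_lipschitz_max.
  by apply/dir_lipschitzN/dir_lipschitzZ/dir_lipschitz_max => //; exact: dir_lipschitzN.
by apply: dir_lipschitzD; [exact: pos|apply: dir_lipschitzN; exact: pos].
Qed.

(** * A homogeneous cut-additive functional is determined by two values *)

Section Uniqueness.
Variable E : seq 'cV[R]_n -> 'cV[R]_n -> R.
Hypotheses (EP : perm_invariant n E) (EC : cut_additive n E)
  (EG : gl_homogeneous n E) (n2 : (2 < n)%N).

Lemma std_symmetric i j :
  E std (delta_mx i 0) = E std (delta_mx j 0) /\
  E std (- delta_mx i 0) = E std (- delta_mx j 0).
Proof.
have [->//|ij] := eqVneq i j.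
have [k ki kj] : exists2 k, k != i & k != j.
  have : (0 < #|~: [set i; j]|)%N.
    by have := cardsC [set i; j]; rewrite cards2 ij card_ord; lia.
  by case/card_gt0P => k; rewrite !inE negb_or => /andP[]; exists k.
pose s : {perm 'I_n} := (tperm j i * tperm j k)%g.
have sj : s j = i by rewrite permM tpermL tpermD// eq_sym.
have dets : \det (perm_mx s : 'M[R]_n) = 1.
  by rewrite det_perm odd_permM !odd_tperm (eq_sym j) ij eq_sym kj expr0.
have key x : E std ((perm_mx s)^T *m x) = E std x.
  rewrite -[RHS](EP (vs := [seq perm_mx s *m v | v <- std])).
  - by rewrite EG ?dets ?mul1r ?free_std ?size_std.
  - by apply: free_map_unit free_std; rewrite unitmxE dets unitr1.
  - by rewrite size_map size_std.
  - exact: perm_std.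
have sE : (perm_mx s)^T *m delta_mx j 0 = delta_mx i 0 :> 'cV[R]_n.
  by rewrite tr_perm_mx perm_mx_delta invgK sj.
by split; rewrite -sE -?mulmxN key.
Qed.

Let E0 := E std.

Definition set_coord x i (a : R) : 'cV[R]_n := x + (a - x i 0) *: delta_mx i 0.

Lemma set_coordE x i a k : set_coord x i a k 0 = if k == i then a else x k 0.
Proof.
rewrite !mxE andbT; case: eqP => [->|_]; first by rewrite mulr1 addrC subrK.
by rewrite mulr0 addr0.
Qed.

(** The edge joining two standard vectors is cut where [x] has the value [a]. Each piece is a linear
    image of the standard simplex with determinant [t] or [1 - t], whose transpose replaces [x j 0]
    or [x i 0] by [a]. *)
Lemma cut_relation x i j a : i != j -> x i 0 < a -> a < x j 0 ->
  (x j 0 - x i 0) * E0 x =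
  (a - x i 0) * E0 (set_coord x j a) + (x j 0 - a) * E0 (set_coord x i a).
Proof.
move=> ij ia aj; have iltj := lt_trans ia aj.
have d0 : 0 < x j 0 - x i 0 by rewrite subr_gt0.
pose t := (a - x i 0) / (x j 0 - x i 0).
have tE : t * (x j 0 - x i 0) = a - x i 0 by rewrite divfK// gt_eqF.
have t0 : 0 < t by rewrite divr_gt0// subr_gt0.
have t1 : t < 1 by rewrite ltr_pdivrMr// mul1r ltrD2r.
have [r [pr rE]] := std_pair ij.
set ei := delta_mx i 0 in pr rE; set ej := delta_mx j 0 in pr rE.
have ii : vdot ei ei = 1 by rewrite vdot_deltal mxE !eqxx.
have jj : vdot ej ej = 1 by rewrite vdot_deltal mxE !eqxx.
have eij : vdot ei ej = 0 by rewrite vdot_deltal mxE (negPf ij).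
have eji : vdot ej ei = 0 by rewrite vdotC.
have fr : free [:: ei, ej & r] by rewrite -(perm_free pr) free_std.
have sr : (size r).+2 = n by rewrite -[LHS](perm_size pr) size_std.
have E0E y : E0 y = E [:: ei, ej & r] y by exact: EP free_std size_std pr.
have right : E [:: ei, mix t ei ej & r] x = t * E0 (set_coord x j a).
  pose A := rank1 ((t - 1) *: (ej - ei)) ej.
  have dA : \det A = t by rewrite det_rank1 vdotZr vdotBr jj eji; ring.
  have -> : [:: ei, mix t ei ej & r] = [seq A *m v | v <- [:: ei, ej & r]].
    rewrite /= rank1_fix => [|v /rE[]//]; rewrite !rank1E jj eji scale0r addr0.
    by congr [:: _, _ & _]; apply/colP => k; rewrite !mxE; ring.
  rewrite EG ?dA// -E0E rank1_tr rank1E vdotZl vdotBl !vdot_deltal.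
  by congr (_ * E0 (_ + _ *: _)); rewrite mulrBl tE; ring.
have left : E [:: mix t ei ej, ej & r] x = (1 - t) * E0 (set_coord x i a).
  pose A := rank1 (t *: (ej - ei)) ei.
  have dA : \det A = 1 - t by rewrite det_rank1 vdotZr vdotBr ii eij; ring.
  have -> : [:: mix t ei ej, ej & r] = [seq A *m v | v <- [:: ei, ej & r]].
    rewrite /= rank1_fix => [|v /rE[]//]; rewrite !rank1E ii eij scale0r addr0.
    by congr [:: _, _ & _]; apply/colP => k; rewrite !mxE; ring.
  rewrite EG ?dA ?subr_gt0// -E0E rank1_tr rank1E vdotZl vdotBl !vdot_deltal.
  by congr (_ * E0 (_ + _ *: _)); rewrite tE.
rewrite (E0E x) (EC x fr sr t0 t1) right left -tE.
have -> : x j 0 - a = (1 - t) * (x j 0 - x i 0) by rewrite mulrBl tE; ring.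
by ring.
Qed.

Hypothesis EZ : forall (c : R) x, 0 <= c -> E0 (c *: x) = c * E0 x.
Hypothesis EL : dir_lipschitz E0.
Variable i0 : 'I_n.
Hypothesis (E1 : E0 (delta_mx i0 0) = 0) (EN1 : E0 (- delta_mx i0 0) = 0).

Definition generic x := forall i j, i != j -> x i 0 != 0 -> x j 0 != 0 ->
  x i 0 != x j 0.

(** Induction on the number of nonzero coordinates; genericity provides the strict inequalities
    demanded by [cut_relation]. *)
Lemma generic_eq0 x : generic x -> E0 x = 0.
Proof.
have [m] := ubnP #|[pred i | x i 0 != 0]|; elim: m x => // m IH x xm gx.
have step y i : x i 0 != 0 -> y i 0 = 0 -> (forall k, y k 0 != 0 -> x k 0 != 0) ->
    generic y -> E0 y = 0.
  move=> xi yi yx gy; apply: IH => //.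
  rewrite -ltnS; apply: leq_trans xm; rewrite ltnS; apply: proper_card; apply/properP;
    split.
      by apply/fintype.subsetP => k; rewrite !inE; exact: yx.
  by exists i; rewrite !inE ?xi ?yi ?eqxx.
have step0 i : x i 0 != 0 -> E0 (set_coord x i 0) = 0.
  move=> xi; apply: (step _ i) => //; first by rewrite set_coordE eqxx.
    by move=> k; rewrite set_coordE; case: ifP; rewrite ?eqxx.
  move=> k l kl; rewrite !set_coordE; case: (eqVneq k i) => [_|_]; rewrite ?eqxx//.
  by case: (eqVneq l i) => [_|_]; rewrite ?eqxx//; exact: gx.
have step1 i j : i != j -> x i 0 != 0 -> x j 0 != 0 ->
    E0 (set_coord (set_coord x i 0) j (x i 0)) = 0.
  move=> ij xi xj; apply: (step _ i) => //.
  - by rewrite set_coordE (negPf ij) set_coordE eqxx.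
  - move=> k; rewrite !set_coordE; case: (eqVneq k j) => [->//|_].
    by case: (eqVneq k i) => [_|_]; rewrite ?eqxx.
  move=> k l kl; rewrite !set_coordE.
  have [kj|kj] := eqVneq k j; have [lj|lj] := eqVneq l j.
  - by rewrite kj lj eqxx in kl.
  - have [_|li] := eqVneq l i; rewrite ?eqxx//.
    by move=> _ xl; apply: gx; rewrite // eq_sym.
  - have [_|ki] := eqVneq k i; rewrite ?eqxx//.
    by move=> xk _; exact: gx.
  - have [_|_] := eqVneq k i; rewrite ?eqxx//.
    by have [_|_] := eqVneq l i; rewrite ?eqxx//; exact: gx.
have [[i [j [ij xi xj]]]|no2] := pselect (exists i j, [/\ i != j, x i 0 != 0 & x j 0 != 0]).
  wlog xij : i j ij xi xj / x i 0 < x j 0.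
    move=> h; have := gx _ _ ij xi xj; rewrite neq_lt => /orP[]; first exact: h.
    by apply: h => //; rewrite eq_sym.
  have ji : j != i by rewrite eq_sym.
  (* For two positive coordinates the relation is applied to [y], with the smaller one set to 0, at
     [a = x i 0]: of its three arguments only [x] does not have fewer nonzero coordinates. Two
     negative ones are symmetric, and opposite signs allow a cut at 0. *)
  have [xi0|xi0] := ltP (x i 0) 0; last first.
    have {}xi0 : 0 < x i 0 by rewrite lt_neqAle eq_sym xi.
    pose y := set_coord x i 0.
    have yi : y i 0 = 0 by rewrite set_coordE eqxx.
    have yj : y j 0 = x j 0 by rewrite set_coordE (negPf ji).
    have := @cut_relation y i j (x i 0) ij; rewrite yi yj => /(_ xi0 xij).
    rewrite step0// step1// !mulr0 add0r => /esym/eqP.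
    rewrite mulf_eq0 subr_eq0 gt_eqF//= => /eqP.
    congr (E0 _ = 0); apply/colP => k; rewrite /y !set_coordE.
    by case: eqP => [->|].
  have [xj0|xj0] := ltP 0 (x j 0).
    have := @cut_relation x i j 0 ij xi0 xj0; rewrite !step0// !mulr0 addr0 => /eqP.
    by rewrite mulf_eq0 subr_eq0 gt_eqF//= => /eqP.
  have {}xj0 : x j 0 < 0 by rewrite lt_neqAle xj.
  pose y := set_coord x j 0.
  have yj : y j 0 = 0 by rewrite set_coordE eqxx.
  have yi : y i 0 = x i 0 by rewrite set_coordE (negPf ij).
  have := @cut_relation y i j (x j 0) ij; rewrite yi yj => /(_ xij xj0).
  rewrite step0// (step1 j i)// !mulr0 addr0 => /esym/eqP.
  rewrite mulf_eq0 subr_eq0 gt_eqF//= => /eqP.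
  congr (E0 _ = 0); apply/colP => k; rewrite /y !set_coordE.
  by case: eqP => [->|].
have [[i xi]|x0] := pselect (exists i, x i 0 != 0); last first.
  have -> : x = 0 *: x.
    rewrite scale0r; apply/colP => k; rewrite mxE; apply/eqP; apply: contrapT => xk.
    by apply: x0; exists k; apply/negP.
  by rewrite EZ// mul0r.
have xE : x = x i 0 *: delta_mx i 0.
  apply/colP => k; rewrite !mxE andbT; have [->|ki] := eqVneq k i; first by rewrite mulr1.
  rewrite mulr0; apply/eqP; apply: contrapT => /negP xk.
  by apply: no2; exists k, i.
have [h1 h2] := std_symmetric i i0; rewrite -/E0 in h1 h2.
have [x0|x0] := leP 0 (x i 0); first by rewrite xE EZ// h1 E1 mulr0.
by rewrite xE -[x i 0]opprK scaleNr -scalerN EZ ?oppr_ge0 ?ltW// h2 EN1 mulr0.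
Qed.

(** The direction has distinct coordinates, so two given coordinates of the perturbed vector
    coincide for just one [e], namely [c (i, j)]. *)
Lemma generic_perturb x : exists2 d : R, 0 < d &
  forall e, 0 < e -> e < d -> generic (x + e *: \col_i i.+1%:R).
Proof.
pose c (p : 'I_n * 'I_n) := (x p.1 0 - x p.2 0) / (p.2%:R - p.1%:R).
pose D (p : 'I_n * 'I_n) : R := if 0 < c p then c p else 1.
exists (\big[Num.min/1]_p D p).
  (* Pairs without a positive collision parameter get the harmless bound 1; on the diagonal [c] is 0
     by the convention for division by zero. *)
  by apply/bigmin_gtP; split=> // p _; rewrite /D; case: ifP.
move=> e e0 /bigmin_gtP[_ eD] i j ij _ _; rewrite !mxE.
have dij : (j%:R - i%:R : R) != 0.
  by rewrite subr_eq0 eqr_nat eq_sym val_eqE.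
apply/eqP => h.
have ec : e = c (i, j).
  rewrite /c /=; apply: (mulIf dij); rewrite divfK//.
  by move: h; rewrite -!natr1 !mulrDr !mulr1; lra.
by have := eD (i, j) isT; rewrite /D -ec e0 ltxx.
Qed.

Lemma std_eq0 x : E0 x = 0.
Proof.
have [d d0 gd] := generic_perturb x.
have [C hC] := EL x (\col_i i.+1%:R).
apply/eqP; rewrite -normr_eq0 eq_le normr_ge0 andbT leNgt; apply/negP => E0gt.
pose B := `|C| + 1; have B0 : 0 < B by rewrite ltr_wpDl.
(* Small enough for genericity, for the Lipschitz bound, and to make [C * e] less than the supposed
   nonzero [|E0 x|]. *)
pose e := Num.min (Num.min (d / 2) 1) (`|E0 x| / (2 * B)).
have e0 : 0 < e by rewrite !lt_min ltr01 !divr_gt0// mulr_gt0.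
have ed : e < d.
  by apply: (@le_lt_trans _ _ (d / 2)); [rewrite !ge_min lexx|rewrite ltr_pdivrMr//; lra].
have e1 : e <= 1 by rewrite !ge_min lexx orbT.
have := hC e (ltW e0) e1; rewrite (generic_eq0 (gd _ e0 ed)) sub0r normrN.
rewrite leNgt => /negP; apply.
have eE : e * (2 * B) <= `|E0 x| by rewrite -ler_pdivlMr ?mulr_gt0// !ge_min lexx !orbT.
have h1 : C * e <= B * e by rewrite ler_wpM2r ?(ltW e0)// /B ler_wpDr// ler_norm.
have h2 : 0 < B * e by exact: mulr_gt0.
by apply: le_lt_trans h1 _; lra.
Qed.

Lemma functional_eq0 vs x : free vs -> size vs = n -> E vs x = 0.
Proof.
move=> fvs svs; have [V Vu vsE] := map_std fvs svs.
have [dV|dV] := ltP 0 (\det V).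
  by rewrite vsE EG ?free_std ?size_std// -/E0 std_eq0 mulr0.
have {}dV : \det V < 0.
  by rewrite lt_neqAle dV andbT; move: Vu; rewrite unitmxE unitfE.
have [j ji] : exists j, j != i0.
  have : (0 < #|~: [set i0]|)%N by have := cardsC [set i0]; rewrite cards1 card_ord; lia.
  by case/card_gt0P => j; rewrite !inE; exists j.
(* Exchanging two vertices of the standard simplex turns a negative determinant into a positive
   one. *)
pose s := tperm i0 j; pose S : 'M[R]_n := perm_mx s.
have dS : \det S = -1 by rewrite det_perm odd_tperm eq_sym ji expr1.
have Su : S \in unitmx by rewrite unitmxE dS unitrN1.
have -> : vs = [seq (V *m invmx S) *m v | v <- [seq S *m v | v <- std]].
  by rewrite -map_comp vsE; apply: eq_map => v /=; rewrite mulmxA mulmxKV.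
have fS : free [seq S *m v | v <- std] := free_map_unit Su free_std.
have sS : size [seq S *m v | v <- std] = n by rewrite size_map size_std.
have dVS : 0 < \det (V *m invmx S).
  by rewrite det_mulmx det_inv dS invrN1 mulrN1 oppr_gt0.
rewrite EG// (EP _ fS sS (perm_std s)).
by rewrite -/E0 std_eq0 mulr0.
Qed.

End Uniqueness.
End StandardBasis.

Arguments std {R n}.

(** * Classification *)

Lemma maxl_scale (R : realType) (c : R) (l : seq R) : 0 <= c ->
  maxl [seq c * t | t <- l] = c * maxl l.
Proof.
move=> c0; elim: l => [|a [|b l] IH]; rewrite ?mulr0//.
by rewrite [LHS]maxl_cons maxl_cons maxr_pMr// -IH.
Qed.

Lemma Dval_scale (R : realType) n (a1 a2 b1 b2 c : R) x (vs : seq 'cV[R]_n) :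
  0 <= c -> Dval a1 a2 b1 b2 (vals (c *: x) vs) = c * Dval a1 a2 b1 b2 (vals x vs).
Proof.
move=> c0; rewrite /Dval !minl_valsN -scalerN.
have vE y : maxl (vals (c *: y) vs) = c * maxl (vals y vs).
  rewrite -maxl_scale// /vals -map_comp; congr maxl; apply: eq_map => v /=.
  by rewrite vdotZl.
have mE t : Num.max (c * t) 0 = c * Num.max t 0 by rewrite maxr_pMr// mulr0.
by rewrite !vE /Dpos /Dneg opprK -!mulrN !mE -?mulrN ?opprK; ring.
Qed.

Lemma Dval1 (R : realType) (a1 a2 b1 b2 t : R) :
  Dval a1 a2 b1 b2 [:: t] = a1 * Num.max t 0 + b1 * Num.max (- t) 0.
Proof. by rewrite /Dval /minl /= opprK /Dpos /Dneg; ring. Qed.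

Lemma Dval2 (R : realType) (a1 a2 b1 b2 s t : R) : s <= t ->
  Dval a1 a2 b1 b2 [:: s; t] = Dpos a2 b1 b2 t - Dneg a1 a2 b2 s.
Proof. by move=> st; rewrite /Dval /minl /= (max_r st) max_l ?lerN2// opprK. Qed.

Lemma Dpos_nneg (R : realType) (a2 b1 b2 t : R) : 0 <= t -> Dpos a2 b1 b2 t = a2 * t.
Proof. by move=> t0; rewrite /Dpos max_l// max_r ?oppr_le0// mulr0 subr0. Qed.

Lemma Dpos_npos (R : realType) (a2 b1 b2 t : R) : t <= 0 -> Dpos a2 b1 b2 t = (b2 - b1) * t.
Proof. by move=> t0; rewrite /Dpos max_r// max_l ?oppr_ge0//; ring. Qed.

Lemma Dneg_nneg (R : realType) (a1 a2 b2 t : R) : 0 <= t -> Dneg a1 a2 b2 t = (a2 - a1) * t.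
Proof. by move=> t0; rewrite /Dneg max_l// max_r ?oppr_le0// mulr0 subr0. Qed.

Lemma Dneg_npos (R : realType) (a1 a2 b2 t : R) : t <= 0 -> Dneg a1 a2 b2 t = b2 * t.
Proof. by move=> t0; rewrite /Dneg max_r// max_l ?oppr_ge0//; ring. Qed.

(** The cases [s -> 0] and [s -> +oo], made explicit by suitable values of [s]. *)
Lemma affine_ge0 (R : realType) (a b : R) :
  (forall s, 0 < s -> 0 <= a + s * b) -> 0 <= a /\ 0 <= b.
Proof.
move=> h; split; rewrite leNgt; apply/negP => lt0.
  have b0 : 0 < `|b| + 1 by rewrite ltr_wpDl.
  pose s := - a / (2 * (`|b| + 1)).
  have s0 : 0 < s by rewrite divr_gt0 ?oppr_gt0// mulr_gt0.
  have sE : s * (2 * (`|b| + 1)) = - a by rewrite divfK// gt_eqF// mulr_gt0.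
  have sb : s * b <= s * (`|b| + 1).
    by rewrite ler_pM2l//; have := ler_norm b; lra.
  by have := h s s0; lra.
pose s := (`|a| + 1) / - b.
have s0 : 0 < s by rewrite divr_gt0 ?oppr_gt0// ltr_wpDl.
have sE : s * b = - (`|a| + 1).
  by apply: oppr_inj; rewrite opprK -mulrN /s divfK// oppr_eq0 lt_eqF.
by have := h s s0; rewrite sE; have := ler_norm a; lra.
Qed.

Section StandardMoment.
Variables (R : realType) (n : nat).
Implicit Types (x y u v w : 'cV[R]_n) (i j : 'I_n).

Lemma lebesgue_int0 m : lebesgue_int ((fun=> 0%E) : 'cV[R]_m -> \bar R) = 0%E.
Proof.
elim: m => [//|m IH]; rewrite lebesgue_intS -[RHS](@integral0 _ _ _ lebesgue_measure setT).
by apply: eq_integral => t _; rewrite -IH; exact: eq_lebesgue_int.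
Qed.

(** The standard simplex lies in the positive orthant. Evaluating at a basis vector and at its
    negative thus separates the coefficients of the two moment bodies. *)
Lemma moment_stdN i : moment std (- delta_mx i 0 : 'cV[R]_n) = 0.
Proof.
rewrite /moment /moment_support (eq_lebesgue_int (G := fun=> 0%E)) ?lebesgue_int0// => y.
rewrite /moment_density indicE; have [|_] := boolP (y \in _); last by rewrite mul0r.
rewrite inE => /osimplexP[b _ yb]; rewrite max_r ?mulr0//.
rewrite -(mul0r b); apply: weighted_le yb => _ /mapP[j _ ->].
by rewrite vdotNl vdot_deltal mxE oppr_le0 ler0n.
Qed.

Lemma mem_std i : (delta_mx i 0 : 'cV[R]_n) \in std.
Proof. by apply: map_f; rewrite mem_enum. Qed.

Lemma weighted_std y : (forall i, 0 <= y i 0) -> weighted std (\sum_i y i 0) y.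
Proof.
move=> y0; rewrite [in X in weighted _ _ X](colE_sum y).
elim/big_rec2: _ => [|i z a _ za]; first exact: weighted0.
apply: weightedD => //; rewrite -[X in weighted _ X]mulr1; apply: weightedZ => //.
exact/weighted_mem/mem_std.
Qed.

(** The simplex contains a box with coordinates in [[b / 2, b]], [b] being the reciprocal of the
    dimension. Positivity permits the division that defines [c1] and [c2]. *)
Lemma moment_std_gt0 i : 0 < moment std (delta_mx i 0 : 'cV[R]_n).
Proof.
have n0 : (0 < n)%N by exact: leq_ltn_trans (ltn_ord i).
have n0' : 0 < n%:R :> R by rewrite ltr0n.
pose b : R := n%:R^-1; have b0 : 0 < b by rewrite invr_gt0.
have ab : b / 2 < b by rewrite ltr_pdivrMr//; lra.
have a0 : 0 < b / 2 by rewrite divr_gt0.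
have bT := borel_osimplex (@free_std R n).
rewrite fine_gt0// (moment_support_gt0 bT ab a0) /=.
- by have := moment_simplex_fin (delta_mx i 0) (@free_std R n);
    rewrite fin_numE => /andP[_]; rewrite -ltey.
- move=> y yb; apply/osimplexP; exists (\sum_j y j 0); last first.
    by apply: weighted_std => j; have /andP[h _] := yb j; apply: le_trans h; exact: ltW.
  apply: (@le_trans _ _ (\sum_(j < n) b)); first by apply: ler_sum => j _;
    have /andP[] := yb j.
  by rewrite sumr_const card_ord -[b *+ n]mulr_natr mulVf// gt_eqF.
- by move=> y yb; rewrite vdot_deltal; have /andP[] := yb i.
Qed.

End StandardMoment.

(** * Support functions of the values of an arbitrary valuation *)

Section Classification.
Variables (R : realType) (n : nat) (Z : set 'cV[R]_n -> set 'cV[R]_n).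
Hypotheses (n2 : (2 < n)%N)
  (ZB : forall T, is_osimplex T -> convex_body_o (Z T))
  (ZV : minkowski_valuation Z) (ZS : SLn_covariant Z).
Implicit Types (x y u v w : 'cV[R]_n) (vs ws r : seq 'cV[R]_n).

Let h vs x := support (Z (osimplex vs)) x.

Lemma osimplex_is vs : free vs -> is_osimplex (osimplex vs).
Proof. by exists vs. Qed.

Lemma cbody_Z vs : free vs -> cbody (Z (osimplex vs)).
Proof.
by move=> /osimplex_is/ZB[? [? ?]]; split=> //; exists 0.
Qed.

Lemma h_sublinear vs : free vs -> sublinear (h vs).
Proof. by move=> /cbody_Z[? _ ?]; exact: support_sublinear. Qed.

Lemma h_ge0 vs x : free vs -> 0 <= h vs x.
Proof.
move=> /osimplex_is/ZB[cZ [_ Z0]].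
by have := support_ub x cZ Z0; rewrite vdot0r.
Qed.

Lemma h_perm vs ws x : perm_eq vs ws -> h vs x = h ws x.
Proof. by move=> /perm_mem/eq_mem_osimplex p; rewrite /h p. Qed.

Lemma h_sl (A : 'M[R]_n) vs x : \det A = 1 -> free vs ->
  h [seq A *m v | v <- vs] x = h vs (A^T *m x).
Proof.
move=> dA fvs; rewrite /h -limage_osimplex ZS//; last exact: osimplex_is.
by rewrite support_limage//; exact: cbody_Z.
Qed.

Lemma h_cut v1 v2 r t x : free [:: v1, v2 & r] -> 0 < t -> t < 1 ->
  h [:: v1, v2 & r] x + h (mix t v1 v2 :: r) x =
  h [:: v1, mix t v1 v2 & r] x + h [:: mix t v1 v2, v2 & r] x.
Proof.
move=> fv t0 t1; have f1 := free_cut1 t0 fv; have f2 := free_cut2 t1 fv.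
have f3 := free_cut t fv.
have := ZV (osimplex_is f1) (osimplex_is f2).
rewrite (cut_union v1 v2 r t0 t1) (cut_inter t0 t1 fv).
move=> /(_ (osimplex_is fv) (osimplex_is f3)) /(congr1 (fun K => support K x)).
by rewrite !support_mink_sum; [|exact: cbody_Z..].
Qed.

(* [Z] of a simplex lies in its linear span: transvections fixing the simplex
   move anything outside of the span to infinity. *)
Lemma h_span vs x y : free vs -> (forall v, v \in vs -> vdot y v = 0) ->
  h vs (x + y) = h vs x.
Proof.
move=> fvs; have [hD hZ] := h_sublinear fvs.
have [->|y0] := eqVneq y 0; first by rewrite addr0.
(* The transvection built from [p] and [y'] fixes the simplex, and its transpose sends [z] to
   [z + y']. *)
have gen p z y' : vdot y' p = 0 -> vdot p z != 0 ->
    (forall v, v \in vs -> vdot y' v = 0) -> h vs (z + y') = h vs z.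
  move=> yp pz yvs; pose A := rank1 ((vdot p z)^-1 *: p) y'.
  have dA : \det A = 1 by rewrite det_rank1 vdotZr yp mulr0 addr0.
  have := h_sl z dA fvs; rewrite rank1_fix// => ->.
  by rewrite rank1_tr rank1E vdotZl mulVf// scale1r.
move=> yvs; have yy : vdot y y != 0 by rewrite vdot_eq0.
pose p := x - (vdot y x / vdot y y) *: y.
have yp : vdot y p = 0 by rewrite vdotBr vdotZr divfK// subrr.
have pp : vdot p x = vdot p p.
  by rewrite {3}/p vdotBr vdotZr (vdotC p y) yp mulr0 subr0.
have [p0|p0] := eqVneq p 0; last by apply: (gen p) => //; rewrite pp vdot_eq0.
have xE : x = (vdot y x / vdot y y) *: y by apply/eqP; rewrite -subr_eq0 -/p p0.
(* If [x] is a multiple of [y], no admissible [p] is at hand. For [z] orthogonal to [y],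
   subadditivity bounds [s * h vs (c *: y)] by [h vs z + h vs (- z)] for every positive [s]. *)
suff hy c : h vs (c *: y) = 0 by rewrite xE -[X in _ + X]scale1r -scalerDl !hy.
have fy : free [:: y] by rewrite seq1_free.
have [z z0 yz] := free_perp fy (ltn_trans (ltnSn 1) n2).
have {}yz : vdot z y = 0 by apply: yz; rewrite mem_head.
have hz b : h vs (z + b *: y) = h vs z.
  apply: (gen z); rewrite ?vdot_eq0//; first by rewrite vdotC vdotZr yz mulr0.
  by move=> v vvs; rewrite vdotZl yvs// mulr0.
apply/eqP; rewrite eq_le h_ge0// andbT -oppr_ge0.
apply: (affine_ge0 (a := h vs z + h vs (- z)) _).2 => s s0.
have := hD (z + (s * c) *: y) (- z); rewrite addrAC subrr add0r hz -scalerA hZ ?(ltW s0)//.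
by rewrite mulrN; lra.
Qed.

(** Below full dimension the determinant is corrected by a stretch [B] orthogonal to the simplex,
    which changes the argument only by a vector that [h_span] ignores. *)
Lemma h_gl (A : 'M[R]_n) vs x : A \in unitmx -> free vs -> (size vs < n)%N ->
  h [seq A *m v | v <- vs] x = h vs (A^T *m x).
Proof.
move=> Au fvs svs; have [u u0 uvs] := free_perp fvs svs.
have uu : vdot u u != 0 by rewrite vdot_eq0.
have dA : \det A != 0 by rewrite -unitfE -unitmxE.
pose B := rank1 ((((\det A)^-1 - 1) / vdot u u) *: u) u.
have dB : \det B = (\det A)^-1 by rewrite det_rank1 vdotZr divfK//; ring.
have dAB : \det (A *m B) = 1 by rewrite det_mulmx dB mulfV.
have := h_sl x dAB fvs.
have -> : [seq A *m B *m v | v <- vs] = [seq A *m v | v <- vs].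
  rewrite -[in RHS](rank1_fix ((((\det A)^-1 - 1) / vdot u u) *: u) uvs) -map_comp.
  by apply: eq_map => v /=; rewrite mulmxA.
move=> ->; rewrite trmx_mul -mulmxA rank1_tr rank1E h_span// => v vvs.
by rewrite vdotZl (uvs v)// mulr0.
Qed.

(** * Dimensions one and two, and the constants of D *)

Let i0 : 'I_n := Ordinal (ltn_trans (isT : (0 < 2)%N) n2).
Let i1 : 'I_n := Ordinal (ltn_trans (isT : (1 < 2)%N) n2).
Let i2 : 'I_n := Ordinal n2.
Let e0 : 'cV[R]_n := delta_mx i0 0.
Let e1 : 'cV[R]_n := delta_mx i1 0.

(** The four constants are read off where [Dval] isolates them, at the value lists [[:: 1]],
    [[:: -1]], [[:: 0; 1]] and [[:: -1; 0]]. *)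
Let a1 := h [:: e0] e0.
Let b1 := h [:: e0] (- e0).
Let a2 := h [:: e0; e1] e1.
Let b2 := h [:: e0; e1] (- e0).
Let D vs x := Dval a1 a2 b1 b2 (vals x vs).

Let e00 : vdot e0 e0 = 1. Proof. by rewrite vdot_deltal mxE !eqxx. Qed.
Let e11 : vdot e1 e1 = 1. Proof. by rewrite vdot_deltal mxE !eqxx. Qed.
Let e01 : vdot e0 e1 = 0. Proof. by rewrite vdot_deltal mxE. Qed.
Let e10 : vdot e1 e0 = 0. Proof. by rewrite vdotC. Qed.

Let free_e0 : free [:: e0].
Proof. by rewrite seq1_free -vdot_eq0 e00 oner_eq0. Qed.

Let free_e01 : free [:: e0; e1].
Proof.
apply: dual_free => c; exists (c 0%N *: e0 + c 1%N *: e1).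
by case=> [|[|]]//= _; rewrite vdotDl !vdotZl ?e00 ?e10 ?e01 ?e11; ring.
Qed.

Lemma h_dim1 v x : v != 0 -> h [:: v] x = D [:: v] x.
Proof.
move=> v0; have fv : free [:: v] by rewrite seq1_free.
have [V Vu [_ VE]] := free_complete fv.
have ve : v = V *m e0 by exact: (VE i0 isT).
have -> : h [:: v] x = h [:: e0] (V^T *m x).
  by rewrite -(@h_gl V [:: e0])//= ?ve// (ltn_trans _ n2).
have [hD hZ] := h_sublinear free_e0.
rewrite /D /= {1}ve vdot_mulmxr; move: (V^T *m x) => y; set t := vdot y e0.
have -> : h [:: e0] y = h [:: e0] (t *: e0).
  rewrite -[in LHS](subrK (t *: e0) y) addrC h_span// => w; rewrite inE => /eqP ->.
  by rewrite vdotBl vdotZl e00 mulr1 subrr.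
rewrite Dval1; have [t0|t0] := leP 0 t.
  by rewrite max_r ?oppr_le0// hZ// mulr0 addr0 mulrC.
rewrite max_l ?oppr_ge0 ?(ltW t0)// -[t]opprK scaleNr -scalerN hZ ?oppr_ge0 ?(ltW t0)//.
by rewrite opprK mulr0 add0r mulrC.
Qed.

Let f s t := h [:: e0; e1] (s *: e0 + t *: e1).

Lemma h_dim2E v1 v2 x : free [:: v1; v2] -> h [:: v1; v2] x = f (vdot x v1) (vdot x v2).
Proof.
move=> fv; have [V Vu [_ VE]] := free_complete fv.
have ve1 : v1 = V *m e0 by exact: (VE i0 isT).
have ve2 : v2 = V *m e1 by exact: (VE i1 isT).
have -> : h [:: v1; v2] x = h [:: e0; e1] (V^T *m x).
  by rewrite -(@h_gl V [:: e0; e1])//= ?ve1 ?ve2.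
rewrite ve1 ve2 !vdot_mulmxr /f; move: (V^T *m x) => y.
set z := (X in _ = h _ X).
rewrite -[in LHS](subrK z y) addrC h_span// => w; rewrite !inE => /orP[]/eqP ->.
  by rewrite /z !vdot_simp e00 e10; ring.
by rewrite /z !vdot_simp e01 e11; ring.
Qed.

Let fC s t : f s t = f t s.
Proof.
have fe10 : free [:: e1; e0].
  by rewrite (perm_free (perm_swap12 _ _ _)).
rewrite /f (h_perm _ (perm_swap12 _ _ _)).
by rewrite h_dim2E// /f !vdot_simp e00 e01 e10 e11; congr (h _ (_ *: _ + _ *: _)); ring.
Qed.

Let fZ c s t : 0 <= c -> f (c * s) (c * t) = c * f s t.
Proof.
by move=> c0; rewrite /f -!scalerA -scalerDr (h_sublinear free_e01).2.
Qed.

Let f_cut s t c : 0 < c -> c < 1 ->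
  f s t + Dval a1 a2 b1 b2 [:: (1 - c) * s + c * t] =
  f s ((1 - c) * s + c * t) + f ((1 - c) * s + c * t) t.
Proof.
move=> c0 c1; pose x := s *: e0 + t *: e1.
have x0 : vdot x e0 = s by rewrite /x !vdot_simp e00 e10; ring.
have x1 : vdot x e1 = t by rewrite /x !vdot_simp e01 e11; ring.
have := h_cut x free_e01 c0 c1.
rewrite (h_dim2E _ free_e01) (h_dim2E _ (free_cut1 c0 free_e01)).
rewrite (h_dim2E _ (free_cut2 c1 free_e01)).
have m0 : mix c e0 e1 != 0 by apply: free_neq0 (free_cut c free_e01) (mem_head _ _).
by rewrite h_dim1// /D /= !vdot_mix x0 x1.
Qed.

(** If both values agree, halving the edge reproduces [f t t] twice on the right and once on the
    left. *)
Let f_diag t : f t t = Dval a1 a2 b1 b2 [:: t].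
Proof.
have h0 : 0 < 2^-1 :> R by rewrite invr_gt0.
have h1 : 2^-1 < 1 :> R by rewrite invf_lt1// ltr1n.
have := f_cut t t h0 h1; have -> : (1 - 2^-1) * t + 2^-1 * t = t by field.
by lra.
Qed.

Let f_between s t (w : R) : s < w -> w < t ->
  f s t + Dval a1 a2 b1 b2 [:: w] = f s w + f w t.
Proof.
move=> sw wt; have st := lt_trans sw wt.
have := @f_cut s t ((w - s) / (t - s)).
have -> : (1 - (w - s) / (t - s)) * s + (w - s) / (t - s) * t = w.
  by field; rewrite subr_eq0 gt_eqF.
apply; first by rewrite divr_gt0// subr_gt0.
by rewrite ltr_pdivrMr ?subr_gt0// mul1r ltrD2r.
Qed.

Let f0t t : 0 <= t -> f 0 t = t * a2.
Proof.
by move=> t0; rewrite -[in LHS](mulr1 t) -[in LHS](mulr0 t) fZ// /f scale0r scale1r add0r.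
Qed.

Let fs0 s : s <= 0 -> f s 0 = - s * b2.
Proof.
move=> s0; have -> : f s 0 = f (- s * -1) (- s * 0) by rewrite mulr0 mulrNN mulr1.
by rewrite fZ ?oppr_ge0// /f scale0r scaleN1r addr0.
Qed.

(** Values of opposite sign are cut at 0. For equal signs, a segment reaching from the farther value
    to 0 is cut at the nearer one, so that only the known values of [f] on the axes remain. *)
Let fE s t : s <= t -> f s t = Dval a1 a2 b1 b2 [:: s; t].
Proof.
move=> st; rewrite Dval2// /Dpos /Dneg.
have [->|sNt] := eqVneq s t; first by rewrite f_diag Dval1; ring.
have {}st : s < t by rewrite lt_neqAle sNt.
have [t0|t0] := leP t 0.
  have s0 : s < 0 by exact: lt_le_trans t0.
  rewrite (max_r (ltW s0)) !max_l ?oppr_ge0 ?(ltW s0)//.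
  have [->|tN0] := eqVneq t 0; first by rewrite fs0 ?(ltW s0)//; ring.
  have {}t0 : t < 0 by rewrite lt_neqAle tN0.
  have := f_between st t0; rewrite fs0 ?(ltW s0)// fs0 ?(ltW t0)// Dval1.
  by rewrite (max_r (ltW t0)) max_l ?oppr_ge0 ?(ltW t0)//; lra.
have [s0|s0] := ltP s 0.
  have := f_between s0 t0; rewrite fs0 ?(ltW s0)// f0t ?(ltW t0)// Dval1.
  rewrite oppr0 maxxx !mulr0 !addr0 => ->.
  by rewrite (max_r (x := - t)) ?oppr_le0 ?(ltW t0)// max_l ?oppr_ge0 ?(ltW s0)//; ring.
rewrite !(max_r (x := - _)) ?oppr_le0 ?(ltW t0)//.
have [->|sN0] := eqVneq s 0; first by rewrite f0t ?(ltW t0)//; ring.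
have {}s0 : 0 < s by rewrite lt_neqAle eq_sym sN0.
have := f_between s0 st; rewrite f0t ?(ltW t0)// f0t ?(ltW s0)// Dval1.
by rewrite (max_l (ltW s0)) max_r ?oppr_le0 ?(ltW s0)//; lra.
Qed.

Lemma h_dim2 v1 v2 x : free [:: v1; v2] -> h [:: v1; v2] x = D [:: v1; v2] x.
Proof.
move=> fv; rewrite h_dim2E// /D /=.
have [st|ts] := leP (vdot x v1) (vdot x v2); first exact: fE.
rewrite fC fE ?(ltW ts)//; apply: Dval_perm => t.
by rewrite !inE orbC.
Qed.

(** * Dimensions below the top *)

Lemma D_cut v1 v2 r t x : 0 < t -> t < 1 ->
  D [:: v1, v2 & r] x + D (mix t v1 v2 :: r) x =
  D [:: v1, mix t v1 v2 & r] x + D [:: mix t v1 v2, v2 & r] x.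
Proof.
move=> t0 t1; apply: Dval_cut; rewrite vdot_mix.
have [st|ts] := leP (vdot x v1) (vdot x v2); [left|right].
  have := mulr_ge0 (ltW t0) (_ : 0 <= vdot x v2 - vdot x v1).
  have := mulr_ge0 (_ : 0 <= 1 - t) (_ : 0 <= vdot x v2 - vdot x v1).
  by rewrite !subr_ge0 (ltW t1) st => /(_ isT isT) h1 /(_ isT) h2; apply/andP; split; lra.
have := mulr_ge0 (ltW t0) (_ : 0 <= vdot x v1 - vdot x v2).
have := mulr_ge0 (_ : 0 <= 1 - t) (_ : 0 <= vdot x v1 - vdot x v2).
by rewrite !subr_ge0 (ltW t1) (ltW ts) => /(_ isT isT) h1 /(_ isT) h2; apply/andP; split;
  lra.
Qed.

Lemma D_perm vs ws x : perm_eq vs ws -> D vs x = D ws x.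
Proof. by move=> p; apply: Dval_perm; apply: perm_mem; exact: perm_map. Qed.

Lemma D_map (A : 'M[R]_n) vs x : D [seq A *m v | v <- vs] x = D vs (A^T *m x).
Proof. by rewrite /D vals_map. Qed.

Lemma h_low vs x : free vs -> (size vs < n)%N -> h vs x = D vs x.
Proof.
have [m] := ubnP (size vs); elim: m vs x => // m IH vs x svm fvs svs.
case: vs => [|v1 [|v2 [|v3 r]]] in svm fvs svs *.
- rewrite /D /Dval /minl /= oppr0 /Dpos /Dneg !oppr0 maxxx !mulr0 subrr.
  have := sublinear0 (h_sublinear fvs) => <-.
  by rewrite -[in LHS](add0r x) h_span.
- by apply: h_dim1; rewrite -seq1_free.
- exact: h_dim2.
move: [:: v1, v2, v3 & r] svm fvs svs (isT : (2 < size [:: v1, v2, v3 & r])%N) => us svm fvs svs su.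
apply/eqP; rewrite -subr_eq0; apply/eqP.
pose E vs x := h vs x - D vs x.
have EP : perm_invariant (size us) E.
  by move=> vs ws y _ _ p; rewrite /E (h_perm _ p) (D_perm _ p).
have EG (A : 'M[R]_n) vs y : A \in unitmx -> free vs -> size vs = size us ->
    E [seq A *m v | v <- vs] y = E vs (A^T *m y).
  by move=> Au fv sv; rewrite /E h_gl ?sv// D_map.
have EC : cut_additive (size us) E.
  move=> w1 w2 s t y fw sw t0 t1; have hc := h_cut y fw t0 t1.
  have dc := D_cut w1 w2 s y t0 t1.
  have ih : h (mix t w1 w2 :: s) y = D (mix t w1 w2 :: s) y.
    apply: IH; [|exact: free_cut|].
      by rewrite /= -ltnS sw.
    by rewrite /= sw ltnW.
  by rewrite /E; lra.
suff : E us x = 0 by [].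
apply: (cut_additive_eq0 su EP EC) => // w1 w2 s y fw sw y12.
have t0 : 0 < 2^-1 :> R by rewrite invr_gt0.
have t1 : 2^-1 < 1 :> R by rewrite invf_lt1// ltr1n.
(* By [h_gl] no determinant factor appears, so each half of the cut simplex has the same [E] as the
   whole; additivity then forces [E] to vanish. *)
have pair u1 u2 : free [:: u1, u2 & s] -> vdot y u1 = vdot y u2 ->
    E [:: u1, mix 2^-1 u1 u2 & s] y = E [:: u1, u2 & s] y.
  move=> fu u12; have [A [dA AE Ay]] := shear 2^-1 fu.
  by rewrite -AE EG ?Ay// unitmxE dA unitfE gt_eqF.
have p21 := perm_swap12 w1 w2 s.
have f21 : free [:: w2, w1 & s] by rewrite -(perm_free p21).
have := EC _ _ _ _ y fw sw t0 t1; rewrite pair//.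
have -> : E [:: mix 2^-1 w1 w2, w2 & s] y = E [:: w1, w2 & s] y.
  rewrite (EP _ _ _ (free_cut2 t1 fw) sw (perm_swap12 _ _ _)).
  rewrite -/(mix _ _ _) mixC; have -> : 1 - 2^-1 = 2^-1 :> R by field.
  by rewrite pair// -(EP _ _ _ fw sw p21).
lra.
Qed.

(** * Inequalities between the constants and the top dimension *)

Lemma f_subadditive s t s' t' : f (s + s') (t + t') <= f s t + f s' t'.
Proof.
rewrite /f; apply: le_trans ((h_sublinear free_e01).1 _ _).
by rewrite le_eqVlt; apply/orP; left; apply/eqP; congr (h _ _); rewrite !scalerDl addrACA.
Qed.

Let a1_ge0 : 0 <= a1. Proof. exact: h_ge0. Qed.
Let b1_ge0 : 0 <= b1. Proof. exact: h_ge0. Qed.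

Let f11 : f 1 1 = a1.
Proof. by rewrite f_diag Dval1 max_l// max_r ?oppr_le0//; ring. Qed.

Let fN11 : f (-1) (-1) = b1.
Proof. by rewrite f_diag Dval1 opprK max_r ?oppr_le0// max_l//; ring. Qed.

(** Subadditivity of [f] for (0, 1) = (1, 1) + (-1, 0). *)
Let a2_le : a2 - a1 <= b2.
Proof.
have := f_subadditive 1 1 (-1) 0; rewrite subrr addr0 f11 f0t// fs0 ?oppr_le0//.
by rewrite opprK !mul1r; lra.
Qed.

Let b2_le : b2 - b1 <= a2.
Proof.
have := f_subadditive (-1) (-1) 0 1; rewrite addr0 addNr fN11 f0t// fs0 ?oppr_le0//.
by rewrite opprK !mul1r; lra.
Qed.

Let E vs x := h vs x - D vs x.

Let E_perm : perm_invariant n E.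
Proof. by move=> vs ws x _ _ p; rewrite /E (h_perm _ p) (D_perm _ p). Qed.

Let E_cut : cut_additive n E.
Proof.
move=> v1 v2 r t x fv sv t0 t1; have hc := h_cut x fv t0 t1.
have dc := D_cut v1 v2 r x t0 t1.
have hl : h (mix t v1 v2 :: r) x = D (mix t v1 v2 :: r) x.
  by apply: h_low; [exact: free_cut|exact: (eq_leq sv)].
by rewrite /E; lra.
Qed.

Let E_sl : sl_covariant n E.
Proof. by move=> A vs x dA fvs _; rewrite /E h_sl// D_map. Qed.

Let E_gl : gl_homogeneous n E.
Proof.
apply: (sl_gl_homogeneous (b := Dval a1 a2 b1 b2) n2) => //.
by move=> vs x fvs _; rewrite /E lerBrDr addrC -[X in X <= _]/(D vs x - D vs x) subrr h_ge0.
Qed.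

(** Stretching the standard simplex to determinant [s] scales [E] but not [D]. Small [s] thus
    isolates [D] and large [s] isolates [E], each inheriting properties of support functions. *)
Lemma h_stretched s x : 0 < s -> exists B : 'M[R]_n, exists2 vs, free vs &
  forall y, h vs (B *m y) = D std y + s * E std y.
Proof.
move=> s0; pose A := rank1 ((s - 1) *: e0) e0.
have dA : \det A = s by rewrite det_rank1 vdotZr e00; ring.
have Au : A \in unitmx by rewrite unitmxE dA unitfE gt_eqF.
exists (invmx A)^T, [seq A *m v | v <- std]; first exact: free_map_unit Au (@free_std R n).
move=> y; have key : A^T *m ((invmx A)^T *m y) = y.
  by rewrite mulmxA -trmx_mul mulVmx// trmx1 mul1mx.
have := E_gl ((invmx A)^T *m y) (_ : 0 < \det A) (@free_std R n) (@size_std R n).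
rewrite dA => /(_ s0); rewrite key /E D_map key => <-.
by rewrite addrC subrK.
Qed.

Let E_std_ge0 y : 0 <= E std y.
Proof.
apply: (affine_ge0 (a := D std y) _).2 => s s0.
have [B [vs fvs hE]] := h_stretched 0 s0.
by rewrite -hE h_ge0.
Qed.

Let D_std_subadditive y z : D std (y + z) <= D std y + D std z.
Proof.
rewrite -subr_ge0.
apply: (affine_ge0 (b := E std y + E std z - E std (y + z)) _).1 => s s0.
have [B [vs fvs hE]] := h_stretched 0 s0.
have := (h_sublinear fvs).1 (B *m y) (B *m z).
by rewrite -mulmxDr !hE; lra.
Qed.

Let peak (a b c : R) : 'cV[R]_n :=
  \col_i (if i == i0 then a else if i == i1 then b else c).

Let peakD a b c a' b' c' :
  peak a b c + peak a' b' c' = peak (a + a') (b + b') (c + c').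
Proof. by apply/colP => i; rewrite !mxE; case: ifP => // _; case: ifP. Qed.

Let D_peak a b c M m : M \in [:: a; b; c] -> m \in [:: a; b; c] ->
  (forall t, t \in [:: a; b; c] -> m <= t <= M) ->
  D std (peak a b c) = Dpos a2 b1 b2 M - Dneg a1 a2 b2 m.
Proof.
move=> Mabc mabc bnd.
have vE : vals (peak a b c) std =i [:: a; b; c].
  move=> t; apply/mapP/idP => [[_ /mapP[i _ ->] ->]|].
    rewrite vdot_deltar mxE !inE; case: ifP => _; first by rewrite eqxx.
    by case: ifP => _; rewrite eqxx ?orbT.
  rewrite !inE => /or3P[]/eqP ->.
  - by exists (delta_mx i0 0); rewrite ?mem_std// vdot_deltar mxE.
  - by exists (delta_mx i1 0); rewrite ?mem_std// vdot_deltar mxE.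
  - by exists (delta_mx i2 0); rewrite ?mem_std// vdot_deltar mxE.
rewrite /D (Dval_perm _ _ _ _ vE) /Dval (maxlE Mabc); last by move=> t /bnd/andP[].
congr (_ - Dneg _ _ _ _); rewrite /minl (maxlE (a := - m)) ?opprK//.
  exact: (map_f (fun t => - t) mabc).
by move=> _ /mapP[t /bnd/andP[h1 _] ->]; rewrite lerN2.
Qed.

(* The minimum of three coordinates is not convex, which determines the sign
   of its coefficient in the support function. *)
Let a1_le : a1 <= a2.
Proof.
(* In (1, 0, 2) + (0, 1, 2) = (1, 1, 4) the maxima add up while the minimum jumps from 0 to 1,
   leaving exactly the sign of [a2 - a1]. *)
have Dp : D std (peak 1 0 2) = Dpos a2 b1 b2 2 - Dneg a1 a2 b2 0.
  apply: D_peak; rewrite ?inE ?eqxx ?orbT// => t.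
  by rewrite !inE => /or3P[]/eqP ->; apply/andP; split; lra.
have Dq : D std (peak 0 1 2) = Dpos a2 b1 b2 2 - Dneg a1 a2 b2 0.
  apply: D_peak; rewrite ?inE ?eqxx ?orbT// => t.
  by rewrite !inE => /or3P[]/eqP ->; apply/andP; split; lra.
have Dpq : D std (peak 1 1 4) = Dpos a2 b1 b2 4 - Dneg a1 a2 b2 1.
  apply: D_peak; rewrite ?inE ?eqxx ?orbT// => t.
  by rewrite !inE => /or3P[]/eqP ->; apply/andP; split; lra.
have := D_std_subadditive (peak 1 0 2) (peak 0 1 2); rewrite peakD.
have -> : peak (1 + 0) (0 + 1) (2 + 2) = peak 1 1 4 by congr peak; ring.
rewrite Dp Dq Dpq !Dpos_nneg ?Dneg_nneg//.
by lra.
Qed.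

(** The reflected vectors: now the minima add up and the maximum drops from 0 to -1, where its
    coefficient is [b2 - b1]. *)
Let b1_le : b1 <= b2.
Proof.
have Dp : D std (peak (-1) 0 (-2)) = Dpos a2 b1 b2 0 - Dneg a1 a2 b2 (-2).
  apply: D_peak; rewrite ?inE ?eqxx ?orbT// => t.
  by rewrite !inE => /or3P[]/eqP ->; apply/andP; split; lra.
have Dq : D std (peak 0 (-1) (-2)) = Dpos a2 b1 b2 0 - Dneg a1 a2 b2 (-2).
  apply: D_peak; rewrite ?inE ?eqxx ?orbT// => t.
  by rewrite !inE => /or3P[]/eqP ->; apply/andP; split; lra.
have Dpq : D std (peak (-1) (-1) (-4)) = Dpos a2 b1 b2 (-1) - Dneg a1 a2 b2 (-4).
  apply: D_peak; rewrite ?inE ?eqxx ?orbT// => t.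
  by rewrite !inE => /or3P[]/eqP ->; apply/andP; split; lra.
have := D_std_subadditive (peak (-1) 0 (-2)) (peak 0 (-1) (-2)); rewrite peakD.
have -> : peak (-1 + 0) (0 + -1) (-2 + -2) = peak (-1) (-1) (-4) by congr peak; ring.
rewrite Dp Dq Dpq !Dpos_npos ?oppr_le0// !Dneg_npos ?oppr_le0//.
by lra.
Qed.

(** Since the moment vanishes at [- e0], dividing by [kappa] matches the defect [E] at [e0] through
    [c1] alone and at [- e0] through [c2] alone. *)
Let kappa := moment std e0.
Let c1 := E std e0 / kappa.
Let c2 := E std (- e0) / kappa.

Let kappa_gt0 : 0 < kappa. Proof. exact: moment_std_gt0. Qed.
Let c1_ge0 : 0 <= c1. Proof. by rewrite divr_ge0// ltW. Qed.
Let c2_ge0 : 0 <= c2. Proof. by rewrite divr_ge0// ltW. Qed.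

Lemma moment_cut v1 v2 r t x : free [:: v1, v2 & r] -> (size r).+2 = n ->
  0 < t -> t < 1 -> moment [:: v1, v2 & r] x =
  moment [:: v1, mix t v1 v2 & r] x + moment [:: mix t v1 v2, v2 & r] x.
Proof.
move=> fv sv t0 t1; have f1 := free_cut1 t0 fv; have f2 := free_cut2 t1 fv.
have f3 := free_cut t fv.
rewrite -(moment_valuation x f1 f2 fv f3).
- by rewrite (moment_lower x f3) ?addr0//; exact: (eq_leq sv).
- by rewrite (cut_union v1 v2 r t0 t1).
- by rewrite (cut_inter t0 t1 fv).
Qed.

Lemma h_top vs x : free vs -> size vs = n ->
  h vs x = c1 * moment vs x + c2 * moment vs (- x) + D vs x.
Proof.
pose F vs x := E vs x - (c1 * moment vs x + c2 * moment vs (- x)).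
have ms := moment_sublinear (@free_std R n); have mns := sublinearN ms.
have hs := h_sublinear (@free_std R n).
move=> fvs svs; suff : F vs x = 0 by rewrite /F /E; lra.
(* [E] and both moment terms are additive under cuts and homogeneous in the determinant, so their
   difference is governed by the two values at [e0] and [- e0], which vanish by the choice of [c1]
   and [c2]. *)
apply: (@functional_eq0 _ _ F _ _ _ n2 _ _ i0) => //.
- move=> us ws y fus sus p; rewrite /F (E_perm _ fus sus p).
  by rewrite !(moment_perm _ (perm_mem p)).
- move=> v1 v2 r t y fv sv t0 t1; rewrite /F (E_cut _ fv sv t0 t1).
  by rewrite (moment_cut y fv sv t0 t1) (moment_cut (- y) fv sv t0 t1); ring.
- move=> A us y dA fus sus; rewrite /F E_gl//.
  have Au : A \in unitmx by rewrite unitmxE unitfE gt_eqF.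
  by rewrite !moment_map// gtr0_norm// mulmxN; ring.
- move=> c y c0; rewrite /F /E /D Dval_scale// -(scalerN c y) (hs.2 _ y c0).
  by rewrite (ms.2 _ y c0) (ms.2 _ (- y) c0); ring.
- apply: dir_lipschitzD.
    apply: dir_lipschitzD; first exact: sublinear_dir_lipschitz.
    exact/dir_lipschitzN/dir_lipschitz_Dval.
  apply/dir_lipschitzN/dir_lipschitzD; apply: dir_lipschitzZ;
  by apply: sublinear_dir_lipschitz.
- by rewrite /F moment_stdN mulr0 addr0 /c1 divfK ?subrr// gt_eqF.
- by rewrite /F moment_stdN mulr0 add0r opprK /c2 divfK ?subrr// gt_eqF.
Qed.

Lemma valuation_classification : exists a1 a2 b1 b2 c1 c2 : R,
  [/\ 0 <= a1, 0 <= a2, 0 <= b1 & 0 <= b2] /\ 0 <= c1 /\ 0 <= c2 /\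
  [/\ a1 <= a2, b1 <= b2, a2 - a1 <= b2 & b2 - b1 <= a2] /\
  forall vs, free vs -> Z (osimplex vs) = combination a1 a2 b1 b2 c1 c2 vs.
Proof.
exists a1, a2, b1, b2, c1, c2.
split; first by split=> //; [exact: le_trans a1_le|exact: le_trans b1_le].
do 2!split=> //; split=> // vs fvs.
apply: support_inj; [exact: cbody_Z|exact: cbody_combination|move=> x].
rewrite support_combination// -[LHS]/(h vs x).
have [V _ [svs _]] := free_complete fvs.
have [svn|svn] := ltnP (size vs) n.
  by rewrite h_low// !moment_lower// !mulr0 !add0r.
by apply: h_top => //; apply/eqP; rewrite eqn_leq svs.
Qed.

End Classification.

Theorem theorem5p11 (R : realType) (n : nat) (Z : set 'cV[R]_n -> set 'cV[R]_n) :
  (3 <= n)%N ->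
  (forall T, is_osimplex T -> convex_body_o (Z T)) ->
  (minkowski_valuation Z /\ SLn_covariant Z) <->
  (exists a1 a2 b1 b2 c1 c2 : R,
     [/\ 0 <= a1, 0 <= a2, 0 <= b1 & 0 <= b2] /\ 0 <= c1 /\ 0 <= c2 /\
     [/\ a1 <= a2, b1 <= b2, a2 - a1 <= b2 & b2 - b1 <= a2] /\
     forall vs : seq 'cV[R]_n, free vs ->
       Z (osimplex vs) =
       mink_sum (mink_sum (bscale c1 (Mplus (osimplex vs)))
                  (bscale c2 (Mminus (osimplex vs))))
            (Dbody a1 a2 b1 b2 vs)).
Proof.
move=> n2 ZB; split=> [[ZV ZS]|]; first exact: valuation_classification.
move=> [a1 [a2 [b1 [b2 [c1 [c2 [[a10 _ b10 _] [c10 [c20 [[a12 b12 a21b b21a] ZE]]]]]]]]]].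
have {}ZE vs : free vs -> Z (osimplex vs) = combination a1 a2 b1 b2 c1 c2 vs by exact: ZE.
split; [exact: combination_valuation ZE|exact: combination_covariant ZE].
Qed.
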